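(* Let the characteristic $p$ be arbitrary, and fix $\bar\lambda\in\mathbb{F}_q^*$. Let $\omega_0,\dots,\omega_n$ be the eigenvalues of the $\Omega_0$-linear map induced by $\alpha_0$ on $H^n(\Omega^\bullet_{\mathcal{C}_0},\nabla(D))\otimes\Omega_0$ (the setting is described in the context). Then these eigenvalues are integers in $\mathbb{Z}_p[\zeta_p]$ and may be ordered so that \[ \frac{\omega_i}{q^i}\equiv1\pmod{\gamma},\qquad 0\le i\le n. \]
   Context: $p$ prime, $q=p^a$, $n\ge1$. For $u\in\mathbb{Z}^n$, $m(u)=\max\{0,-u_1,\dots,-u_n\}$, $w(u)=\sum_iu_i+(n+1)m(u)$. $\mathbb{Q}_q$ is the unramified extension of $\mathbb{Q}_p$ of degree $a$, $\zeta_p$ a primitive $p$-th root of unity, $\Omega_0=\mathbb{Q}_q(\zeta_p)$, $\mathcal{O}_0=\mathbb{Z}_q[\zeta_p]$; $\sigma$ is the Frobenius generator of $\mathrm{Gal}(\mathbb{Q}_q/\mathbb{Q}_p)$ extended by $\sigma(\zeta_p)=\zeta_p$. Fix $\gamma$ a zero of $\sum_{j\ge0}t^{p^j}/p^j$ with $\mathrm{ord}_p\gamma=1/(p-1)$; congruence mod $\gamma$ means modulo $\gamma$ times the ring of integers; $\gamma_m=\sum_{j=0}^m\gamma^{p^j}/p^j$. $\lambda$ is the Teichmüller lift of $\bar\lambda$. $\mathcal{C}_0=\{\sum_u\xi(u)\gamma^{w(u)}x^u:\xi(u)\in\mathcal{O}_0,\ \xi(u)\to0\}$. $\theta_\infty(t)=\mathrm{AH}(\gamma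 t)$ with $\mathrm{AH}(t)=\exp(\sum_{j\ge0}t^{p^j}/p^j)$; $F_\lambda(x)=\theta_\infty(\lambda/(x_1\cdots x_n))\prod_{j=1}^n\theta_\infty(x_j)$; $\psi(x^u)=x^{u/p}$ if $p$ divides all $u_i$, else $0$; $\alpha_1=\sigma^{-1}\circ\psi\circ F_\lambda(x)$ and $\alpha_0=\alpha_1^a$ (an $\Omega_0$-linear completely continuous operator on $\mathcal{C}_0$). For $1\le l\le n$, $D_l=x_l\frac{\partial}{\partial x_l}+\sum_{m\ge0}p^m\gamma_m\big(x_l^{p^m}-\lambda^{p^m}(x_1\cdots x_n)^{-p^m}\big)$; the complex $(\Omega^\bullet_{\mathcal{C}_0},\nabla(D))$ has $\Omega^i_{\mathcal{C}_0}=\bigoplus_{j_1<\cdots<j_i}\mathcal{C}_0\frac{dx_{j_1}}{x_{j_1}}\wedge\cdots\wedge\frac{dx_{j_i}}{x_{j_i}}$, $\nabla(D)(\xi\omega)=(\sum_lD_l(\xi)\frac{dx_l}{x_l})\wedge\omega$, so $H^n=\mathcal{C}_0/\sum_lD_l\mathcal{C}_0$. Since $qD_l\circ\alpha_0=\alpha_0\circ D_l$, $\alpha_0$ induces an endomorphism of $H^n$ (this is the map induced by the Frobenius chain map $\mathrm{Frob}_0^\bullet$, which in degree $i$ is $q^{n-i}\alpha_0$, in top degree $n$). *)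

(* Defs.v *)
From HB Require Import structures.
From mathcomp Require Import all_boot all_order all_algebra all_field.
From mathcomp Require Import classical_sets constructive_ereal.

Set Implicit Arguments.
Unset Strict Implicit.
Unset Printing Implicit Defensive.

Import Order.TTheory GRing.Theory Num.Theory.
Local Open Scope ring_scope.

(* Additive valuations, with value +oo exactly at 0.  The value -oo is excluded
   as soon as some element has a finite value. *)
Definition valuation (F : fieldType) (v : F -> \bar rat) : Prop :=
  [/\ forall x, (v x == +oo%E) = (x == 0),
      forall x y, v (x * y) = (v x + v y)%E
    & forall x y, (Order.min (v x) (v y) <= v (x + y)%R)%E].

Definition complete_valuation (F : fieldType) (v : F -> \bar rat) : Prop :=
  forall s : nat -> F,
    (forall N : nat, exists m0, forall m1 m2, (m0 <= m1)%N -> (m0 <= m2)%N ->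
       (N%:R%:E <= v (s m1 - s m2)%R)%E) ->
    exists l, forall N : nat, exists m0, forall m, (m0 <= m)%N ->
       (N%:R%:E <= v (s m - l)%R)%E.

(* F is the completion of the rationals at p, and v is ord_p. *)
Definition padic_numbers (p : nat) (F : fieldType) (v : F -> \bar rat) : Prop :=
  [/\ valuation v,
      v p%:R = 1%:E,
      complete_valuation v
    & forall (x : F) (N : nat), exists r : rat, (N%:R%:E <= v (x - ratr r)%R)%E].

Section Summation.
Variables (K : fieldType) (ord : K -> \bar rat) (I : eqType).

(* Convergence to 0 along the complements of finite sets of indices. *)
Definition tends_to_0 (s : I -> K) : Prop :=
  forall N : nat, exists S0 : seq I, forall i, i \notin S0 ->
    (N%:R%:E <= ord (s i))%E.

Definition has_sum (s : I -> K) (l : K) : Prop :=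
  forall N : nat, exists S0 : seq I, forall S : seq I,
    uniq S -> {subset S0 <= S} ->
    (N%:R%:E <= ord (l - \sum_(i <- S) s i)%R)%E.

(* Junk value 0 when the family is not summable. *)
Definition infsum (s : I -> K) : K := xget 0 (has_sum s).

End Summation.

Section Fields.
Variables (Qp : fieldType) (K : fieldExtType Qp) (ord : K -> \bar rat).

Definition integers_of (E : {subfield K}) : {pred K} :=
  [pred x | (x \in E) && (0%:E <= ord x)%E].

(* Every nonzero value taken on E is taken on Qp: ramification index 1. *)
Definition unramified (E : {subfield K}) : Prop :=
  forall x, x \in E -> x != 0 -> exists y : Qp, ord x = ord (y%:A).

Definition adjoin (A : {pred K}) (z x : K) : Prop :=
  exists2 P : {poly K}, P \is a polyOver A & x = P.[z].

(* red exhibits k as the residue field of A; only its values on A matter. *)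
Definition residue_map (A : {pred K}) (k : fieldType) (red : K -> k) : Prop :=
  [/\ red 1 = 1,
      {in A &, forall x y, red (x + y) = red x + red y},
      {in A &, forall x y, red (x * y) = red x * red y},
      {in A, forall x, (red x == 0) = (0%:E < ord x)%E}
    & forall y, exists2 x, x \in A & red x = y].

End Fields.

Definition congr_mod (K : fieldType) (O : K -> Prop) (c x y : K) : Prop :=
  exists2 z, O z & x - y = c * z.

(* For subspaces A and B of the space of functions T -> K and f linear on A:
   B is contained in A, f induces an endomorphism of A / B, the dimension of A / B
   is d, and the characteristic polynomial is \prod_i ('X - omega i).  Here e is
   a basis of A modulo B and M the matrix (on row vectors) of the induced map. *)
Definition quotient_eigenvalues (K : fieldType) (T : Type)
    (A B : (T -> K) -> Prop) (f : (T -> K) -> (T -> K))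
    (d : nat) (omega : 'I_d -> K) : Prop :=
  [/\ forall v, B v -> A v,
      forall v, A v -> A (f v),
      forall v, B v -> B (f v)
    & exists (e : 'I_d -> T -> K) (M : 'M[K]_d),
      [/\ forall i, A (e i),
          forall c : 'I_d -> K,
            B (fun u => \sum_i c i * e i u) -> forall i, c i = 0,
          forall v, A v ->
            exists c : 'I_d -> K, B (fun u => v u - \sum_i c i * e i u),
          forall i, B (fun u => f (e i) u - \sum_j M i j * e j u)
        & char_poly M = \prod_i ('X - (omega i)%:P)]].

(* For A a torsion-free module over a domain with fraction field K, inside a
   K-space of functions, this is its K-span, i.e. A tensored with K. *)
Definition extend_scalars (K : fieldType) (T : Type) (A : (T -> K) -> Prop)
    (v : T -> K) : Prop :=
  exists2 c : K, c != 0 & A (fun u => c * v u).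

Section Dwork.
Variables (p n : nat) (Qp : fieldType) (K : fieldExtType Qp).
Variables (ord : K -> \bar rat) (gamma lambda : K).

Notation expo := {ffun 'I_n -> int}.
(* The Laurent series \sum_u f(u) x^u. *)
Notation laurent := (expo -> K).

Definition mfun (u : expo) : int := \big[Num.max/0]_(i < n) (- u i).
Definition weight (u : expo) : int := \sum_i u i + (mfun u) *+ n.+1.

(* Zero of \sum_j t^(p^j) / p^j with ord_p = 1 / (p - 1). *)
Definition is_gamma : Prop :=
  has_sum ord (fun j : nat => gamma ^+ (p ^ j) / p%:R ^+ j) 0
  /\ ord gamma = ((p.-1)%:R^-1)%:E.

Definition gamma_ (m : nat) : K :=
  \sum_(j < m.+1) gamma ^+ (p ^ j) / p%:R ^+ j.

(* k-th coefficient of AH(t) = exp (\sum_j t^(p^j) / p^j).  The exponent has no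
   constant term and p^j > k for j > k, so truncating both sums at k does not
   affect this coefficient. *)
Definition AH (k : nat) : K :=
  (\sum_(m < k.+1)
     (m`!%:R)^-1 *: (\sum_(j < k.+1) (p%:R ^+ j)^-1 *: 'X^(p ^ j)) ^+ m
   : {poly K})`_k.

Definition theta (k : nat) : K := AH k * gamma ^+ k.

(* theta_oo (c x^v) = \sum_k theta_k c^k x^(k v). *)
Definition theta_at (c : K) (v : expo) : laurent :=
  fun u => infsum ord (fun k : nat => (v *+ k == u)%:R * (theta k * c ^+ k)).

Definition lmul (f g : laurent) : laurent :=
  fun u => infsum ord (fun v : expo => f v * g (u - v)).
Definition lone : laurent := fun u => (u == 0)%:R.

Definition evec (l : 'I_n) : expo := [ffun i => (i == l)%:R].
Definition ones : expo := [ffun=> 1].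

Definition Fseries : laurent :=
  lmul (theta_at lambda (- ones))
       (\big[lmul/lone]_(j < n) theta_at 1 (evec j)).

(* x^u |-> x^(u/p), or 0 if p does not divide u. *)
Definition psi (f : laurent) : laurent := fun u => f (u *+ p).

Definition alpha1 (sigma : 'AEnd(K)) (f : laurent) : laurent :=
  fun u => (sigma^-1)%VF (psi (lmul Fseries f) u).

Definition alpha0 (sigma : 'AEnd(K)) (a : nat) (f : laurent) : laurent :=
  iter a (alpha1 sigma) f.

Definition Dop (l : 'I_n) (f : laurent) : laurent := fun u =>
  (u l)%:~R * f u
  + infsum ord (fun m : nat => p%:R ^+ m * gamma_ m *
      (f (u - evec l *+ (p ^ m))
       - lambda ^+ (p ^ m) * f (u + ones *+ (p ^ m)))).

Definition C0 (O0 : K -> Prop) (f : laurent) : Prop :=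
  exists xi : laurent,
    [/\ forall u, O0 (xi u),
        tends_to_0 ord xi
      & forall u, f u = xi u * gamma ^ (weight u)].

(* \sum_l D_l C0, so that the cohomology in degree n of the complex of the D_l
   on C0 is C0 / DC0. *)
Definition DC0 (O0 : K -> Prop) (f : laurent) : Prop :=
  exists2 g : 'I_n -> laurent,
    forall l, C0 O0 (g l) & forall u, f u = \sum_l Dop l (g l) u.

End Dwork.

(* Main.v *)
Require Import Defs.
From HB Require Import structures.
From mathcomp Require Import all_boot all_order all_algebra all_field.
From mathcomp Require Import boolp classical_sets constructive_ereal.
From mathcomp Require Import zify ring lra.

Set Implicit Arguments.
Unset Strict Implicit.
Unset Printing Implicit Defensive.

Import Order.TTheory GRing.Theory Num.Theory.
Local Open Scope ring_scope.

(* Let u_j = (1,..,1,0,..,0) with j ones.  Reduction modulo gamma along the cones of the fan spanned by the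
   exponents of x_1, .., x_n, 1/(x_1..x_n) shows that the monomials gamma^j x^(u_j), 0 <= j <= n, form a basis of
   C_0 modulo the image of the D_l, and that a monomial gamma^w x^u of weight w reduces to a combination of the
   gamma^i x^(u_i) with i <= w, up to terms gaining a factor p for every unit of weight.  Since Frobenius sends
   C_0 into series whose coefficient at gamma^w x^u is divisible by p^w, its matrix A in this basis has A_ij in
   p^i O_0, A_ij in gamma p^i O_0 for i < j, and A_jj = p^j (1 + O(gamma)): the last point comes from the
   differential equation of F_lambda, which gives ((p-1)!)^j F((p-1) u_j) = gamma^((p-1)j) up to higher order, from
   Wilson's theorem and from gamma^(p-1) = -p (1 + O(gamma)).  A fixed point argument then produces a
   sigma-semilinear change of basis making A triangular without changing the diagonal modulo gamma, so that the
   eigenvalues of the a-th iterate are products of a conjugates of the diagonal entries. *)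

(** * Valuations and convergent families *)

(** The argument has to work for every p, including p at most n, so no exponent may be inverted.
    Hence a monomial of exponent v is reduced by applying D_i - D_k to the monomial of exponent u =
    v - v_i, where v_i is the i-th vertex of the fan: the Euler term has smaller weight, and only
    the unit coefficient of x^(v_i) is divided out. Taking for k the first vertex missing from v
    makes this terminate: x^(u + v_k) either loses weight, hence becomes divisible by gamma, or has
    a later first missing vertex. The factor p per unit of weight comes from the valuation of
    gamma_m, computed as the tail of a series that vanishes at gamma. Since alpha_1 is only
    semilinear, its commutation with the D_l needs sigma gamma = gamma. This is not assumed; it is
    obtained by comparing two zeros of the series defining gamma. The products of conjugates that
    give the eigenvalues run over the whole cyclic group generated by sigma, so sigma fixes them. An
    integral element fixed by sigma has its coefficients in powers of zeta_p - 1 in Z_p, which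
    places the eigenvalues in Z_p[zeta_p]. *)

Lemma ex_choice (X Y : Type) (P : X -> Y -> Prop) :
  (forall x, exists y, P x y) -> exists f : X -> Y, forall x, P x (f x).
Proof. by move=> /choice[f hf]; exists f. Qed.

Section Valuation.
Variables (K : fieldType) (ord : K -> \bar rat).
Hypothesis ord_val : valuation ord.

Definition vge (r : rat) (x : K) : bool := (r%:E <= ord x)%E.
(** At 0 this is the junk value 0 of [fine], which is why [vgeE] treats 0 separately. *)
Definition vl (x : K) : rat := fine (ord x).

Lemma vlE x : vl x = fine (ord x). Proof. by []. Qed.

Lemma ordv0 : ord 0 = +oo%E.
Proof. by case: ord_val => h _ _; apply/eqP; rewrite h. Qed.

(** The value -oo is impossible: ord (0 * x) is +oo, whereas +oo + -oo is -oo. *)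
Lemma ordE x : x != 0 -> ord x = (vl x)%:E.
Proof.
case: ord_val => h0 hM _ x0; rewrite /vl.
have := h0 x; rewrite (negbTE x0); case E: (ord x) => [r| |] //= _.
by have := hM 0 x; rewrite mul0r ordv0 E.
Qed.

Lemma vgeE r x : vge r x = (x == 0) || (r <= vl x).
Proof.
rewrite /vge; have [->|x0] := eqVneq x 0; first by rewrite ordv0 leey.
by rewrite ordE // lee_fin.
Qed.

Lemma vge0 r : vge r 0. Proof. by rewrite vgeE eqxx. Qed.

Lemma vge_val x : vge (vl x) x. Proof. by rewrite vgeE lexx orbT. Qed.

Lemma vlM x y : x != 0 -> y != 0 -> vl (x * y) = vl x + vl y.
Proof.
move=> x0 y0; case: ord_val => _ hM _.
by rewrite {1}/vl hM !ordE.
Qed.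

Lemma vl1 : vl 1 = 0.
Proof.
have := vlM (oner_neq0 K) (oner_neq0 K); rewrite mulr1 => h; lra.
Qed.

Lemma vlV x : vl x^-1 = - vl x.
Proof.
have [->|x0] := eqVneq x 0; first by rewrite invr0 /vl ordv0 /= oppr0.
by have := vlM x0 (invr_neq0 x0); rewrite divff // vl1 => h; lra.
Qed.

Lemma vlX x n : x != 0 -> vl (x ^+ n) = n%:R * vl x.
Proof.
move=> x0; elim: n => [|n IH]; first by rewrite expr0 vl1 mul0r.
by rewrite exprS vlM ?expf_neq0 // IH -natr1; ring.
Qed.

Lemma vlXz x (n : int) : x != 0 -> vl (x ^ n) = n%:~R * vl x.
Proof.
move=> x0; case: n => n; first by rewrite -exprnP vlX.
by rewrite NegzE -exprz_inv -exprnP vlX ?invr_eq0 // vlV; lra.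
Qed.

Lemma vlN x : vl (- x) = vl x.
Proof.
have [->|x0] := eqVneq x 0; first by rewrite oppr0.
have h1 : vl (-1) = 0.
  have n1 : (-1 : K) != 0 by rewrite oppr_eq0 oner_neq0.
  by have := vlM n1 n1; rewrite mulrNN mulr1 vl1 => h; lra.
by rewrite -mulN1r vlM ?oppr_eq0 ?oner_neq0 // h1 add0r.
Qed.

Lemma vgeN r x : vge r (- x) = vge r x.
Proof. by rewrite !vgeE oppr_eq0 vlN. Qed.

Lemma vgeD r x y : vge r x -> vge r y -> vge r (x + y).
Proof.
case: ord_val => _ _ hD hx hy; apply: le_trans (hD x y).
by rewrite le_min; apply/andP.
Qed.

Lemma vgeB r x y : vge r x -> vge r y -> vge r (x - y).
Proof. by move=> hx hy; rewrite vgeD ?vgeN. Qed.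

Lemma vgeM r s x y : vge r x -> vge s y -> vge (r + s) (x * y).
Proof.
rewrite !vgeE mulf_eq0; have [//|x0] := eqVneq x 0; have [//|y0] := eqVneq y 0.
by move=> /= hx hy; rewrite vlM //; lra.
Qed.

Lemma vgeM0 r x y : vge 0 x -> vge r y -> vge r (x * y).
Proof. by move=> hx hy; have := vgeM hx hy; rewrite add0r. Qed.

Lemma vgeM0r r x y : vge r x -> vge 0 y -> vge r (x * y).
Proof. by move=> hx hy; have := vgeM hx hy; rewrite addr0. Qed.

Lemma vgeX r x n : vge r x -> vge (n%:R * r) (x ^+ n).
Proof.
have [->|x0] := eqVneq x 0; last first.
  rewrite !vgeE (negbTE x0) expf_eq0 (negbTE x0) andbF /= => h.
  by rewrite vlX // ler_wpM2l.
by case: n => [|n] _; rewrite ?expr0 ?exprS ?mul0r ?vge0 // vgeE vl1 lexx orbT.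
Qed.

Lemma vge_le r s x : s <= r -> vge r x -> vge s x.
Proof. by rewrite !vgeE => h /orP[->//|h']; rewrite (le_trans h h') orbT. Qed.

Lemma vge1 : vge 0 1. Proof. by rewrite vgeE vl1 lexx orbT. Qed.

Lemma vgeX0 x n : vge 0 x -> vge 0 (x ^+ n).
Proof. by move=> /(@vgeX 0 x n); rewrite mulr0. Qed.

Lemma vge_sum r (I : Type) (s : seq I) (P : pred I) (F : I -> K) :
  (forall i, P i -> vge r (F i)) -> vge r (\sum_(i <- s | P i) F i).
Proof. by move=> h; elim/big_ind: _ => //; [exact: vge0|move=> x y; exact: vgeD]. Qed.

Lemma vge_nat m : vge 0 m%:R.
Proof. by elim: m => [|m IH]; rewrite ?vge0 // -natr1 vgeD // vge1. Qed.

Lemma vge_int (m : int) : vge 0 m%:~R.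
Proof. by case: m => m; rewrite ?NegzE ?mulrNz ?vgeN; exact: vge_nat. Qed.

Lemma vgeMn r x m : vge r x -> vge r (x *+ m).
Proof. by move=> h; rewrite -mulr_natl vgeM0 ?vge_nat. Qed.

Lemma vge_mulK r x y : y != 0 -> vge (r + vl y) (x * y) = vge r x.
Proof.
move=> y0; rewrite !vgeE mulf_eq0 (negbTE y0) orbF.
by have [//|x0] := eqVneq x 0; rewrite vlM // lerD2r.
Qed.

Lemma rat_ub (r : rat) : exists N : nat, r <= N%:R.
Proof.
by exists (Num.truncn r).+1; apply/ltW/truncnS_gt.
Qed.

Lemma vge_eq0 x : (forall N : nat, vge N%:R x) -> x = 0.
Proof.
move=> h; apply/eqP/negPn/negP => x0; have [N hN] := rat_ub (vl x).
have := h N.+1; rewrite vgeE (negbTE x0) /= -natr1 => h'; lra.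
Qed.

Lemma vge_eq x y : (forall N : nat, vge N%:R (x - y)) -> x = y.
Proof. by move=> h; apply/subr0_eq/vge_eq0. Qed.

Lemma vl_lt_addl x y : x != 0 -> (y == 0) || (vl x < vl y) -> x + y != 0 /\ vl (x + y) = vl x.
Proof.
move=> x0 /orP[/eqP ->|lt]; first by rewrite addr0.
have ny : x + y != 0.
  apply: contraL lt => /eqP xy; rewrite (_ : y = - x) ?vlN ?ltxx //.
  by rewrite -(add0r (- x)) -xy; ring.
split=> //; apply/eqP; rewrite eq_le; apply/andP; split.
  rewrite leNgt; apply/negP => lt2.
  have : vge (Num.min (vl (x + y)) (vl y)) (x + y - y).
    by rewrite vgeB // vgeE ge_min ?lexx ?orbT.
  by rewrite addrK vgeE (negbTE x0) /= ge_min !leNgt lt lt2.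
have : vge (vl x) (x + y) by rewrite vgeD // vgeE ?lexx ?(ltW lt) ?orbT.
by rewrite vgeE (negbTE ny).
Qed.

(** * Sums of families tending to 0 *)

Section Infsum.
Variable I : eqType.
Implicit Types (s : I -> K) (l : K).

Lemma has_sum_uniq s l l' : has_sum ord s l -> has_sum ord s l' -> l = l'.
Proof.
move=> h h'; apply: vge_eq => N.
have [S hS] := h N; have [S' hS'] := h' N.
pose U := undup (S ++ S'); have uU : uniq U by exact: undup_uniq.
have h1 := hS U uU; have h2 := hS' U uU.
rewrite (_ : l - l' = (l - \sum_(i <- U) s i) - (l' - \sum_(i <- U) s i)); last by ring.
apply: vgeB; [apply: h1|apply: h2] => i iS; rewrite mem_undup mem_cat iS ?orbT //.
Qed.

Lemma infsumE s l : has_sum ord s l -> infsum ord s = l.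
Proof. by move=> h; apply: xget_unique => // l' h'; exact: has_sum_uniq h' h. Qed.

Lemma sum_sub (S0 S : seq I) s : uniq S0 -> uniq S -> {subset S0 <= S} ->
  \sum_(i <- S) s i = \sum_(i <- S0) s i + \sum_(i <- S | i \notin S0) s i.
Proof.
move=> u0 u1 sub; rewrite (bigID (mem S0)) /=; congr (_ + _).
rewrite -big_filter; apply: perm_big; apply: uniq_perm => //; first exact: filter_uniq.
by move=> i; rewrite mem_filter; apply: andb_idr => /sub.
Qed.

Lemma sum_close r (S0 S1 : seq I) s : uniq S0 -> uniq S1 ->
  {subset S0 <= S1} -> (forall i, i \notin S0 -> vge r (s i)) ->
  vge r (\sum_(i <- S1) s i - \sum_(i <- S0) s i).
Proof.
move=> u0 u1 sub h; rewrite (sum_sub _ u0 u1 sub).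
by rewrite addrC addKr; apply: vge_sum.
Qed.

Lemma has_sum_approx s l r (S0 : seq I) : has_sum ord s l -> uniq S0 ->
  (forall i, i \notin S0 -> vge r (s i)) -> vge r (l - \sum_(i <- S0) s i).
Proof.
move=> h u0 hS; have [N hN] := rat_ub r; have [S1 hS1] := h N.
pose U := undup (S0 ++ S1); have uU : uniq U by exact: undup_uniq.
rewrite (_ : _ - _ = (l - \sum_(i <- U) s i)
   + (\sum_(i <- U) s i - \sum_(i <- S0) s i)); last by ring.
apply: vgeD.
  apply: vge_le hN _; apply: hS1 => // i iS.
  by rewrite mem_undup mem_cat iS orbT.
by apply: sum_close => // i iS; rewrite mem_undup mem_cat iS.
Qed.

Hypothesis ord_complete : complete_valuation ord.

Lemma summable s : tends_to_0 ord s -> exists l, has_sum ord s l.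
Proof.
move=> h; have [S0 hS0] := choice h.
(* The exceptional sets up to N are accumulated, so that the finite sets [T N] increase with N. *)
pose T N := undup (flatten [seq S0 k | k <- iota 0 N.+1]).
have sT N k : (k <= N)%N -> {subset S0 k <= T N}.
  move=> kN i iS; rewrite mem_undup; apply/flattenP; exists (S0 k) => //.
  by apply: map_f; rewrite mem_iota.
have uT N : uniq (T N) by exact: undup_uniq.
have monT N M : (N <= M)%N -> {subset T N <= T M}.
  move=> NM i; rewrite mem_undup => /flattenP[x /mapP[k]].
  rewrite mem_iota /= add0n ltnS => kN -> ik; apply: (sT M k) => //.
  exact: leq_trans kN NM.
have out N i : i \notin T N -> vge N%:R (s i).
  by move=> h1; apply: hS0; apply: contra h1 => /(sT N N (leqnn _)).
have hC N M : (N <= M)%N -> vge N%:R (\sum_(i <- T M) s i - \sum_(i <- T N) s i).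
  by move=> NM; apply: sum_close => //; [exact: monT|exact: out].
have [l hl] : exists l, forall N : nat, exists m0, forall m, (m0 <= m)%N ->
       (N%:R%:E <= ord (\sum_(i <- T m) s i - l)%R)%E.
  apply: ord_complete => N; exists N => m1 m2 h1 h2.
  rewrite -/(vge _ _) (_ : _ - _ = (\sum_(i <- T m1) s i - \sum_(i <- T N) s i)
    - (\sum_(i <- T m2) s i - \sum_(i <- T N) s i)); last by ring.
  by apply: vgeB; exact: hC.
exists l => N; have [m0 hm0] := hl N; exists (T (maxn N m0)) => S uS sub.
set m := maxn N m0 in sub *.
rewrite -/(vge _ _) (_ : _ - _ = - (\sum_(i <- T m) s i - l)
   - (\sum_(i <- S) s i - \sum_(i <- T m) s i)); last by ring.
apply: vgeB; first by rewrite vgeN; apply: hm0; rewrite leq_maxr.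
apply: sum_close => // i /out; apply: vge_le; rewrite ler_nat; exact: leq_maxl.
Qed.

Lemma has_infsum s : tends_to_0 ord s -> has_sum ord s (infsum ord s).
Proof. by move=> /summable[l hl]; rewrite (infsumE hl). Qed.

Lemma infsum_approx s r (S0 : seq I) : tends_to_0 ord s -> uniq S0 ->
  (forall i, i \notin S0 -> vge r (s i)) ->
  vge r (infsum ord s - \sum_(i <- S0) s i).
Proof. by move=> /has_infsum; exact: has_sum_approx. Qed.

(** Summability is not assumed: a divergent family has the junk sum 0, which satisfies every
    bound. *)
Lemma infsum_vge s r : (forall i, vge r (s i)) -> vge r (infsum ord s).
Proof.
move=> h; rewrite /infsum; case: xgetP => [l _ hl|_]; last exact: vge0.
have [N hN] := rat_ub r; have [S1 hS1] := hl N.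
rewrite -(subrK (\sum_(i <- undup S1) s i) l).
apply: vgeD; last exact: vge_sum.
apply: vge_le hN _; apply: hS1; first exact: undup_uniq.
by move=> i; rewrite mem_undup.
Qed.

Lemma eq_infsum s s' : s =1 s' -> infsum ord s = infsum ord s'.
Proof. by move=> h; congr infsum; exact: funext. Qed.

Lemma infsum_fin s (S0 : seq I) : uniq S0 -> (forall i, i \notin S0 -> s i = 0) ->
  infsum ord s = \sum_(i <- S0) s i.
Proof.
move=> u h; apply: infsumE => N; exists S0 => S uS sub.
rewrite (sum_sub _ u uS sub) [X in _ - (_ + X)]big1 ?addr0 ?subrr ?ordv0 ?leey //.
Qed.

Lemma infsum1 s (i0 : I) : (forall i, i != i0 -> s i = 0) -> infsum ord s = s i0.
Proof.
move=> h; rewrite (@infsum_fin _ [:: i0]) ?big_seq1 //.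
by move=> i; rewrite inE => /h.
Qed.

Lemma infsum0 s : (forall i, s i = 0) -> infsum ord s = 0.
Proof. by move=> h; rewrite (@infsum_fin _ [::]) ?big_nil. Qed.

Lemma tends_to_0D s s' : tends_to_0 ord s -> tends_to_0 ord s' ->
  tends_to_0 ord (fun i => s i + s' i).
Proof.
move=> h h' N; have [S hS] := h N; have [S' hS'] := h' N; exists (S ++ S') => i.
by rewrite mem_cat negb_or => /andP[/hS h1 /hS' h2]; exact: vgeD.
Qed.

Lemma tends_to_0Z c s : tends_to_0 ord s -> tends_to_0 ord (fun i => c * s i).
Proof.
move=> h N; have [->|c0] := eqVneq c 0.
  by exists [::] => i _; rewrite mul0r -/(vge _ _) vge0.
have [M hM] := rat_ub (N%:R - vl c); have [S hS] := h M; exists S => i /hS hi.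
rewrite -/(vge _ _); apply: vge_le (vgeM (vge_val c) hi); lra.
Qed.

Lemma infsumD s s' : tends_to_0 ord s -> tends_to_0 ord s' ->
  infsum ord (fun i => s i + s' i) = infsum ord s + infsum ord s'.
Proof.
move=> h h'; apply: vge_eq => N.
have [S hS] := h N; have [S' hS'] := h' N; pose U := undup (S ++ S').
have uU : uniq U by exact: undup_uniq.
have o1 i : i \notin U -> vge N%:R (s i).
  by rewrite mem_undup mem_cat negb_or => /andP[/hS].
have o2 i : i \notin U -> vge N%:R (s' i).
  by rewrite mem_undup mem_cat negb_or => /andP[_ /hS'].
have a1 := infsum_approx h uU o1; have a2 := infsum_approx h' uU o2.
have a3 := infsum_approx (tends_to_0D h h') uU (fun i hi => vgeD (o1 i hi) (o2 i hi)).
have := vgeB a3 (vgeD a1 a2); rewrite big_split /=.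
by congr vge; ring.
Qed.

Lemma infsumZ c s : tends_to_0 ord s ->
  infsum ord (fun i => c * s i) = c * infsum ord s.
Proof.
move=> h; have [->|c0] := eqVneq c 0.
  by rewrite mul0r infsum0 // => i; rewrite mul0r.
apply: vge_eq => N; have [M hM] := rat_ub (Num.max N%:R (N%:R - vl c)).
rewrite ge_max in hM; case/andP: hM => hM1 hM2.
have [S hS] := h M; have [S' hS'] := tends_to_0Z c h N; pose U := undup (S ++ S').
have uU : uniq U by exact: undup_uniq.
have o1 i : i \notin U -> vge M%:R (s i).
  by rewrite mem_undup mem_cat negb_or => /andP[/hS].
have o2 i : i \notin U -> vge N%:R (c * s i).
  by rewrite mem_undup mem_cat negb_or => /andP[_ /hS'].
have a1 := infsum_approx h uU o1.
have a3 := infsum_approx (tends_to_0Z c h) uU o2.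
have a2 : vge N%:R (c * (infsum ord s - \sum_(i <- U) s i)).
  by apply: vge_le (vgeM (vge_val c) a1); lra.
have := vgeB a3 a2; rewrite -mulr_sumr.
by congr vge; ring.
Qed.

Lemma infsumN s : tends_to_0 ord s -> infsum ord (fun i => - s i) = - infsum ord s.
Proof.
move=> h; rewrite -mulN1r -infsumZ //; apply: eq_infsum => i; by rewrite mulN1r.
Qed.

Lemma tends_to_0N s : tends_to_0 ord s -> tends_to_0 ord (fun i => - s i).
Proof.
move=> /(tends_to_0Z (-1)) h N; have [S hS] := h N; exists S => i /hS.
by rewrite mulN1r.
Qed.

Lemma infsumB s s' : tends_to_0 ord s -> tends_to_0 ord s' ->
  infsum ord (fun i => s i - s' i) = infsum ord s - infsum ord s'.
Proof. by move=> h h'; rewrite infsumD ?infsumN //; exact: tends_to_0N. Qed.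

Lemma tends_to_0_fin s (S0 : seq I) : (forall i, i \notin S0 -> s i = 0) -> tends_to_0 ord s.
Proof. by move=> h N; exists S0 => i /h ->; rewrite ordv0 leey. Qed.

Lemma infsum_reindex s (f g : I -> I) : cancel f g -> cancel g f ->
  tends_to_0 ord s -> infsum ord (fun i => s (f i)) = infsum ord s.
Proof.
move=> fg gf h; apply: infsumE => N; have [S hS] := has_infsum h N.
exists (map g S) => S' uS' sub.
have -> : \sum_(i <- S') s (f i) = \sum_(i <- map f S') s i by rewrite big_map.
apply: hS; first by rewrite map_inj_uniq //; exact: can_inj fg.
by move=> i iS; rewrite -(gf i); apply: map_f; apply: sub; exact: map_f.
Qed.

End Infsum.

(** * Interchange of summations *)

Section Exchange.
Hypothesis ord_complete : complete_valuation ord.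
Variables I J : eqType.

(** Smallness outside a finite rectangle, which makes both iterated sums approximable by the same
    finite double sum. *)
Definition tends2 (s : I -> J -> K) : Prop := forall N : nat,
  exists I0 : seq I, exists J0 : seq J, forall i j, (i \notin I0) || (j \notin J0) ->
   vge N%:R (s i j).

Lemma tends2_row s i : tends2 s -> tends_to_0 ord (s i).
Proof.
move=> h N; have [I0 [J0 hIJ]] := h N; exists J0 => j hj; apply: hIJ.
by rewrite hj orbT.
Qed.

Lemma tends2_inf s : tends2 s -> tends_to_0 ord (fun i => infsum ord (s i)).
Proof.
move=> h N; have [I0 [J0 hIJ]] := h N; exists I0 => i hi.
by rewrite -/(vge _ _); apply: infsum_vge => j; apply: hIJ; rewrite hi.
Qed.

Lemma infsum2_approx s r (I0 : seq I) (J0 : seq J) : tends2 s -> uniq I0 -> uniq J0 ->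
  (forall i j, (i \notin I0) || (j \notin J0) -> vge r (s i j)) ->
  vge r (infsum ord (fun i => infsum ord (s i)) - \sum_(i <- I0) \sum_(j <- J0) s i j).
Proof.
move=> h uI uJ hr.
rewrite (_ : _ - _ = (infsum ord (fun i => infsum ord (s i)) - \sum_(i <- I0) infsum ord (s i))
   + \sum_(i <- I0) (infsum ord (s i) - \sum_(j <- J0) s i j)); last first.
  by rewrite sumrB; ring.
apply: vgeD.
  apply: infsum_approx => //; first exact: tends2_inf.
  by move=> i hi; apply: infsum_vge => j; apply: hr; rewrite hi.
apply: vge_sum => i _; apply: infsum_approx => //; first exact: tends2_row.
by move=> j hj; apply: hr; rewrite hj orbT.
Qed.

End Exchange.

Lemma tends2_sym (I J : eqType) (s : I -> J -> K) :
  tends2 s -> tends2 (fun j i => s i j).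
Proof.
move=> h N; have [I0 [J0 hIJ]] := h N; exists J0, I0 => j i hij; apply: hIJ.
by rewrite orbC.
Qed.

Lemma infsum_exchange (I J : eqType) (s : I -> J -> K) :
  complete_valuation ord -> tends2 s ->
  infsum ord (fun i => infsum ord (s i)) = infsum ord (fun j => infsum ord (fun i => s i j)).
Proof.
move=> cpl h; apply: vge_eq => N; have [I0 [J0 hIJ]] := h N.
have uI := undup_uniq I0; have uJ := undup_uniq J0.
have a1 := @infsum2_approx cpl _ _ s N%:R (undup I0) (undup J0) h uI uJ.
have a2 := @infsum2_approx cpl _ _ _ N%:R (undup J0) (undup I0) (tends2_sym h) uJ uI.
rewrite (_ : _ - _ = (infsum ord (fun i => infsum ord (s i))
     - \sum_(i <- undup I0) \sum_(j <- undup J0) s i j)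
   - (infsum ord (fun j => infsum ord (fun i => s i j))
     - \sum_(j <- undup J0) \sum_(i <- undup I0) s i j)); last first.
  by rewrite [in RHS]exchange_big /=; ring.
apply: vgeB; first by apply: a1 => i j; rewrite !mem_undup; exact: hIJ.
by apply: a2 => j i; rewrite !mem_undup orbC; exact: hIJ.
Qed.

Lemma infsum_recl (s : nat -> K) : complete_valuation ord -> tends_to_0 ord s ->
  infsum ord s = s 0%N + infsum ord (fun m => s m.+1).
Proof.
move=> cpl h; apply: infsumE => N; have h1 : tends_to_0 ord (fun m => s m.+1).
  move=> M; have [S hS] := h M; exists (map predn S) => i hi; apply: hS.
  by apply: contra hi => hi; rewrite -[i]/(i.+1.-1); exact: map_f.
have [S hS] := has_infsum cpl h1 N; exists (0%N :: map succn S) => S' uS' sub.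
have h0 : 0%N \in S' by apply: sub; rewrite inE eqxx.
rewrite (bigD1_seq 0%N) //= -big_filter.
have uF : uniq [seq i <- S' | i != 0%N] by exact: filter_uniq.
have e : \sum_(i <- [seq i <- S' | i != 0%N]) s i =
   \sum_(i <- map predn [seq i <- S' | i != 0%N]) s i.+1.
  rewrite big_map; apply: eq_big_seq => i; rewrite mem_filter => /andP[i0 _].
  by rewrite prednK // lt0n.
rewrite e [X in (_ <= ord X)%E](_ : _ = infsum ord (fun m => s m.+1)
  - \sum_(i <- map predn [seq i <- S' | i != 0%N]) s i.+1); last by ring.
apply: hS.
  rewrite map_inj_in_uniq // => i j; rewrite !mem_filter => /andP[i0 _] /andP[j0 _] eij.
  by rewrite -(@prednK i) ?lt0n // eij prednK ?lt0n.
move=> i iS; rewrite -[i]/(i.+1.-1); apply: map_f; rewrite mem_filter /=.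
by apply: sub; rewrite inE map_f.
Qed.

End Valuation.

(** * The valuation of integers and rationals; residues of limits of rationals *)

Section ValuedAtP.
Variables (K : fieldType) (ord : K -> \bar rat) (p : nat).
Hypotheses (ord_val : valuation ord) (p_prime : prime p) (ord_p : ord p%:R = 1%:E).
Notation vge := (vge ord).
Notation vl := (vl ord).

Lemma pnat_neq0 : p%:R != 0 :> K.
Proof. by case: ord_val => h _ _; rewrite -h ord_p. Qed.

Lemma vl_p : vl p%:R = 1. Proof. by rewrite vlE ord_p. Qed.

Lemma vge_pos1 r : 0 < r -> vge r 1 = false.
Proof. by move=> r0; rewrite vgeE // oner_eq0 vl1 //= leNgt r0. Qed.

(** By Bezout, 1 is an integral combination of p and m, so m can neither vanish nor have positive
    valuation. *)
Lemma vl_coprime m : coprime p m -> m%:R != 0 :> K /\ vl m%:R = 0.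
Proof.
move=> cop; have [[|u] v e _] := egcdnP m (prime_gt0 p_prime).
  by move: e; rewrite mul0n (eqP cop) addn1.
rewrite (eqP cop) in e; have h0 := vge_nat ord_val m.
suff: ~~ ((m%:R == 0 :> K) || (0 < vl m%:R)).
  rewrite negb_or -leNgt => /andP[m0 le]; split=> //.
  by move: h0; rewrite vgeE // (negbTE m0) /= => le'; apply/eqP; rewrite eq_le le.
apply/negP => hm; pose r := if m%:R == 0 :> K then 1 else Num.min 1 (vl m%:R).
have r0 : 0 < r by rewrite /r; case: ifP hm => //= _ hm; rewrite lt_min hm.
have : vge r (u.+1%:R * p%:R - v%:R * m%:R).
  apply: vgeB => //; apply: vgeM0; rewrite ?vge_nat //; rewrite vgeE // /r.
    by rewrite vl_p (negbTE pnat_neq0) /=; case: ifP => // _; rewrite ge_min lexx.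
  by case: ifP => //= _; rewrite ge_min lexx orbT.
by rewrite -!natrM e natrD addrC addKr vge_pos1.
Qed.

Lemma vl_nat m : (0 < m)%N -> m%:R != 0 :> K /\ vl m%:R = (logn p m)%:R.
Proof.
move=> m0; have [k cop e] := pfactor_coprime p_prime m0; rewrite [in m%:R]e.
have [k0 vk] := vl_coprime cop.
rewrite natrM natrX mulf_neq0 ?expf_neq0 ?pnat_neq0 //; split => //.
by rewrite vlM ?expf_neq0 ?pnat_neq0 // vk vlX ?pnat_neq0 // vl_p mulr1 add0r //.
Qed.

Lemma pnatr_eq0K m : (m%:R == 0 :> K) = (m == 0)%N.
Proof. by case: m => [|m]; rewrite ?eqxx //; apply/negbTE; case: (@vl_nat m.+1). Qed.

Lemma pchar0 : [pchar K] =i pred0.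
Proof. by apply/pcharf0P => m; exact: pnatr_eq0K. Qed.

Lemma vl_int (z : int) : z != 0 -> z%:~R != 0 :> K /\ vl z%:~R = (logn p `|z|)%:R.
Proof.
case: z => m; first by move=> m0; apply: vl_nat; case: m m0.
by move=> _; rewrite NegzE mulrNz oppr_eq0 vlN // abszN; apply: vl_nat.
Qed.

Lemma vl_rat (r : rat) : r != 0 -> ratr r != 0 :> K /\
  vl (ratr r) = (logn p `|numq r|)%:R - (logn p `|denq r|)%:R.
Proof.
move=> r0; rewrite /ratr.
have [n0 vn] : _ := vl_int (z := numq r) (ltac:(by rewrite numq_eq0)).
have [d0 vd] := vl_int (denq_neq0 r).
by rewrite mulf_neq0 ?invr_eq0 // vlM ?invr_eq0 // vn vlV // vd.
Qed.

Definition rat_dense_at (x : K) := forall N : nat, exists r : rat, vge N%:R (x - ratr r).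

(** A close enough rational has the same valuation as x, and valuations of rationals are
    integers. *)
Lemma vl_dense x : x != 0 -> rat_dense_at x -> exists k : int, vl x = k%:~R.
Proof.
move=> x0 h; have [N hN] := rat_ub (vl x); have [r hr] := h N.+1.
have := hr; rewrite vgeE // -natr1 => hr'.
have [nz e] : ratr r != 0 :> K /\ vl (ratr r) = vl x.
  have := @vl_lt_addl _ _ ord_val x (ratr r - x) x0.
  rewrite (_ : x + (ratr r - x) = ratr r); last by ring.
  apply.
  rewrite -opprB oppr_eq0 vlN //.
  by case/orP: hr' => [->//|h']; apply/orP; right; lra.
have r0 : r != 0 by apply: contra nz => /eqP ->; rewrite (ratr_nat _ 0).
have [_ e'] := vl_rat r0; exists ((logn p `|numq r|)%:Z - (logn p `|denq r|)%:Z).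
by rewrite -e e' intrB.
Qed.

Lemma residue_int x : rat_dense_at x -> vge 0 x -> exists z : int, vge 1 (x - z%:~R).
Proof.
move=> h x0; have [r hr] := h 1%N.
have r0 : vge 0 (ratr r).
  rewrite -(subrK x (ratr r)) vgeD // -vgeN // opprB.
  by apply: vge_le hr.
have [e|rn0] := eqVneq r 0.
  by exists 0; move: hr; rewrite e (ratr_nat _ 0).
have [nz vr] := vl_rat rn0.
have copd : coprime p `|denq r|.
  rewrite prime_coprime //; apply/negP => pd.
  have pn : ~~ (p %| `|numq r|)%N.
    apply/negP => pn; have := coprime_num_den r.
    rewrite /coprime => /eqP g; have : (p %| 1)%N by rewrite -g dvdn_gcd pn pd.
    by rewrite Euclid_dvd1.
  move: r0; rewrite vgeE // (negbTE nz) vr /= lognE (negbTE pn) !andbF sub0r.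
  rewrite oppr_ge0 lern0 -leqn0 leqNgt logn_gt0 mem_primes p_prime pd andbT.
  by rewrite absz_gt0 denq_neq0.
have [d0 vd] := vl_int (denq_neq0 r).
have [u [v uv]] : exists u v : int, u * denq r + v * p%:Z = 1.
  have := Bezoutz (denq r) p%:Z => -[u [v e]]; exists u, v; rewrite e.
  by rewrite /gcdz gcdnC; rewrite (eqP copd).
(* The factor u inverts the denominator of r modulo p. *)
exists (numq r * u); rewrite -(subrK (ratr r) x) -addrA vgeD //.
have -> : ratr r - (numq r * u)%:~R = (numq r)%:~R * (denq r)%:~R^-1 * v%:~R * p%:R :> K.
  have e1 : u%:~R * (denq r)%:~R + v%:~R * p%:R = 1 :> K.
    by rewrite -[p%:R]/(p%:Z%:~R) -!intrM -intrD uv.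
  rewrite [ratr r](_ : _ = (numq r)%:~R * (denq r)%:~R^-1 *
    (u%:~R * (denq r)%:~R + v%:~R * p%:R)); last by rewrite e1 mulr1.
  by rewrite intrM; field.
rewrite -[1]add0r; apply: vgeM => //; last by rewrite -vl_p vge_val.
do 2![apply: vgeM0; rewrite ?vge_int //].
Qed.

Lemma residue_nat x : rat_dense_at x -> vge 0 x -> exists2 m : nat, (m < p)%N & vge 1 (x - m%:R).
Proof.
move=> h x0; have [z hz] := residue_int h x0.
have p0 : (p%:Z != 0) by rewrite eqz_nat -lt0n prime_gt0.
exists `|(z %% p)%Z|%N.
  rewrite -ltz_nat gez0_abs ?modz_ge0 // ltz_pmod // ltz_nat; exact: prime_gt0.
rewrite pmulrn gez0_abs ?modz_ge0 // /modz intrB intrM opprB addrA addrAC vgeD //.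
by rewrite -[1]add0r; apply: vgeM; rewrite ?vge_int // -vl_p vge_val.
Qed.

End ValuedAtP.

(** * Congruences between p-th powers, completeness of finite extensions *)

Section ValuedMore.
Variables (K : fieldType) (ord : K -> \bar rat) (p : nat).
Hypotheses (ord_val : valuation ord) (p_prime : prime p) (ord_p : ord p%:R = 1%:E).
Notation vge := (vge ord).
Notation vl := (vl ord).

Lemma vge_p : vge 1 p%:R. Proof. by rewrite -(vl_p ord_p) vge_val. Qed.

Lemma vge_pX N : vge N%:R (p%:R ^+ N).
Proof. by have := vgeX ord_val N vge_p; rewrite mulr1. Qed.

Lemma vge_pdvd N x : vge N%:R x -> exists2 y, vge 0 y & x = p%:R ^+ N * y.
Proof.
move=> h; have p0 := pnat_neq0 ord_val ord_p; exists (x / p%:R ^+ N); last first.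
  by rewrite mulrCA divff ?mulr1 // expf_neq0.
rewrite -(vge_mulK ord_val _ _ (expf_neq0 N p0)) divfK ?expf_neq0 //.
by rewrite vlX // (vl_p ord_p) mulr1 add0r.
Qed.

(** In the factorisation of x^p - y^p, the cofactor of x - y is p y^(p-1) modulo x - y; it has
    valuation at least s because s is at most both 1 and r. *)
Lemma pow_close r s x y : 0 <= s -> s <= 1 -> s <= r -> vge 0 x -> vge 0 y ->
  vge r (x - y) -> vge (r + s) (x ^+ p - y ^+ p).
Proof.
move=> s0 s1 sr x0 y0 h; rewrite subrXX; apply: vgeM => //.
have -> : \sum_(i < p) x ^+ (p.-1 - i) * y ^+ i =
    \sum_(i < p) (x ^+ (p.-1 - i) - y ^+ (p.-1 - i)) * y ^+ i + p%:R * y ^+ p.-1.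
  under [X in X + _]eq_bigr do rewrite mulrBl -exprD.
  rewrite sumrB -[LHS]addr0 -[RHS]addrA; congr (_ + _).
  rewrite (eq_bigr (fun=> y ^+ p.-1)) => [|i _].
    by rewrite sumr_const card_ord mulr_natl addNr.
  by congr (_ ^+ _); have := ltn_ord i; lia.
apply: vgeD => //; last first.
  by apply: vgeM0r => //; [apply: vge_le vge_p|exact: vgeX0].
apply: vge_sum => // i _; apply: vgeM0r => //; last exact: vgeX0.
rewrite subrXX; apply: vgeM0r => //; first exact: vge_le h.
by apply: vge_sum => // j _; apply: vgeM0 => //; exact: vgeX0.
Qed.

Lemma pow_closeX r s x y k : 0 <= s -> s <= 1 -> s <= r -> vge 0 x -> vge 0 y ->
  vge r (x - y) -> vge (r + k%:R * s) (x ^+ (p ^ k) - y ^+ (p ^ k)).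
Proof.
move=> s0 s1 sr x0 y0 h; elim: k => [|k IH]; first by rewrite mul0r addr0 !expr1.
rewrite expnSr !exprM -natr1 mulrDl mul1r addrA.
have h0 : 0 <= k%:R * s by rewrite mulr_ge0.
by apply: pow_close => //; [lra|exact: vgeX0|exact: vgeX0].
Qed.

(** Raising to the power p^(qM) fixes x and y while [pow_closeX] brings them arbitrarily close as M
    grows. *)
Lemma fixed_close_eq q s x y : (0 < q)%N -> 0 < s -> s <= 1 -> vge 0 x -> vge 0 y ->
  vge s (x - y) -> x ^+ (p ^ q) = x -> y ^+ (p ^ q) = y -> x = y.
Proof.
move=> q0 s0 s1 x0 y0 h xq yq; apply: (vge_eq ord_val) => N.
have it (z : K) k : z ^+ (p ^ q) = z -> z ^+ (p ^ (q * k)) = z.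
  by move=> zq; rewrite expnM; elim: k => [|k IH]; rewrite ?expn0 // expnS exprM zq.
have [M hM] := rat_ub (N%:R / s).
rewrite -(it x M xq) -(it y M yq).
apply: vge_le (pow_closeX (q * M) (ltW s0) s1 (lexx s) x0 y0 h) => //.
have : N%:R <= (q * M)%:R * s.
  rewrite -ler_pdivrMr // (le_trans hM) // ler_nat leq_pmull //.
by lra.
Qed.

Definition complete_on (V : K -> Prop) := forall s : nat -> K, (forall m, V (s m)) ->
    (forall N : nat, exists m0, forall m1 m2, (m0 <= m1)%N -> (m0 <= m2)%N ->
       vge N%:R (s m1 - s m2)) ->
    exists2 l, V l & forall N : nat, exists m0, forall m, (m0 <= m)%N -> vge N%:R (s m - l).

(** Passing to coordinates costs at most C in valuation, so a Cauchy sequence in V is Cauchy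
    coordinatewise and the limits of the coordinates lie in E. *)
Lemma complete_span (E V : K -> Prop) d (b : 'I_d -> K) (C : rat) :
  complete_on E ->
  (forall x y, E x -> E y -> E (x - y)) ->
  (forall c : 'I_d -> K, (forall i, E (c i)) -> V (\sum_i c i * b i)) ->
  (forall x, V x -> exists2 c : 'I_d -> K, (forall i, E (c i)) & x = \sum_i c i * b i) ->
  (forall r (c : 'I_d -> K), (forall i, E (c i)) -> vge r (\sum_i c i * b i) ->
     forall i, vge (r - C) (c i)) ->
  complete_on V.
Proof.
move=> cE EB EV VE bd s sV sC.
have [c hc] : exists c : nat -> 'I_d -> K,
    forall m, (forall i, E (c m i)) /\ s m = \sum_i c m i * b i.
  by apply: (@ex_choice nat ('I_d -> K) (fun m c => (forall i, E (c i)) /\ s m = \sum_i c i * b i)) => m; have [c h1 h2] := VE _ (sV m); exists c.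
have [l hl] : exists l : 'I_d -> K, forall i, E (l i) /\
    forall N : nat, exists m0, forall m, (m0 <= m)%N -> vge N%:R (c m i - l i).
  apply: (@ex_choice 'I_d K (fun i l => E l /\
    forall N : nat, exists m0, forall m, (m0 <= m)%N -> vge N%:R (c m i - l))) => i.
  have [||l h1 h2] := cE (fun m => c m i).
  - by move=> m; case: (hc m).
  - move=> N; have [M hM] := rat_ub (N%:R + C).
    have [m0 hm0] := sC M; exists m0 => m1 m2 h1 h2.
    have e : s m1 - s m2 = \sum_i (c m1 i - c m2 i) * b i.
      rewrite (hc m1).2 (hc m2).2 -sumrB; apply: eq_bigr => j _; ring.
    have := hm0 _ _ h1 h2; rewrite e => /bd h.
    apply: vge_le (h _ i) => //; first by lra.
    by move=> j; apply: EB; [case: (hc m1)|case: (hc m2)].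
  by exists l.
have [B hB] : exists B : nat, forall i, vge (- B%:R) (b i).
  have [f hf] : exists f : 'I_d -> nat, forall i, vge (- (f i)%:R) (b i).
    apply: (@ex_choice 'I_d nat (fun i B => vge (- B%:R) (b i))) => i.
    have [B hB] := rat_ub (- vl (b i)); exists B.
    by apply: vge_le (vge_val ord_val (b i)) => //; lra.
  exists (\max_i f i) => i; apply: vge_le (hf i) => //.
  by rewrite lerN2 ler_nat; exact: leq_bigmax.
exists (\sum_i l i * b i); first by apply: EV => i; case: (hl i).
move=> N; have [f hf] : exists f : 'I_d -> nat, forall i m, (f i <= m)%N ->
    vge (N + B)%:R (c m i - l i).
  apply: (@ex_choice 'I_d nat (fun i m0 => forall m, (m0 <= m)%N ->
    vge (N + B)%:R (c m i - l i))) => i.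
  by case: (hl i) => _ /(_ (N + B)%N).
exists (\max_i f i)%N => m hm.
rewrite (hc m).2 -sumrB; apply: vge_sum => // i _; rewrite -mulrBl.
apply: vge_le (vgeM ord_val (hf i m _) (hB i)) => //.
  by rewrite natrD; lra.
by apply: leq_trans hm; exact: leq_bigmax.
Qed.

(* Terms with pairwise distinct valuations cannot cancel. *)
Lemma distinct_vge r d (t : 'I_d -> K) :
  (forall i j, i != j -> t i != 0 -> t j != 0 -> vl (t i) != vl (t j)) ->
  vge r (\sum_i t i) -> forall i, vge r (t i).
Proof.
move=> dist h i; apply/negPn/negP => hi.
pose P i := ~~ vge r (t i).
have [i0 Pi0 min] := arg_minP (fun i => vl (t i)) (hi : P i).
have t0 : t i0 != 0 by apply: contra Pi0 => /eqP ->; rewrite vge0.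
have lt : vl (t i0) < r by move: Pi0; rewrite /P vgeE // negb_or -ltNge => /andP[].
move: h; rewrite (bigD1 i0) //=; set y := \sum_(i | _) _.
have hy : (y == 0) || (vl (t i0) < vl y).
  have [//|y0 /=] := eqVneq y 0.
  rewrite ltNge; apply/negP => ley; pose P2 i := (i != i0) && (t i != 0).
  have [k hk|hk] := pickP P2; last first.
    move/eqP: y0; apply; apply: big1 => k kn.
    by have := hk k; rewrite /P2 kn /= => /negbFE/eqP.
  have [k0 /andP[k0n tk0] kmin] := arg_minP (fun i => vl (t i)) hk.
  have lek : vl (t i0) < vl (t k0).
    have := dist _ _ k0n tk0 t0; rewrite lt_neqAle eq_sym => -> /=.
    have [/negPf Pk|nPk] := boolP (~~ P k0); last by apply: min; rewrite negbK in nPk.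
    move/negbFE: Pk; rewrite vgeE // (negbTE tk0) /=; lra.
  have : vge (vl (t k0)) y.
    apply: vge_sum => // k' k'n; rewrite vgeE //; have [//|tk'] := eqVneq (t k') 0.
    by apply: kmin; rewrite /P2 k'n.
  by rewrite vgeE // (negbTE y0) /=; lra.
have [n0 e] := vl_lt_addl ord_val t0 hy.
by rewrite vgeE // (negbTE n0) e /= leNgt lt.
Qed.

End ValuedMore.

(** Independence over F_p is phrased with natural coefficients, so that it can be tested on
    reductions of elements of characteristic 0. *)
Lemma Fp_basis (p a : nat) (F : finFieldType) : prime p -> #|F| = (p ^ a)%N ->
  exists b : 'I_a -> F, forall m : 'I_a -> nat, \sum_k (m k)%:R * b k = 0 ->
    forall k, (p %| m k)%N.
Proof.
move=> pp cF; have pF := card_finPcharP cF pp.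
pose R : vectType 'F_p := pPrimeCharType pF.
have dR : \dim {:R} = a by rewrite /R pprimeChar_dimf cF pfactorK.
have := vbasisP {:R}; move: (vbasis _); rewrite dR => X bX.
have /freeP fX := basis_free bX.
exists (fun k : 'I_a => X`_k) => m hm k.
rewrite (dvdn_pcharf (pchar_Fp pp)); apply/eqP; move: k.
apply: fX; rewrite -[RHS]hm; apply: eq_bigr => i _.
by rewrite scaler_nat mulr_natl.
Qed.

(** * The field Omega_0 *)

Lemma pchar_nat_inj (p : nat) (F : nzRingType) (m k : nat) : p \in [pchar F] ->
  (m < p)%N -> (k < p)%N -> m%:R = k%:R :> F -> m = k.
Proof.
move=> pF; wlog le : m k / (m <= k)%N => [hw mp kp e|].
  by case: (leqP m k) => [/hw|/ltnW/hw h]; [apply|symmetry; apply: h].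
move=> _ kp e; have : (p %| k - m)%N by rewrite (dvdn_pcharf pF) natrB // e subrr.
rewrite -(subnK le) in kp e *; rewrite addnK => d.
have [//|] := posnP (k - m); first by move=> ->; rewrite add0n.
move=> k0; have := dvdn_leq k0 d; lia.
Qed.

(** The polynomial X^p - X has at most p roots, and the images of 0, .., p-1 already provide p of
    them. *)
Lemma prime_field_fixed (p : nat) (F : fieldType) (x : F) : p \in [pchar F] ->
  x ^+ p = x -> exists m : nat, x = m%:R.
Proof.
move=> pF xp; have p_prime := pcharf_prime pF.
pose s := [seq (m%:R : F) | m <- iota 0 p].
have [/mapP[m _ ->]|xn] := boolP (x \in s); first by exists m.
have sz : size ('X^p - 'X : {poly F}) = p.+1.
  by rewrite size_polyDl ?size_polyXn // size_polyN size_polyX ltnS prime_gt1.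
have nz : 'X^p - 'X != 0 :> {poly F} by rewrite -size_poly_eq0 sz.
suff : (size (x :: s) < size ('X^p - 'X : {poly F})%R)%N.
  by rewrite /= sz size_map size_iota ltnn.
apply: max_poly_roots => //.
  rewrite /= rootE !hornerE xp subrr eqxx /=; apply/allP => _ /mapP[m _ ->].
  by rewrite rootE !hornerE -(pFrobenius_autE pF) pFrobenius_aut_nat subrr.
rewrite /= xn map_inj_in_uniq ?iota_uniq // => m k.
by rewrite !mem_iota /= add0n => mp kp; exact: pchar_nat_inj pF mp kp.
Qed.

Section OmegaZero.
Variables (p a : nat) (p_prime : prime p) (a_gt0 : (0 < a)%N).
Variables (Qp : fieldType) (ordp : Qp -> \bar rat) (Qp_padic : padic_numbers p ordp).
Variables (K : fieldExtType Qp) (ord : K -> \bar rat) (ord_val : valuation ord).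
Hypothesis ord_ext : forall x : Qp, ord (x%:A) = ordp x.
Variables (Qq : {subfield K}) (Qq_deg : \dim Qq = a) (Qq_unram : unramified ord Qq).
Variables (zeta : K) (zeta_prim : p.-primitive_root zeta).
Hypothesis K_gen : <<Qq; zeta>>%VS = fullv.
Variables (Fq : finFieldType) (Fq_card : #|Fq| = (p ^ a)%N).
Variables (red : K -> Fq) (red_res : residue_map ord (integers_of ord Qq) red).

Lemma vgeA r (x : Qp) : vge ord r x%:A = vge ordp r x.
Proof. by rewrite /vge ord_ext. Qed.

Notation vge := (vge ord).
Notation vl := (vl ord).
Notation Zq := (integers_of ord Qq).

Lemma ord_p : ord p%:R = 1%:E.
Proof.
rewrite (_ : p%:R = (p%:R : Qp)%:A); last by rewrite scaler_nat.
by rewrite ord_ext; case: Qp_padic.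
Qed.
Let ordP := ord_p.

Lemma p_neq0 : p%:R != 0 :> K. Proof. exact: pnat_neq0 ord_val ordP. Qed.

Lemma rat_dense_Qp (x : Qp) : rat_dense_at ord (x%:A : K).
Proof.
move=> N; have [_ _ _ /(_ x N)[r hr]] := Qp_padic; exists r.
rewrite (_ : _ - _ = (x - ratr r)%:A); first by rewrite vgeA.
by rewrite scalerBl; congr (_ - _); rewrite -(fmorph_rat (in_alg K)).
Qed.

Lemma ZqP x : (x \in Zq) = (x \in Qq) && vge 0 x. Proof. by []. Qed.

Lemma Zq_O x : x \in Zq -> vge 0 x. Proof. by rewrite ZqP => /andP[]. Qed.

Lemma Zq_Q x : x \in Zq -> x \in Qq. Proof. by rewrite ZqP => /andP[]. Qed.

Lemma Zq_nat m : m%:R \in Zq.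
Proof. by rewrite ZqP vge_nat // andbT rpred_nat. Qed.

Lemma ZqD x y : x \in Zq -> y \in Zq -> x + y \in Zq.
Proof. by rewrite !ZqP => /andP[h1 h2] /andP[h3 h4]; rewrite rpredD // vgeD. Qed.

Lemma ZqB x y : x \in Zq -> y \in Zq -> x - y \in Zq.
Proof. by rewrite !ZqP => /andP[h1 h2] /andP[h3 h4]; rewrite rpredB // vgeB. Qed.

Lemma ZqM x y : x \in Zq -> y \in Zq -> x * y \in Zq.
Proof. by rewrite !ZqP => /andP[h1 h2] /andP[h3 h4]; rewrite rpredM // vgeM0. Qed.

Lemma ZqX x m : x \in Zq -> x ^+ m \in Zq.
Proof. by rewrite !ZqP => /andP[h1 h2]; rewrite rpredX // vgeX0. Qed.

Lemma Zq_sum (I : Type) (r : seq I) (P : pred I) (f : I -> K) :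
  (forall i, P i -> f i \in Zq) -> \sum_(i <- r | P i) f i \in Zq.
Proof.
move=> h; elim/big_ind: _ => //; [exact: (Zq_nat 0)|move=> x y; exact: ZqD].
Qed.

(** Absence of ramification moves the value into Q_p, where the rationals are dense. *)
Lemma Qq_vl_int x : x \in Qq -> x != 0 -> exists k : int, vl x = k%:~R.
Proof.
move=> xQ x0; have [y hy] := Qq_unram xQ x0.
have y0 : (y%:A : K) != 0.
  by apply: contraNneq x0 => y0; case: ord_val => h _ _; rewrite -h hy y0 h.
have [k hk] := vl_dense ord_val p_prime ordP y0 (rat_dense_Qp y).
by exists k; rewrite -hk vlE hy.
Qed.

(** Valuations on Q_q are integers, so a bound above k - 1 improves to k. *)
Lemma Qq_vge_ceil (k : int) r x : x \in Qq -> (k%:~R - 1 < r)%R -> vge r x -> vge k%:~R x.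
Proof.
move=> xQ kr; rewrite !vgeE //; have [//|x0] /= := eqVneq x 0.
have [m ->] := Qq_vl_int xQ x0 => h.
by have := lt_le_trans kr h; rewrite -[1]/(1%:~R) -intrB ltr_int ler_int; lia.
Qed.

Lemma Zq_pos x r : x \in Zq -> 0 < r -> vge r x -> vge 1 x.
Proof. by move=> /Zq_Q xQ r0; apply: (@Qq_vge_ceil 1) => //; rewrite subrr. Qed.

Lemma Qq_pdiv x : x \in Qq -> vge 1 x -> exists2 y, y \in Zq & x = p%:R * y.
Proof.
move=> xQ /(vge_pdvd ord_val ordP (N := 1%N))[y y0 e]; exists y => //.
rewrite ZqP y0 andbT; rewrite expr1 in e.
by rewrite -[y](mulKf p_neq0) -e rpredM // rpredV rpred_nat.
Qed.

Lemma redD : {in Zq &, forall x y, red (x + y) = red x + red y}.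
Proof. by case: red_res. Qed.
Lemma redM : {in Zq &, forall x y, red (x * y) = red x * red y}.
Proof. by case: red_res. Qed.
Lemma red1 : red 1 = 1. Proof. by case: red_res. Qed.

Lemma red0 : red 0 = 0.
Proof.
have h := redD (Zq_nat 0) (Zq_nat 0); apply: (addrI (red 0)).
by rewrite -h !addr0.
Qed.

Lemma redB : {in Zq &, forall x y, red (x - y) = red x - red y}.
Proof.
move=> x y xZ yZ; apply: (addIr (red y)); rewrite subrK -redD ?subrK //; exact: ZqB.
Qed.

Lemma red_nat m : red m%:R = m%:R.
Proof.
elim: m => [|m IH]; first exact: red0.
by rewrite -addn1 !natrD redD ?(Zq_nat 1) ?Zq_nat // IH red1.
Qed.

Lemma redX x m : x \in Zq -> red (x ^+ m) = red x ^+ m.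
Proof.
move=> xZ; elim: m => [|m IH]; first by rewrite !expr0 red1.
by rewrite !exprS redM ?ZqX // IH.
Qed.

Lemma red_sum (I : Type) (r : seq I) (f : I -> K) :
  (forall i, f i \in Zq) -> red (\sum_(i <- r) f i) = \sum_(i <- r) red (f i).
Proof.
move=> h; elim: r => [|i r IH]; first by rewrite !big_nil red0.
by rewrite !big_cons redD ?IH // Zq_sum.
Qed.

Lemma red_eq0 x : x \in Zq -> (red x == 0) = vge 1 x.
Proof.
move=> xZ; have [_ _ _ /(_ x xZ) -> _] := red_res.
have [->|x0] := eqVneq x 0; first by rewrite (ordv0 ord_val) (vge0 ord_val) ltey.
rewrite vgeE // (ordE ord_val) // lte_fin (negbTE x0) /=.
have [k ->] := Qq_vl_int (Zq_Q xZ) x0.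
by rewrite -[1]/(1%:~R) ltr0z ler_int gtz0_ge1.
Qed.

Lemma red_eq x y : x \in Zq -> y \in Zq -> (red x == red y) = vge 1 (x - y).
Proof. by move=> xZ yZ; rewrite -red_eq0 ?ZqB // redB // subr_eq0. Qed.

Lemma Fq_char : p \in [pchar Fq].
Proof. by rewrite inE p_prime /= -red_nat red_eq0 ?Zq_nat ?(vge_p ord_val ordP). Qed.

(** * The uniformizer zeta - 1 and expansions in its powers *)

Let pi := zeta - 1.
Let e : rat := (p.-1)%:R^-1.

Lemma p1_gt0 : (0 < p.-1)%N. Proof. by have := prime_gt1 p_prime; case: (p) => [|[]]. Qed.

Lemma e_gt0 : 0 < e. Proof. by rewrite /e invr_gt0 ltr0n p1_gt0. Qed.

Lemma e_le1 : e <= 1.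
Proof. by rewrite /e invf_le1 ?ltr0n ?p1_gt0 // ler1n p1_gt0. Qed.

Lemma p1e : (p.-1)%:R * e = 1.
Proof. by rewrite /e divff // pnatr_eq0 -lt0n p1_gt0. Qed.

Lemma pi_neq0 : pi != 0.
Proof.
rewrite subr_eq0; apply/eqP => z1; have := prim_order_dvd zeta_prim 1%N.
by rewrite z1 expr1n eqxx dvdn1 => /eqP p1; move: p_prime; rewrite p1.
Qed.

(* The relation ((1 + pi) ^ p - 1) / pi = 0, solved for its leading term. *)
Lemma pi_eisenstein : exists2 u : K, vge e u & pi ^+ p.-1 = - p%:R * (1 + u) /\ vl pi = e.
Proof.
have pE : p = p.-1.+1 by rewrite prednK // prime_gt0.
have zp : (1 + pi) ^+ p = 1 by rewrite addrC subrK (prim_expr_order zeta_prim).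
have z0 : vge 0 zeta.
  rewrite vgeE //; apply/orP; right; have h : zeta ^+ p = 1 by exact: prim_expr_order.
  have zn : zeta != 0.
    apply/eqP => zE; move/eqP: h.
    by rewrite zE expr0n eqn0Ngt prime_gt0 //= eq_sym oner_eq0.
  have := vlX ord_val p zn; rewrite h vl1 // => /esym/eqP; rewrite mulf_eq0 pnatr_eq0.
  by rewrite (negbTE (lt0n_neq0 (prime_gt0 p_prime))) /= => /eqP ->.
have pi0 : vge 0 pi by rewrite vgeB ?vge1.
have rel : \sum_(k < p) pi ^+ k *+ 'C(p, k.+1) = 0.
  apply: (mulfI pi_neq0); rewrite mulr0.
  move: zp; rewrite exprDn big_ord_recl /= subn0 expr1n mul1r expr0 bin0 mulr1n.
  move=> /(canRL (addKr _)); rewrite [X in _ = X]addNr => h0; rewrite -[RHS]h0 mulr_sumr; apply: eq_bigr => i _.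
  by rewrite expr1n mul1r /bump /= add1n exprS mulrnAr.
pose d k := ('C(p, k.+1) %/ p)%N.
have hd k : (k < p.-1)%N -> 'C(p, k.+1) = (d k * p)%N.
  move=> kp; rewrite divnK // prime_dvd_bin // ltnS; lia.
have [m mE] : exists m, p.-1 = m.+1 by case: (p.-1) p1_gt0 => // m; exists m.
pose u := \sum_(k < m) pi ^+ k.+1 *+ d k.+1.
have relu : pi ^+ p.-1 = - p%:R * (1 + u).
  apply: (addIr (p%:R * (1 + u))); rewrite mulNr addNr -rel [in RHS]pE.
  rewrite big_ord_recr /= addrC -pE binn mulr1n; congr (_ + _).
  rewrite mE big_ord_recl /= expr0 bin1 mulrDr mulr1; congr (_ + _).
  rewrite mulr_sumr; apply: eq_bigr => k _; rewrite /bump /= add1n hd.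
    by rewrite mulrnA mulr_natl.
  by rewrite mE ltnS.
have u0 : vge 0 u by apply: vge_sum => // k _; apply: vgeMn => //; exact: vgeX0.
have piv : vge e pi.
  have : vge 1 (pi ^+ p.-1).
    rewrite relu mulNr vgeN //; apply: vgeM0r; rewrite ?(vge_p ord_val ordP) //.
    by rewrite vgeD ?vge1.
  rewrite !vgeE // expf_eq0 (negbTE pi_neq0) andbF vlX ?pi_neq0 //= -[X in X <= _]p1e.
  by rewrite ler_pM2l // ltr0n p1_gt0.
have ue : vge e u.
  apply: vge_sum => // k _; apply: vgeMn => //; rewrite exprS.
  by apply: vgeM0r => //; exact: vgeX0.
exists u => //; split => //.
have [n1 v1] : 1 + u != 0 /\ vl (1 + u) = vl 1.
  apply: vl_lt_addl; rewrite ?oner_eq0 // vl1 //; move: ue; rewrite vgeE //.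
  by case/orP => [->//|h]; rewrite (lt_le_trans e_gt0 h) orbT.
have := congr1 vl relu; rewrite vlX ?pi_neq0 // vlM ?oppr_eq0 ?p_neq0 //.
rewrite v1 vl1 // vlN // (vl_p ordP) addr0 => h.
by apply: (@mulfI _ (p.-1)%:R); rewrite ?p1e // pnatr_eq0 -lt0n p1_gt0.
Qed.

Lemma vl_pi : vl pi = e. Proof. by have [u _ []] := pi_eisenstein. Qed.

Lemma pi_expand x : exists2 c : 'I_p.-1 -> K, (forall i, c i \in Qq) & x = \sum_i c i * pi ^+ i.
Proof.
have /Fadjoin_polyP[P PQ xE] : x \in <<Qq; zeta>>%VS by rewrite K_gen memvf.
have zsum : \sum_(i < p) zeta ^+ i = 0.
  apply: (mulfI pi_neq0); rewrite mulr0 /pi.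
  have := subrX1 zeta p; rewrite (prim_expr_order zeta_prim) subrr => h.
  by rewrite [RHS]h; congr (_ * _).
(* The p-th cyclotomic polynomial: reducing P modulo E brings its degree below p - 1. *)
pose E : {poly K} := \poly_(i < p) 1.
have sE : size E = p by rewrite size_poly_eq // oner_neq0.
have En : E != 0 by rewrite -size_poly_eq0 sE -lt0n prime_gt0.
have EQ : E \is a polyOver Qq by apply/polyOver_poly => i _; exact: rpred1.
have rE : E.[zeta] = 0.
  by rewrite horner_poly -[RHS]zsum; apply: eq_bigr => i _; rewrite mul1r.
(* Substituting X + 1 turns a polynomial in zeta into one in zeta - 1. *)
pose R := (P %% E) \Po ('X + 1%:P).
have RQ : R \is a polyOver Qq.
  apply: polyOver_comp; first exact: modp_polyOver.
  by rewrite rpredD ?polyOverX // polyOverC rpred1.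
exists (fun i => R`_i) => [i|]; first by have /polyOverP := RQ.
have sR : (size R <= p.-1)%N.
  rewrite size_comp_poly2 ?size_XaddC //.
  by rewrite -ltnS prednK ?prime_gt0 // -[X in (_ < X)%N]sE ltn_modp.
rewrite -(horner_coef_wide _ sR) /R horner_comp !hornerE /pi subrK xE.
by rewrite {1}(divp_eq P E) hornerD hornerM rE mulr0 add0r.
Qed.

(** The c_i have integer valuations and the pi^i with i < p - 1 have valuations distinct modulo 1,
    so no two nonzero terms have the same valuation and nothing cancels. *)
Lemma pi_vge r (c : 'I_p.-1 -> K) : (forall i, c i \in Qq) ->
  vge r (\sum_i c i * pi ^+ i) -> forall i : 'I_p.-1, vge (r - i%:R * e) (c i).
Proof.
move=> cQ h i; have pin := pi_neq0.
have := @distinct_vge _ _ ord_val r _ (fun i : 'I_p.-1 => c i * pi ^+ i) _ h i.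
rewrite -(vge_mulK ord_val (r - _) _ (expf_neq0 i pin)) vlX // vl_pi subrK; apply.
move=> {i}i j ij; rewrite !mulf_eq0 !expf_eq0 !(negbTE pin) !andbF !orbF => ci cj.
rewrite !vlM ?expf_neq0 // !vlX // vl_pi.
have [k ->] := Qq_vl_int (cQ i) ci; have [l ->] := Qq_vl_int (cQ j) cj.
apply: contra ij => /eqP h1.
have : ((k * p.-1 + i)%:~R = (l * p.-1 + j)%:~R :> rat).
  have H (x : int) (m : nat) : (x * p.-1 + m)%:~R = (x%:~R + m%:R * e) * (p.-1)%:R.
    by rewrite intrD intrM -!pmulrn mulrDl -mulrA [e * _]mulrC p1e mulr1.
  by rewrite !H h1.
move/eqP; rewrite eqr_int => /eqP h2.
have := ltn_ord i; have := ltn_ord j; move: h2; set q := p.-1.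
move=> h2 jq iq; apply/eqP/val_inj => /=.
have : k = l by nia.
by move=> kl; move: h2; rewrite kl; lia.
Qed.

(** By [pi_vge] each coefficient has valuation at least -i/(p-1) > -1, hence at least 0 since it is
    an integer. Thus O_0 is the full valuation ring. *)
Lemma pi_expand_O x : vge 0 x ->
  exists2 c : 'I_p.-1 -> K, (forall i, c i \in Zq) & x = \sum_i c i * pi ^+ i.
Proof.
have [c cQ ->] := pi_expand x => h; exists c => // i; rewrite ZqP cQ /=.
apply: (@Qq_vge_ceil 0 _ _ (cQ i) _ (pi_vge cQ h i)).
have : i%:R * e < (p.-1)%:R * e by rewrite ltr_pM2r ?e_gt0 // ltr_nat.
by rewrite p1e => h'; lra.
Qed.

Lemma pi_O : vge 0 pi. Proof. by rewrite vgeE // vl_pi ltW ?orbT // e_gt0. Qed.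

Lemma zeta_O : vge 0 zeta. Proof. by rewrite -(subrK 1 zeta) vgeD ?pi_O ?vge1. Qed.

Lemma adjoin_vge (E : {subfield K}) x : adjoin (integers_of ord E) zeta x -> vge 0 x.
Proof.
case=> P /allP PE ->; rewrite horner_coef; apply: vge_sum => // i _.
apply: vgeM0 => //; last by apply: vgeX0 => //; exact: zeta_O.
by have /andP[] := PE _ (mem_nth 0 (ltn_ord i)).
Qed.

Lemma pi_adjoin (E : {subfield K}) (c : 'I_p.-1 -> K) :
  (forall i, c i \in integers_of ord E) -> adjoin (integers_of ord E) zeta (\sum_i c i * pi ^+ i).
Proof.
move=> cE; exists (\sum_i c i *: ('X - 1%:P) ^+ i); last first.
  by rewrite horner_sum; apply: eq_bigr => i _; rewrite !hornerE.
apply/allP => _ /(nthP 0)[k _ <-]; rewrite coef_sum.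
have h i : exists z : int, (c i *: ('X - 1%:P) ^+ i)`_k = c i * z%:~R.
  exists (('X - 1%:P : {poly int}) ^+ i)`_k; rewrite coefZ; congr (_ * _).
  by rewrite -coef_map rmorphXn rmorphB /= map_polyX map_polyC rmorph1.
rewrite inE; apply/andP; split.
  apply: rpred_sum => i _; have [z ->] := h i.
  by have /andP[ci _] := cE i; rewrite rpredM // rpred_int.
apply: vge_sum => // i _; have [z ->] := h i.
by have /andP[_ ci] := cE i; apply: vgeM0r => //; exact: vge_int.
Qed.

Lemma adjoin_Zq x : adjoin Zq zeta x <-> vge 0 x.
Proof.
split; first exact: adjoin_vge.
by case/pi_expand_O => c cZ ->; exact: pi_adjoin.
Qed.

(** * Completeness of Q_q and Omega_0 *)

Lemma complete_Qp : complete_on ord (fun x : K => exists y : Qp, x = y%:A).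
Proof.
move=> s sV sC; have [t ht] := ex_choice sV.
have [_ _ cpl _] := Qp_padic.
have [N|l hl] := cpl t; last first.
  exists l%:A; first by exists l.
  by move=> N; have [m0 h] := hl N; exists m0 => m /h; rewrite ht -scalerBl vgeA.
have [m0 h] := sC N; exists m0 => m1 m2 h1 h2.
by have := h _ _ h1 h2; rewrite !ht -scalerBl vgeA.
Qed.

(** Lifts of an F_p-basis of F_q. If a coefficient were worse than the sum, dividing by the one of
    least valuation and reducing would give a nontrivial relation over F_p. *)
Lemma Zq_basis : exists2 b : 'I_a -> K, forall i, b i \in Zq &
  forall r (c : 'I_a -> Qp), vge r (\sum_i (c i)%:A * b i) -> forall i, vge r (c i)%:A.
Proof.
have [be hbe] := Fp_basis p_prime Fq_card.
have [b hb] : exists b : 'I_a -> K, forall i, b i \in Zq /\ red (b i) = be i.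
  apply: (@ex_choice _ _ (fun i x => x \in Zq /\ red x = be i)) => i.
  by have [_ _ _ _ /(_ (be i))[x xZ xE]] := red_res; exists x.
exists b => [i|r c]; first by case: (hb i).
set v := fun i => (c i)%:A : K.
move=> h i; apply/negPn/negP => ci.
have [i0 Pi0 min] := arg_minP (fun i => vl (v i)) (ci : (fun i => ~~ vge r (v i)) i).
have c0 : v i0 != 0 by apply: contra Pi0 => /eqP ->; rewrite vge0.
have lt : vl (v i0) < r by move: Pi0; rewrite vgeE // negb_or -ltNge => /andP[].
have vmin j : vge (vl (v i0)) (v j).
  have [hj|hj] := boolP (vge r (v j)); first exact: vge_le (ltW lt) hj.
  by apply: vge_le (min j hj) (vge_val ord_val _).
(* The coefficients normalised so that all are integral and the one at [i0] is 1. *)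
pose d j := (c j / c i0)%:A : K.
have dE j : d j = v j / v i0.
  apply: (mulIf c0); rewrite divfK // /d /v mulr_algl scalerA divfK //.
  by apply: contraNneq c0 => h0; rewrite /v h0 scale0r.
have d0 j : vge 0 (d j).
  by rewrite -(vge_mulK ord_val _ _ c0) dE divfK // add0r.
have [m hm] : exists m : 'I_a -> nat, forall j, vge 1 (d j - (m j)%:R).
  apply: (@ex_choice _ _ (fun j (k : nat) => vge 1 (d j - k%:R))) => j.
  have [k _ hk] := residue_nat ord_val p_prime ordP (rat_dense_Qp _) (d0 j).
  by exists k.
have dZ j : d j \in Zq by rewrite ZqP d0 andbT rpredZ // rpred1.
have mi0 : ~~ (p %| m i0)%N.
  have := hm i0; rewrite dE divff // -red_eq ?(Zq_nat 1) ?Zq_nat // red1 red_nat eq_sym.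
  by rewrite (dvdn_pcharf Fq_char) => /eqP ->; rewrite oner_eq0.
move/negP: mi0; apply; apply: hbe.
have <- : red (\sum_j d j * b j) = \sum_k (m k)%:R * be k.
  rewrite red_sum => [|j]; last by rewrite ZqM //; case: (hb j).
  apply: eq_bigr => j _; have [bj <-] := hb j.
  rewrite redM //; congr (_ * _); rewrite -red_nat; apply/eqP.
  by rewrite red_eq ?Zq_nat.
apply/eqP; rewrite red_eq0; last by apply: Zq_sum => j _; rewrite ZqM //; case: (hb j).
apply: (@Zq_pos _ (r - vl (v i0))); first by apply: Zq_sum => j _; rewrite ZqM //; case: (hb j).
  by rewrite subr_gt0.
rewrite -(vge_mulK ord_val _ _ c0) subrK mulr_suml.
by under eq_bigr do rewrite mulrAC dE divfK //.
Qed.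

Lemma complete_Qq : complete_on ord (fun x => x \in Qq).
Proof.
have [b bZ bv] := Zq_basis.
have free_b : free [tuple b i | i < a].
  apply/freeP => k hk i; apply/eqP.
  suff : (k i)%:A == 0 :> K by rewrite scaler_eq0 oner_eq0 orbF.
  apply/eqP/(vge_eq0 ord_val) => N; apply: bv; rewrite [X in vge _ X](_ : _ = 0) ?vge0 //.
  rewrite -[RHS]hk; apply: eq_bigr => j _.
  by rewrite mulr_algl (nth_map j) ?size_enum_ord // nth_ord_enum.
have basis_b : basis_of Qq [tuple b i | i < a].
  rewrite basisEfree free_b size_tuple Qq_deg leqnn andbT /=.
  by apply/span_subvP => _ /mapP[i _ ->]; apply: Zq_Q.
apply: (complete_span ord_val (b := b) (C := 0) complete_Qp).
- by move=> _ _ [x ->] [y ->]; exists (x - y); rewrite scalerBl.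
- move=> c hc; apply: rpred_sum => i _; apply: rpredM; last exact: Zq_Q.
  by have [y ->] := hc i; rewrite rpredZ // rpred1.
- move=> x xQ; exists (fun i => (coord [tuple b i | i < a] i x)%:A); first by eexists.
  rewrite {1}(coord_basis basis_b xQ); apply: eq_bigr => i _.
  by rewrite mulr_algl (nth_map i) ?size_enum_ord // nth_ord_enum.
- move=> r c hc; have [y hy] := ex_choice hc.
  move=> h i; rewrite subr0 hy; apply: bv.
  by under eq_bigr do rewrite -hy.
Qed.

Lemma K_complete : complete_valuation ord.
Proof.
have h : complete_on ord (fun _ : K => True).
  apply: (complete_span ord_val (b := fun i : 'I_p.-1 => pi ^+ i) (C := 1) complete_Qq) => //.
  - by move=> x y; exact: rpredB.
  - by move=> x _; exact: pi_expand.
  - move=> r c cQ /(pi_vge cQ) h i; apply: vge_le (h i) => //.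
    have : i%:R * e < (p.-1)%:R * e by rewrite ltr_pM2r ?e_gt0 // ltr_nat.
    by rewrite p1e => h'; lra.
by move=> s hs; have [//|l _ hl] := h s _ hs; exists l.
Qed.

(** * The Frobenius automorphism *)

Variables (sigma : 'AEnd(K)) (sigma_zeta : sigma zeta = zeta).
Hypothesis sigma_frob : {in Zq, forall x, sigma x \in Zq /\ red (sigma x) = red x ^+ p}.

Lemma sigma_pi : sigma pi = pi. Proof. by rewrite rmorphB /= sigma_zeta rmorph1. Qed.

Definition sig k := iter k sigma.

Lemma sig_frob k : {in Zq, forall x, sig k x \in Zq /\ red (sig k x) = red x ^+ (p ^ k)}.
Proof.
move=> x xZ; elim: k => [|k [IH1 IH2]]; first by rewrite expn0 expr1.
by have [h1 h2] := sigma_frob IH1; split => //=; rewrite h2 IH2 expnSr exprM.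
Qed.

Lemma sigX k x m : sig k (x ^+ m) = sig k x ^+ m.
Proof. by elim: k => //= k ->; rewrite rmorphXn. Qed.

Lemma sigD k x y : sig k (x + y) = sig k x + sig k y.
Proof. by elim: k => //= k ->; rewrite rmorphD. Qed.

Lemma sigM k x y : sig k (x * y) = sig k x * sig k y.
Proof. by elim: k => //= k ->; rewrite rmorphM. Qed.

Lemma sig_nat k m : sig k m%:R = m%:R.
Proof. by elim: k => //= k ->; rewrite rmorph_nat. Qed.

(** Induction on the precision. Write x = y + p x1 with y a high q-power of x: the congruence of
    sigma^a x with x modulo p becomes one modulo p^(M+1) for y, while x1 only needs the previous
    precision. *)
Lemma sigma_Zq_order x : x \in Zq -> sig a x = x.
Proof.
move=> xZ; apply: (vge_eq ord_val) => M; elim: M x xZ => [|M IH] x xZ.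
  by rewrite vgeB // ?Zq_O //; case: (sig_frob a xZ).
pose y := x ^+ (p ^ (a * M.+1)).
have yZ : y \in Zq by exact: ZqX.
have red_pa (t : Fq) : t ^+ (p ^ a) = t by rewrite -Fq_card expf_card.
have yx : vge 1 (x - y).
  rewrite -red_eq // redX // expnM; apply/eqP; symmetry.
  by elim: (M.+1) => [|k IHk]; rewrite ?expn0 ?expr1 // expnS exprM red_pa IHk.
have [x1 x1Z e1] : exists2 x1, x1 \in Zq & x - y = p%:R * x1.
  by apply: Qq_pdiv => //; rewrite Zq_Q // ZqB.
have -> : x = y + p%:R * x1 by rewrite -e1; ring.
rewrite sigD sigM sig_nat.
rewrite (_ : _ - _ = (sig a y - y) + p%:R * (sig a x1 - x1)); last by ring.
apply: vgeD => //; last first.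
  by rewrite -natr1 addrC; apply: vgeM => //; [exact: vge_p|exact: IH].
rewrite /y sigX.
have [sZ sr] := sig_frob a xZ.
have h1 : vge 1 (sig a x - x) by rewrite -red_eq // sr red_pa.
apply: vge_le (pow_closeX ord_val p_prime ordP (a * M.+1) ler01 (lexx 1) (lexx 1) (Zq_O sZ) (Zq_O xZ) h1) => //.
by rewrite mulr1 -[X in _ <= X + _]/(1%:R) -natrD ler_nat; nia.
Qed.

Lemma sigma_Qq x : x \in Qq -> sigma x \in Qq.
Proof.
move=> xQ; have [N hN] := rat_ub (- vl x).
have h : p%:R ^+ N * x \in Zq.
  rewrite ZqP rpredM ?rpredX ?rpred_nat //=.
  rewrite -[0](subrr (N%:R)); apply: vgeM => //; first exact: vge_pX.
  by apply: vge_le (vge_val ord_val x) => //; lra.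
have [/Zq_Q] := sigma_frob h; rewrite rmorphM rmorphXn rmorph_nat => h1 _.
by rewrite -[sigma x](mulKf (expf_neq0 N p_neq0)) rpredM // rpredV rpredX // rpred_nat.
Qed.

(** Scaling by a power of p passes from Z_q to Q_q; expanding in powers of pi, which sigma fixes,
    passes to K. *)
Lemma sigma_order x : sig a x = x.
Proof.
have [c cQ ->] := pi_expand x.
have hQ y : y \in Qq -> sig a y = y.
  move=> yQ; have [N hN] := rat_ub (- vl y).
  have h : p%:R ^+ N * y \in Zq.
    rewrite ZqP rpredM ?rpredX ?rpred_nat //=.
    rewrite -[0](subrr (N%:R)); apply: vgeM => //; first exact: vge_pX.
    by apply: vge_le (vge_val ord_val y) => //; lra.
  have := sigma_Zq_order h; rewrite sigM sigX sig_nat.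
  by apply: mulfI; rewrite expf_neq0 // p_neq0.
have hp : sig a pi = pi by elim: (a) => //= k ->; exact: sigma_pi.
have -> : sig a (\sum_i c i * pi ^+ i) = \sum_i sig a (c i * pi ^+ i).
  by elim: (a) => //= k ->; rewrite rmorph_sum.
by apply: eq_bigr => i _; rewrite sigM sigX hp hQ.
Qed.

Lemma sigma_vge0 x : vge 0 x -> vge 0 (sigma x).
Proof.
case/pi_expand_O => c cZ ->; rewrite rmorph_sum; apply: vge_sum => // i _.
rewrite rmorphM rmorphXn /= sigma_pi; apply: vgeM0r => //; last by apply: vgeX0 => //; exact: pi_O.
by apply: Zq_O; case: (sigma_frob (cZ i)).
Qed.

Lemma sigma_vge_nat (N : nat) x : vge N%:R x -> vge N%:R (sigma x).
Proof.
case/(vge_pdvd ord_val ordP) => y y0 ->; rewrite rmorphM rmorphXn rmorph_nat.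
by apply: vgeM0r; rewrite ?sigma_vge0 // vge_pX.
Qed.

Lemma sigma_unitV : forall x, (sigma^-1)%VF x = sig a.-1 x.
Proof.
move=> x; rewrite -[in LHS](sigma_order x) -(prednK a_gt0) /=.
by rewrite lker0_lfunK // AEnd_lker0.
Qed.

(** * The element gamma: valuations and invariance under Frobenius *)

Variables (gamma : K) (gammaP : is_gamma p ord gamma).

Lemma gamma_neq0 : gamma != 0.
Proof. by case: gammaP => _ h; case: ord_val => h0 _ _; rewrite -h0 h. Qed.

Lemma vl_gamma : vl gamma = e.
Proof. by case: gammaP => _; rewrite vlE => ->. Qed.

Let term j := gamma ^+ (p ^ j) / p%:R ^+ j.

(** This is (p^j - 1)/(p - 1), the integer part of the valuation of gamma^(p^j) above that of
    gamma. *)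
Fixpoint geo (j : nat) : nat := if j is j'.+1 then p ^ j' + geo j' else 0.

Lemma geoE j : (p ^ j = (p.-1) * geo j + 1)%N.
Proof.
elim: j => [|j IH] /=; first by rewrite muln0 expn0.
rewrite expnS mulnDr -addnA -IH addnC -[X in (X * _)%N](prednK (prime_gt0 p_prime)).
by rewrite mulSn.
Qed.

Lemma geo_mono m j : (m <= j)%N -> (geo m + j <= geo j + m)%N.
Proof.
elim: j => [|j IH]; first by rewrite leqn0 => /eqP ->.
rewrite leq_eqVlt => /orP[/eqP -> //|]; rewrite ltnS => /IH /=.
have : (0 < p ^ j)%N by rewrite expn_gt0 prime_gt0.
lia.
Qed.

Lemma term_neq0 j : term j != 0.
Proof. by rewrite mulf_neq0 ?invr_eq0 ?expf_neq0 ?gamma_neq0 ?p_neq0. Qed.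

Lemma vl_term j : vl (term j) = e + (geo j)%:R - j%:R.
Proof.
rewrite vlM ?invr_eq0 ?expf_neq0 ?gamma_neq0 ?p_neq0 //.
rewrite vlX ?gamma_neq0 // vlV // vlX ?p_neq0 // vl_gamma (vl_p ordP) geoE natrD natrM.
by rewrite mulrDl mulrAC p1e; ring.
Qed.

(** The whole series vanishes at gamma, so gamma_m is minus its tail; by [geo_mono] the first term
    of the tail has the least valuation. *)
Lemma gamma__vge m : vge (e + (geo m.+1)%:R - m.+1%:R) (gamma_ p gamma m).
Proof.
case: gammaP => h _.
have := has_sum_approx ord_val (r := e + (geo m.+1)%:R - m.+1%:R) h (iota_uniq 0 m.+1).
rewrite sub0r vgeN //.
have -> : \sum_(i <- iota 0 m.+1) gamma ^+ (p ^ i) / p%:R ^+ i = gamma_ p gamma m.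
  by rewrite /gamma_ -(big_mkord xpredT term) /index_iota subn0.
apply => i; rewrite mem_iota /= add0n -leqNgt => mi.
rewrite vgeE // -/(term i) (negbTE (term_neq0 i)) /= vl_term.
by have := geo_mono mi; rewrite -(ler_nat rat) !natrD; lra.
Qed.

(** The case m = 1 of [gamma__vge] says that gamma + gamma^p / p is negligible compared with
    gamma. *)
Lemma gammaX_p : exists2 u : K, vge e u & gamma ^+ p.-1 = - p%:R * (1 + u).
Proof.
have := gamma__vge 1; rewrite /gamma_ !big_ord_recl big_ord0 /= expn1 divr1 expr1 addr0.
rewrite /bump /= addn0 expn0 expr1 => h.
exists ((gamma + gamma ^+ (p ^ 1) / p%:R ^+ 1) / - gamma); last first.
  rewrite expn1 expr1; have := gamma_neq0; have := p_neq0.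
  have -> : gamma ^+ p = gamma * gamma ^+ p.-1 by rewrite -exprS prednK // prime_gt0.
  by move=> p0 g0; field; rewrite ?oppr_eq0 ?p0 ?g0.
rewrite -(vge_mulK ord_val _ _ gamma_neq0) vl_gamma invrN mulrN mulNr divfK ?gamma_neq0 //.
rewrite vgeN //; apply: vge_le h => //.
have := prime_gt1 p_prime; rewrite -(ler_nat rat) natrD => h1.
by have := e_le1; lra.
Qed.

Lemma gamma_over_pi : vge 0 (gamma / pi).
Proof.
rewrite -(vge_mulK ord_val _ _ pi_neq0) divfK ?pi_neq0 // vl_pi add0r.
by rewrite vgeE // vl_gamma lexx orbT.
Qed.

(** Both gamma^(p-1) and pi^(p-1) equal -p up to a factor congruent to 1, so the residue of gamma/pi
    is a (p-1)-st root of unity; it lies in F_p and Frobenius fixes it. *)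
Lemma sigma_gamma_close : vge e (sigma (gamma / pi) - gamma / pi).
Proof.
have e0 := ltW e_gt0; have e1 := e_le1.
set g := gamma / pi; have [c cZ gE] := pi_expand_O gamma_over_pi.
pose i0 : 'I_p.-1 := Ordinal p1_gt0.
(* Modulo pi only the constant coefficient of the expansion is left; it is an element of Z_q, to
   which [red] applies. *)
have gc : vge e (g - c i0).
  rewrite /g gE (bigD1 i0) //= expr0 mulr1 addrAC subrr add0r; apply: vge_sum => // i ni.
  apply: vgeM0 => //; first exact: Zq_O.
  case: i ni => [[|i] hi] ni /=; first by case/eqP: ni; apply/val_inj.
  by rewrite exprS; apply: vgeM0r => //; [rewrite vgeE // vl_pi lexx orbT|apply: vgeX0 => //; exact: pi_O].
have g1 : vge e (g ^+ p.-1 - 1).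
  have [u ue hu] := pi_eisenstein; have [w we hw] := gammaX_p.
  have [u1 vu1] : 1 + u != 0 /\ vl (1 + u) = vl 1.
    apply: vl_lt_addl; rewrite ?oner_eq0 // vl1 //; move: ue; rewrite vgeE //.
    by case/orP => [->//|h]; rewrite (lt_le_trans e_gt0 h) orbT.
  rewrite /g expr_div_n hu.1 hw.
  rewrite (_ : _ - 1 = (w - u) / (1 + u)); last first.
    by have p0 := p_neq0; field; rewrite u1 oppr_eq0 p0.
  apply: vgeM0r; rewrite ?vgeB // vgeE // vlV // vu1 vl1 // oppr0 lexx orbT //.
have c1 : vge e (c i0 ^+ p.-1 - 1).
  rewrite (_ : _ - 1 = (g ^+ p.-1 - 1) - (g ^+ p.-1 - c i0 ^+ p.-1)); last by ring.
  apply: vgeB => //; rewrite subrXX; apply: vgeM0r => //.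
  by apply: vge_sum => // i _; apply: vgeM0 => //; apply: vgeX0 => //; [exact: gamma_over_pi|exact: Zq_O].
have rc : red (c i0) ^+ p.-1 = 1.
  apply/eqP; rewrite -redX // -red1 red_eq ?ZqX ?(Zq_nat 1) //.
  by apply: Zq_pos e_gt0 c1; rewrite ZqB ?ZqX ?(Zq_nat 1).
have [sZ sr] := sigma_frob (cZ i0).
have sc : vge e (sigma (c i0) - c i0).
  apply: vge_le e1 _ => //; rewrite -red_eq // sr; apply/eqP.
  by rewrite -[in LHS](prednK (prime_gt0 p_prime)) exprS rc mulr1.
have sg : vge e (sigma g - sigma (c i0)).
  rewrite /g gE (bigD1 i0) //= rmorphD /= expr0 mulr1 addrAC subrr add0r rmorph_sum.
  apply: vge_sum => // i ni; rewrite rmorphM rmorphXn /= sigma_pi.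
  apply: vgeM0 => //; first by apply: sigma_vge0; exact: Zq_O.
  case: i ni => [[|i] hi] ni /=; first by case/eqP: ni; apply/val_inj.
  by rewrite exprS; apply: vgeM0r => //; [rewrite vgeE // vl_pi lexx orbT|apply: vgeX0 => //; exact: pi_O].
rewrite (_ : _ - _ = (sigma g - sigma (c i0)) + (sigma (c i0) - c i0) - (g - c i0)); last by ring.
by rewrite vgeB // vgeD.
Qed.

(* Two zeros of the series that agree to first order are equal: the terms of
   index at least 1 do not affect the valuation of the difference. *)
Lemma sigma_gamma : sigma gamma = gamma.
Proof.
have e0 := e_gt0; have e1 := e_le1.
have gp : gamma = (gamma / pi) * pi by rewrite divfK ?pi_neq0.
have gp0 : gamma / pi != 0 by rewrite mulf_neq0 ?invr_eq0 ?gamma_neq0 ?pi_neq0.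
have vgp : vl (gamma / pi) = 0.
  by rewrite vlM ?invr_eq0 ?gamma_neq0 ?pi_neq0 // vlV // vl_gamma vl_pi subrr.
pose d := (sigma (gamma / pi) - gamma / pi) / (gamma / pi).
have de : vge e d by rewrite -(vge_mulK ord_val _ _ gp0) divfK // vgp addr0 sigma_gamma_close.
have sE : sigma gamma = gamma * (1 + d).
  rewrite gp rmorphM /= sigma_pi /d; move: (sigma _) => t.
  by field; rewrite pi_neq0 gamma_neq0.
rewrite sE; suff -> : d = 0 by rewrite addr0 mulr1.
apply/eqP/negPn/negP => d0.
have vd : e <= vl d by move: de; rewrite vgeE // (negbTE d0).
case: gammaP => hs _.
have hs' : has_sum ord (fun j => term j * ((1 + d) ^+ (p ^ j) - 1)) 0.
  move=> N; have [S hS] := hs N; exists S => S' uS sub; have := hS S' uS sub.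
  have h1 := hS S' uS sub; have h2 := sigma_vge_nat h1.
  move=> _; have := vgeB ord_val h2 h1; congr vge.
  rewrite !sub0r rmorphN opprK addrC raddf_sum -sumrB /= -sumrN; apply: eq_bigr => j _.
  rewrite fmorph_div !rmorphXn rmorph_nat /= sE exprMn /term /=; ring.
have := has_sum_approx ord_val (r := vl d + e + e) hs' (isT : uniq [:: 0%N]).
rewrite big_seq1 sub0r vgeN // /term expn0 !expr1 expr0 divr1.
rewrite (_ : 1 + d - 1 = d); last by ring.
have d1 : vge 0 (1 + d) by rewrite vgeD ?vge1 //; apply: vge_le (ltW e0) de.
have h : forall i, i \notin [:: 0%N] -> vge (vl d + e + e) (term i * ((1 + d) ^+ (p ^ i) - 1)).
  case=> [//|i] _.
  have t : vge e (term i.+1).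
    rewrite vgeE // (negbTE (term_neq0 _)) vl_term orFb.
    have := geo_mono (leq0n i.+1); rewrite addn0 -[(geo 0 + _)%N]/(i.+1) -(ler_nat rat).
    by lra.
  have hd : vge (vl d) (1 + d - 1).
    by rewrite (_ : 1 + d - 1 = d) ?vge_val //; ring.
  have := pow_closeX ord_val p_prime ordP i.+1 (ltW e0) e1 vd d1 (vge1 ord_val) hd.
  rewrite expr1n => h2; apply: vge_le (vgeM ord_val t h2) => //.
  have : 0 <= i%:R * e by rewrite mulr_ge0 // ltW.
  by rewrite -natr1 mulrDl mul1r; lra.
move=> /(_ h); rewrite vgeE // mulf_eq0 (negbTE d0) (negbTE gamma_neq0) /=.
by rewrite (vlM ord_val gamma_neq0 d0) vl_gamma; lra.
Qed.

Lemma sig_gamma k : sig k gamma = gamma.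
Proof. by elim: k => //= k ->; exact: sigma_gamma. Qed.

Lemma sig_vge0 k x : vge 0 x -> vge 0 (sig k x).
Proof. by move=> x0; elim: k => //= k; exact: sigma_vge0. Qed.

(** Beyond the gamma^(p^m) matched by the weight of x^(p^m v_i), the coefficient p^m gamma_m carries
    p^(p^m - 1). This surplus drives all later estimates. *)
Lemma gamma__coef m : vge ((p ^ m)%:R * e + ((p ^ m)%:R - 1)) (p%:R ^+ m * gamma_ p gamma m).
Proof.
apply: vge_le (vgeM ord_val (vge_pX ord_val ordP m) (gamma__vge m)) => //.
have pm : (p ^ m)%:R * e = (geo m)%:R + e by rewrite geoE natrD natrM mulrDl mulrAC p1e !mul1r.
by rewrite pm /= natrD -natr1; lra.
Qed.

(** * The Teichmueller lift and the elements fixed by Frobenius *)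

Variable lambda : K.
Hypotheses (lambda_Zq : lambda \in Zq) (lambda_teich : lambda ^+ (p ^ a) = lambda).

(** Both sides are fixed by the q-th power map and congruent modulo p, hence equal. *)
Lemma sigma_lambda : sigma lambda = lambda ^+ p.
Proof.
have [sZ sr] := sigma_frob lambda_Zq.
apply: (fixed_close_eq ord_val p_prime ordP a_gt0 ltr01 (lexx 1) (Zq_O sZ)).
- by apply: vgeX0 => //; exact: Zq_O.
- by rewrite -red_eq ?ZqX // sr redX.
- by rewrite -rmorphXn lambda_teich.
- by rewrite -exprM mulnC exprM lambda_teich.
Qed.

Lemma lambda_unit lambdabar : red lambda = lambdabar -> lambdabar != 0 -> lambda != 0 /\ vl lambda = 0.
Proof.
move=> <- r0; have ln0 : lambda != 0 by apply: contraNneq r0 => ->; rewrite red0.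
split=> //; have := r0; rewrite red_eq0 // vgeE // (negbTE ln0) /= -ltNge.
have := Zq_O lambda_Zq; rewrite vgeE // (negbTE ln0) /=.
have [k ->] := Qq_vl_int (Zq_Q lambda_Zq) ln0.
rewrite -[1]/(1%:~R) -[0]/(0%:~R) ler_int ltr_int => h1 h2.
by have -> : k = 0 by lia.
Qed.

(** The residue of a fixed element lies in F_p. Peeling off one p-adic digit leaves a fixed element,
    so c is a limit of natural numbers and completeness puts it in Q_p. *)
Lemma fixed_Zq c : c \in Zq -> sigma c = c -> c \in integers_of ord (1%AS : {subfield K}).
Proof.
move=> cZ sc.
have step y : y \in Zq /\ sigma y = y -> exists m : nat,
    exists2 y1, y1 \in Zq /\ sigma y1 = y1 & y = m%:R + p%:R * y1.
  case=> yZ sy; have [_ yr] := sigma_frob yZ; rewrite sy in yr.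
  have [m hm] := prime_field_fixed Fq_char (esym yr); exists m.
  have [||y1 y1Z h] := @Qq_pdiv (y - m%:R).
  - by rewrite Zq_Q // ZqB ?Zq_nat.
  - by rewrite -red_eq ?Zq_nat // hm red_nat.
  exists y1; last by rewrite -h; ring.
  split=> //; have := congr1 sigma h.
  by rewrite rmorphB rmorphM /= !rmorph_nat sy h => /(mulfI p_neq0).
have approx N : forall y, y \in Zq /\ sigma y = y -> exists m : nat, vge N%:R (y - m%:R).
  elim: N => [|N IH] y hy; first by exists 0%N; rewrite subr0 Zq_O //; case: hy.
  have [m [y1 hy1 ->]] := step y hy; have [k hk] := IH y1 hy1; exists (m + p * k)%N.
  rewrite natrD natrM (_ : _ - _ = p%:R * (y1 - k%:R)); last by ring.
  by rewrite -natr1 addrC; apply: vgeM => //; exact: vge_p.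
have [s hs] := ex_choice (fun N => approx N c (conj cZ sc)).
rewrite inE (Zq_O cZ : (0%:E <= ord c)%E) andbT.
have [||l [y ->] hl] := @complete_Qp (fun N => (s N)%:R).
- by move=> N; exists (s N)%:R; rewrite scaler_nat.
- move=> N; exists N => m1 m2 h1 h2.
  rewrite (_ : _ - _ = (c - (s m2)%:R) - (c - (s m1)%:R)); last by ring.
  by apply: vgeB => //; [apply: vge_le (hs m2)|apply: vge_le (hs m1)] => //; rewrite ler_nat.
have -> : c = y%:A.
  apply: (vge_eq ord_val) => N; have [m0 h] := hl N.
  rewrite (_ : _ - _ = (c - (s (maxn m0 N))%:R) + ((s (maxn m0 N))%:R - y%:A)); last by ring.
  apply: vgeD => //; last by apply: h; rewrite leq_maxl.
  by apply: vge_le (hs _) => //; rewrite ler_nat leq_maxr.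
by rewrite rpredZ // rpred1.
Qed.

(** As sigma fixes pi, it acts on the coefficients of the expansion in pi, which are unique by
    [pi_vge]. *)
Lemma fixed_adjoin x : vge 0 x -> sigma x = x -> adjoin (integers_of ord (1%AS : {subfield K})) zeta x.
Proof.
case/pi_expand_O => c cZ -> sx; apply: pi_adjoin => i; apply: fixed_Zq => //.
have dQ j : sigma (c j) - c j \in Qq by rewrite rpredB ?sigma_Qq ?Zq_Q.
apply: (vge_eq ord_val) => N; apply: vge_le (pi_vge (r := N.+1%:R) dQ _ i) => //.
  have : i%:R * e < (p.-1)%:R * e by rewrite ltr_pM2r ?e_gt0 // ltr_nat.
  by rewrite p1e -natr1 => h'; lra.
move/eqP: sx; rewrite -subr_eq0 rmorph_sum -sumrB => /eqP s0.
rewrite [X in vge _ X](_ : _ = 0) ?vge0 // -[RHS]s0; apply: eq_bigr => j _.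
by rewrite rmorphM rmorphXn /= sigma_pi mulrBl.
Qed.

Lemma Qp_frobenius x : x \in (1%AS : {subfield K}) -> vge 0 x -> vge 1 (x ^+ p - x).
Proof.
move=> /vlineP[y xE] x0; have xZ : x \in Zq by rewrite ZqP x0 andbT xE rpredZ // rpred1.
have [m _ hm] := residue_nat ord_val p_prime ordP (rat_dense_Qp y) (etrans (congr1 _ (esym xE)) x0).
have rx : red x = m%:R by apply/eqP; rewrite -red_nat red_eq ?Zq_nat // xE.
rewrite -red_eq ?ZqX // redX // rx -(pFrobenius_autE Fq_char) pFrobenius_aut_nat //.
Qed.

End OmegaZero.

(** * Integrality of the Artin-Hasse series *)

Section TruncatedSeries.
Variable K : fieldType.
Implicit Types P Q R : {poly K}.

(** Congruence modulo X^(N+1). *)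
Definition eqt (N : nat) P Q := forall k, (k <= N)%N -> P`_k = Q`_k.

Lemma eqtM N P P' Q Q' : eqt N P P' -> eqt N Q Q' -> eqt N (P * Q) (P' * Q').
Proof.
move=> h h' k kN; rewrite !coefM; apply: eq_bigr => i _.
rewrite h ?h' //; first by apply: leq_trans kN; exact: leq_subr.
by apply: leq_trans kN; rewrite -ltnS.
Qed.

Lemma eqtD N P P' Q Q' : eqt N P P' -> eqt N Q Q' -> eqt N (P + Q) (P' + Q').
Proof. by move=> h h' k kN; rewrite !coefD h ?h'. Qed.

Lemma eqt_trans N P Q R : eqt N P Q -> eqt N Q R -> eqt N P R.
Proof. by move=> h h' k kN; rewrite h ?h'. Qed.

Lemma eqtX N P Q m : eqt N P Q -> eqt N (P ^+ m) (Q ^+ m).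
Proof. by move=> h; elim: m => [|m IH]; rewrite ?expr0 // !exprS; exact: eqtM. Qed.

Lemma eqt_sum N (I : Type) (r : seq I) (F G : I -> {poly K}) :
  (forall i, eqt N (F i) (G i)) -> eqt N (\sum_(i <- r) F i) (\sum_(i <- r) G i).
Proof.
by move=> h; elim: r => [|i r IH]; rewrite ?big_nil // !big_cons; exact: eqtD.
Qed.

Lemma eqtXn0 N m : (N < m)%N -> eqt N 'X^m 0.
Proof. by move=> Nm k kN; rewrite coefXn coef0; case: eqP => // e; lia. Qed.

Lemma eqt_comp N P Q d : (0 < d)%N -> eqt N P Q -> eqt N (P \Po 'X^d) (Q \Po 'X^d).
Proof.
move=> d0 h k kN; rewrite !coef_comp_poly_Xn //; case: ifP => // _; apply: h.
by apply: leq_trans kN; exact: leq_div.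
Qed.

Definition expt (M : nat) P := \sum_(m < M.+1) (m`!%:R)^-1 *: P ^+ m.

Lemma coef_pow0 P m k : P`_0 = 0 -> (k < m)%N -> (P ^+ m)`_k = 0.
Proof.
move=> P0 km; have [Q ->] : exists Q, P = Q * 'X.
  exists (\poly_(i < size P) P`_i.+1); apply/polyP => i.
  rewrite coefMX; case: i => [//|i]; rewrite coef_poly /=; case: ifP => // /negbT.
  by rewrite -leqNgt => h; rewrite nth_default // ltnW.
by rewrite exprMn coefMXn km.
Qed.

Lemma expt_trunc N M P : (N <= M)%N -> P`_0 = 0 -> eqt N (expt M P) (expt N P).
Proof.
move=> NM P0; rewrite -(subnKC NM); elim: (M - N)%N => [|d IH]; first by rewrite addn0.
apply: eqt_trans IH => k kN; rewrite addnS /expt big_ord_recr /= coefD coefZ.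
by rewrite coef_pow0 ?mulr0 ?addr0 //; lia.
Qed.

Lemma eqt_expt N M P Q : eqt N P Q -> eqt N (expt M P) (expt M Q).
Proof.
move=> h; apply: eqt_sum => m k kN; rewrite !coefZ; congr (_ * _).
exact: eqtX h _ kN.
Qed.

Hypothesis char0 : [pchar K] =i pred0.

Lemma natr_neq0 m : (0 < m)%N -> m%:R != 0 :> K.
Proof. by move=> m0; have /pcharf0P -> := char0; rewrite -lt0n. Qed.

Lemma deriv_expt M P : (expt M.+1 P)^`() = P^`() * expt M P.
Proof.
rewrite /expt big_ord_recl /= expr0 derivD derivZ derivC scaler0 add0r.
rewrite raddf_sum mulr_sumr; apply: eq_bigr => m _.
rewrite /bump /= add1n derivZ deriv_exp -scalerAr -scaler_nat scalerA; congr (_ *: _).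
by rewrite factS natrM invfM mulrC mulrA divff ?mul1r // natr_neq0.
Qed.

End TruncatedSeries.

(** * The Artin-Hasse exponential *)

Section ArtinHasse.
Variables (p : nat) (p_prime : prime p).
Variables (Qp : fieldType) (K : fieldExtType Qp).
Variables (ord : K -> \bar rat) (ord_val : valuation ord) (ord_p : ord p%:R = 1%:E).
Notation vge := (vge ord).
Notation vl := (vl ord).
Let char0 := pchar0 ord_val p_prime ord_p.
Let natn0 := natr_neq0 char0.

Definition logAH (J : nat) : {poly K} := \sum_(j < J.+1) (p%:R ^+ j)^-1 *: 'X^(p ^ j).

Lemma lt_pX j : (j < p ^ j)%N. Proof. exact: ltn_expl (prime_gt1 p_prime). Qed.

Lemma logAH_trunc N J : (N <= J)%N -> eqt N (logAH J) (logAH N).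
Proof.
move=> NJ; rewrite -(subnKC NJ); elim: (J - N)%N => [|d IH]; first by rewrite addn0.
apply: eqt_trans IH => k kN; rewrite addnS /logAH big_ord_recr /= coefD coefZ coefXn.
have := lt_pX (N + d).+1; case: eqP => [e|_]; last by rewrite mulr0 addr0.
lia.
Qed.

Lemma logAH0 J : (logAH J)`_0 = 0.
Proof.
rewrite coef_sum big1 // => j _; rewrite coefZ coefXn eq_sym expn_eq0.
by case: (p) p_prime => // q _; rewrite mulr0.
Qed.

Lemma AH_expt M J k : (k <= M)%N -> (k <= J)%N -> AH p K k = (expt M (logAH J))`_k.
Proof.
move=> kM kJ; rewrite (@expt_trunc K k M) ?logAH0 //.
by rewrite (@eqt_expt K k k _ _ (logAH_trunc kJ)).
Qed.

Lemma AH0 : AH p K 0 = 1.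
Proof. by rewrite /AH big_ord1 expr0 coefZ coef1 fact0 invr1 mulr1. Qed.

Lemma deriv_logAH J : 'X * (logAH J)^`() = \sum_(j < J.+1) 'X^(p ^ j).
Proof.
rewrite raddf_sum mulr_sumr; apply: eq_bigr => j _ /=.
rewrite derivZ derivXn -scalerAr mulrnAr -exprS prednK ?expn_gt0 ?prime_gt0 //.
rewrite -[X in _ *: X]scaler_nat scalerA natrX mulVf ?scale1r //.
by rewrite expf_neq0 // natn0 // prime_gt0.
Qed.

(** Compare coefficients in X AH' = (X + X^p + X^(p^2) + ..) AH. *)
Lemma AH_rec k : k%:R * AH p K k =
  \sum_(j < k.+1) (if (p ^ j <= k)%N then AH p K (k - p ^ j) else 0).
Proof.
case: k => [|k].
  rewrite mul0r big_ord1 expn0 //.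
rewrite mulrC -[RHS]addr0 -[LHS]addr0.
have -> : AH p K k.+1 * k.+1%:R = ('X * (expt k.+1 (logAH k.+1))^`())`_k.+1.
  by rewrite coefXM /= coef_deriv mulr_natr (@AH_expt k.+1 k.+1).
rewrite deriv_expt // mulrA deriv_logAH mulr_suml coef_sum !addr0.
apply: eq_bigr => j _; rewrite coefXnM ltnNge; case: leqP => //= h.
have pj : (0 < p ^ j)%N by rewrite expn_gt0 prime_gt0.
by symmetry; apply: AH_expt; lia.
Qed.

Lemma AH_recN N k : (k <= N)%N -> k%:R * AH p K k =
  \sum_(j < N.+1) (if (p ^ j <= k)%N then AH p K (k - p ^ j) else 0).
Proof.
move=> kN; rewrite AH_rec -(subnKC kN); elim: (N - k)%N => [|d IH]; first by rewrite addn0.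
rewrite addnS [RHS]big_ord_recr /= -IH; case: ifP => [|_]; last by rewrite addr0.
by have := lt_pX (k + d).+1; lia.
Qed.

Lemma AH_Qp k : AH p K k \in (1%AS : {subfield K}).
Proof.
elim/ltn_ind: k => -[_|k IH]; first by rewrite AH0 rpred1.
have -> : AH p K k.+1 = k.+1%:R^-1 * (k.+1%:R * AH p K k.+1).
  by rewrite mulKf // natn0.
rewrite AH_rec rpredM ?rpredV ?rpred_nat //; apply: rpred_sum => j _.
case: ifP => // h; last exact: rpred0.
have pj : (0 < p ^ j)%N by rewrite expn_gt0 prime_gt0.
by apply: IH; lia.
Qed.

Definition coefs_vge r (P : {poly K}) := forall k, vge r P`_k.

Lemma coefs_vgeM r P Q : coefs_vge r P -> coefs_vge 0 Q -> coefs_vge r (P * Q).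
Proof.
by move=> h h' k; rewrite coefM; apply: vge_sum => // i _; apply: vgeM0r.
Qed.

Lemma coefs_vgeX P m : coefs_vge 0 P -> coefs_vge 0 (P ^+ m).
Proof.
move=> h; elim: m => [|m IH]; last by rewrite exprS; exact: coefs_vgeM.
by move=> k; rewrite expr0 coef1; exact: vge_nat.
Qed.

Lemma coefs_frobenius P Q : coefs_vge 0 P -> coefs_vge 0 Q ->
  coefs_vge 1 ((P + Q) ^+ p - (P ^+ p + Q ^+ p)).
Proof.
move=> hP hQ k; rewrite exprDn.
have gen m (F : nat -> {poly K}) : (0 < m)%N ->
    \sum_(i < m.+1) F i = F 0%N + (\sum_(i < m.-1) F i.+1 + F m).
  by case: m => // m _; rewrite big_ord_recl big_ord_recr.
rewrite (gen p (fun i => P ^+ (p - i) * Q ^+ i *+ 'C(p, i))) ?prime_gt0 //.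
rewrite subn0 subnn !expr0 mulr1 mul1r bin0 binn !mulr1n.
rewrite (_ : _ - _ = \sum_(i < p.-1) P ^+ (p - i.+1) * Q ^+ i.+1 *+ 'C(p, i.+1)); last by ring.
rewrite coef_sum; apply: vge_sum => // i _; rewrite coefMn -mulr_natl -[1]addr0.
apply: vgeM => //; last by apply: coefs_vgeM; exact: coefs_vgeX.
have /dvdnP[d ->] : (p %| 'C(p, i.+1))%N.
  by apply: prime_dvd_bin => //; have := ltn_ord i; lia.
by rewrite natrM; apply: vgeM0; rewrite ?vge_nat ?(vge_p ord_val ord_p).
Qed.

(** By induction on the Horner form: modulo p, the p-th power is additive, so P^p is the polynomial
    in X^p whose coefficients are the p-th powers of those of P. *)
Lemma coef_powp P : coefs_vge 0 P -> forall k,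
  vge 1 ((P ^+ p)`_k - (if (p %| k)%N then P`_(k %/ p) ^+ p else 0)).
Proof.
have p0 := prime_gt0 p_prime.
elim/poly_ind: P => [|P c IH] h k.
  rewrite expr0n eqn0Ngt p0 /= ?mulr0n coef0; case: ifP; rewrite ?subr0 ?vge0 //.
  by rewrite coef0 expr0n eqn0Ngt p0 /= ?mulr0n subr0 vge0.
have hP : coefs_vge 0 P.
  by move=> i; have := h i.+1; rewrite coefD coefMX coefC /= addr0.
have hc : vge 0 c by have := h 0%N; rewrite coefD coefMX coefC /= add0r.
have hPX : coefs_vge 0 (P * 'X).
  by move=> i; rewrite coefMX; case: ifP => // _; exact: vge0.
have hcP : coefs_vge 0 c%:P.
  by move=> i; rewrite coefC; case: ifP => // _; exact: vge0.
have h2 := coefs_frobenius hPX hcP k; rewrite coefB in h2.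
rewrite -[((P * 'X + c%:P) ^+ p)`_k](subrK ((P * 'X) ^+ p + c%:P ^+ p)`_k) -addrA.
apply: vgeD => //.
rewrite coefD exprMn coefMXn -rmorphXn coefC coefD coefMX coefC /=.
have [->|k0] := posnP k; first by rewrite p0 dvdn0 div0n /= !add0r subrr vge0.
rewrite addr0; case: ltnP => kp.
  rewrite gtnNdvd // subr0 vge0 //.
have := IH hP (k - p)%N; rewrite dvdn_subl // => //.
case: ifP => // pk.
have : (0 < k %/ p)%N by rewrite divn_gt0.
case E: (k %/ p)%N => [//|m] _ /=; rewrite addr0.
by have -> : ((k - p) %/ p = m)%N by rewrite -{1}(mul1n p) divnBMl E subn1.
Qed.

Lemma geo_div_lt n m : (0 < m)%N -> (\sum_(1 <= k < n.+1) m %/ p ^ k < m)%N.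
Proof.
have p1 := prime_gt1 p_prime.
elim: n m => [|n IH] m m0; first by rewrite big_geq.
rewrite big_nat_recl // expn1 /=.
have -> : (\sum_(1 <= i < n.+1) m %/ p ^ i.+1 = \sum_(1 <= i < n.+1) (m %/ p) %/ p ^ i)%N.
  by apply: eq_bigr => i _; rewrite expnS divnMA.
have [q0|q0] := posnP (m %/ p)%N.
  by rewrite q0 add0n big1 // => i _; rewrite div0n.
have := IH _ q0; set S := (\sum_(1 <= k < n.+1) _)%N.
have := leq_trunc_div m p; nia.
Qed.

(** Legendre's formula gives ord(m!) < m for m > 0, so exp(pX) is congruent to 1 modulo p. *)
Lemma vge_expp m : (0 < m)%N -> vge 1 (p%:R ^+ m / m`!%:R).
Proof.
move=> m0; have [fn vf] := vl_nat ord_val p_prime ord_p (fact_gt0 m).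
have pn := pnat_neq0 ord_val ord_p.
rewrite vgeE // vlM ?invr_eq0 ?expf_neq0 // vlX // vlV // vf (vl_p ord_p) mulr1.
apply/orP; right; rewrite logn_fact //; have := geo_div_lt m m0.
by rewrite -(ler_nat rat) -natr1; lra.
Qed.

(* AH(X)^p and AH(X^p) exp(pX) satisfy the same first order differential equation. *)
Definition AHp N : {poly K} := \poly_(k < N.+1) AH p K k.

Lemma coef_AHp N k : (k <= N)%N -> (AHp N)`_k = AH p K k.
Proof. by move=> kN; rewrite coef_poly ltnS kN. Qed.

Let T N : {poly K} := \sum_(j < N.+1) 'X^(p ^ j).

Lemma coef_TM N k (P : {poly K}) :
  (T N * P)`_k = \sum_(j < N.+1) (if (p ^ j <= k)%N then P`_(k - p ^ j) else 0).
Proof.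
rewrite mulr_suml coef_sum; apply: eq_bigr => j _.
by rewrite coefXnM ltnNge; case: leqP.
Qed.

Lemma AHp_ode N : eqt N ('X * (AHp N)^`()) (T N * AHp N).
Proof.
move=> k kN; rewrite coef_TM; transitivity (k%:R * AH p K k).
  rewrite coefXM; case: k kN => [|k] kN /=; first by rewrite mul0r.
  by rewrite coef_deriv coef_AHp // mulr_natl.
rewrite (AH_recN kN); apply: eq_bigr => j _; case: ifP => // _.
by rewrite coef_AHp //; lia.
Qed.

(** In characteristic 0 the equation determines coefficient k + 1 from the earlier ones, every shift
    p^j being positive. *)
Lemma ode_uniq N (c : K) (y z : {poly K}) : y`_0 = z`_0 ->
  eqt N ('X * y^`()) (c *: (T N * y)) -> eqt N ('X * z^`()) (c *: (T N * z)) -> eqt N y z.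
Proof.
move=> e0 hy hz; elim/ltn_ind => -[//|k] IH kN.
have := hy k.+1 kN; have := hz k.+1 kN.
rewrite !coefXM /= !coef_deriv !coefZ !coef_TM => h1 h2.
have k0 : k.+1%:R != 0 :> K by exact: natn0.
apply: (mulfI k0); rewrite !mulr_natl h1 h2; congr (_ * _).
apply: eq_bigr => j _; case: ifP => // h.
have pj : (0 < p ^ j)%N by rewrite expn_gt0 prime_gt0.
by apply: IH; lia.
Qed.

Lemma AHp_powp N : (0 < N)%N ->
  eqt N (AHp N ^+ p) ((AHp N \Po 'X^p) * expt N (p%:R *: 'X)).
Proof.
move=> N0; have p0 := prime_gt0 p_prime.
have pX0 : (p%:R *: 'X : {poly K})`_0 = 0 by rewrite coefZ coefX mulr0.
set G := expt N _; set A := AHp N \Po 'X^p.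
have eqtZ P Q : eqt N P Q -> eqt N (p%:R *: P) (p%:R *: Q).
  by move=> h k kN; rewrite !coefZ h.
apply: (@ode_uniq N p%:R).
- have hX (P : {poly K}) m : (P ^+ m)`_0 = P`_0 ^+ m.
    by elim: m => [|m IH]; rewrite ?expr0 ?coef1 // !exprS coef0M IH.
  rewrite coef0M coef_comp_poly_Xn // dvdn0 div0n hX coef_AHp // AH0 mul1r expr1n.
  rewrite coef_sum big_ord_recl /= expr0 fact0 invr1 scale1r coef1 big1 ?addr0 // => i _.
  by rewrite coefZ coef_pow0 ?mulr0.
- have -> : 'X * (AHp N ^+ p)^`() = p%:R *: ('X * (AHp N)^`() * AHp N ^+ p.-1).
    by rewrite deriv_exp mulrnAr mulrA scaler_nat.
  apply: eqtZ; have -> : T N * AHp N ^+ p = T N * AHp N * AHp N ^+ p.-1.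
    by rewrite -mulrA -exprS prednK.
  by apply: eqtM => //; exact: AHp_ode.
- have hA : eqt N ('X * A^`()) (p%:R *: ((T N - 'X) * A)).
    have -> : 'X * A^`() = p%:R *: (('X * (AHp N)^`()) \Po 'X^p).
      rewrite /A deriv_comp derivXn comp_polyM comp_polyX !mulrnAr mulrCA -exprS prednK //.
      by rewrite scaler_nat mulrC.
    apply: eqtZ; apply: eqt_trans (eqt_comp p0 (@AHp_ode N)) _; rewrite comp_polyM.
    have -> : T N - 'X = \sum_(i < N) 'X^(p ^ i.+1).
      by rewrite /T big_ord_recl /= expn0 expr1 addrC addKr.
    apply: eqtM => //; rewrite raddf_sum big_ord_recr /=; have h : eqt N (('X^(p ^ N) : {poly K}) \Po 'X^p) 0.
      rewrite comp_Xn_poly -exprM -expnS; apply: eqtXn0.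
      exact: leq_ltn_trans (leqnSn N) (lt_pX N.+1).
    move=> k kN; rewrite coefD h // coef0 addr0; rewrite !coef_sum; apply: eq_bigr => j _.
    by rewrite comp_Xn_poly -exprM -expnS.
  have hG : eqt N ('X * G^`()) (p%:R *: ('X * G)).
    rewrite /G; case: (N) N0 => // N' _; rewrite deriv_expt // derivZ derivX.
    rewrite -scalerAl mul1r -scalerAr => k kN; rewrite !coefZ !coefXM.
    case: k kN => //= k kN; congr (_ * _).
    by rewrite (@expt_trunc K N' N'.+1 _ (leqnSn _) pX0).
  have -> : 'X * (A * G)^`() = 'X * A^`() * G + A * ('X * G^`()).
    by rewrite derivM; ring.
  have -> : p%:R *: (T N * (A * G)) = p%:R *: ((T N - 'X) * A) * G + A * (p%:R *: ('X * G)).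
    rewrite -scalerAl -scalerAr -scalerDr; congr (_ *: _); ring.
  by apply: eqtD; apply: eqtM.
Qed.

Hypothesis residue_one : forall x, x \in (1%AS : {subfield K}) -> vge 0 x -> vge 1 (x ^+ p - x).

(** Dwork's argument: the N-th coefficients of AH(X)^p and AH(X^p) exp(pX) agree. Modulo p, all
    contributions but p times the N-th coefficient of AH cancel, using that residues of Q_p are
    fixed by the p-th power map. *)
Lemma AH_integral k : vge 0 (AH p K k).
Proof.
elim/ltn_ind: k => -[_|N0 IH]; first by rewrite AH0 vge1.
set N := N0.+1 in IH *; have p0 := prime_gt0 p_prime.
pose b : {poly K} := \poly_(k < N) AH p K k.
have hb : coefs_vge 0 b.
  by move=> k; rewrite coef_poly; case: ifP => [/IH|_] //; exact: vge0.
have b0 : b`_0 = 1 by rewrite coef_poly /= AH0.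
have aE : AHp N = b + AH p K N *: 'X^N.
  apply/polyP => k; rewrite coefD coefZ coefXn !coef_poly ltnS.
  case: (ltngtP k N) => h; rewrite ?mulr0 ?mulr1 ?addr0 ?add0r //.
  by rewrite h.
have hX (P : {poly K}) m : (P ^+ m)`_0 = P`_0 ^+ m.
  by elim: m => [|m IHm]; rewrite ?expr0 ?coef1 // !exprS coef0M IHm.
(* Since AH has constant term 1, its top coefficient enters the p-th power linearly, p times. *)
have e1 : (AHp N ^+ p)`_N = (b ^+ p)`_N + AH p K N * p%:R.
  apply: (addIr (- (b ^+ p)`_N)); rewrite -coefB subrXX addrAC subrr add0r.
  rewrite {1}aE addrAC subrr add0r -scalerAl coefZ coefXnM ltnn subnn; congr (_ * _).
  rewrite coef_sum (eq_bigr (fun=> 1)) ?sumr_const ?card_ord // => i _.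
  by rewrite coef0M !hX b0 coef_AHp // AH0 !expr1n mulr1.
(* The N-th coefficient of AH(X^p). *)
pose q := if (p %| N)%N then AH p K (N %/ p) else 0.
have qint : vge 0 q.
  rewrite /q; case: ifP => // _; last exact: vge0.
  by apply: IH; apply: ltn_Pdiv => //; exact: prime_gt1.
have e2 : vge 1 ((b ^+ p)`_N - q ^+ p).
  have := coef_powp hb N; rewrite /q; case: ifP => // pN.
    by rewrite coef_poly ltn_Pdiv // prime_gt1.
  by rewrite expr0n eqn0Ngt p0.
have qq : vge 1 (q ^+ p - q).
  apply: residue_one => //; rewrite /q; case: ifP => _; [exact: AH_Qp|exact: rpred0].
have e3 : vge 1 ((AHp N ^+ p)`_N - q).
  rewrite AHp_powp // coefM big_ord_recr /= subnn.
  rewrite coef_comp_poly_Xn // [X in _ * X](_ : _ = 1); last first.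
    rewrite coef_sum big_ord_recl /= expr0 fact0 invr1 scale1r coef1 big1 ?addr0 // => i _.
    by rewrite coefZ coef_pow0 ?mulr0 // coefZ coefX mulr0.
  have -> : (if (p %| N)%N then (AHp N)`_(N %/ p) else 0) = q.
    by rewrite /q coef_AHp // leq_div.
  rewrite mulr1 addrK; apply: vge_sum => // i _; apply: vgeM0 => //.
    rewrite coef_comp_poly_Xn //; case: ifP => // _; last exact: vge0.
    have iN : (i %/ p < N)%N by apply: leq_ltn_trans (leq_div _ _) (ltn_ord i).
    by rewrite coef_AHp ?IH // ltnW.
  rewrite /expt coef_sum; apply: vge_sum => // m _.
  rewrite coefZ exprZn coefZ coefXn mulrA mulrC.
  case: eqP => [e|_]; last by rewrite mul0r vge0.
  rewrite mul1r mulrC; apply: vge_expp; rewrite -e.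
  by have := ltn_ord i; lia.
have : vge 1 (AH p K N * p%:R).
  have -> : AH p K N * p%:R = ((AHp N ^+ p)`_N - q) - ((b ^+ p)`_N - q ^+ p) - (q ^+ p - q).
    by rewrite e1; ring.
  by apply: vgeB => //; apply: vgeB.
have pn := pnat_neq0 ord_val ord_p.
by rewrite -[1]add0r -{1}(vl_p ord_p) vge_mulK.
Qed.

End ArtinHasse.

(** * The weight function and the cone decomposition *)

Section Weights.
Variable n : nat.
Notation expo := {ffun 'I_n -> int}.
Implicit Types (u v : expo) (i j k : 'I_n.+1).

(* The ve i are the exponents of x_1, .., x_n and, for i = ord_max, of 1/(x_1..x_n).  They span a complete fan,
   and cc u lists the coordinates of u in the cone that contains it, so that weight u is their sum. *)
Definition co u i : int := oapp u 0 (unlift ord_max i).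
Definition ve i : expo := [ffun j : 'I_n => (lift ord_max j == i)%:R - (i == ord_max)%:R].
Definition cc u i : int := mfun u + co u i.

Lemma co_lift u (j : 'I_n) : co u (lift ord_max j) = u j.
Proof. by rewrite /co liftK. Qed.

Lemma co_max u : co u ord_max = 0.
Proof. by rewrite /co unlift_none. Qed.

Lemma coD u v i : co (u + v) i = co u i + co v i.
Proof. by rewrite /co; case: (unlift _ _) => [j|] //=; rewrite ffunE. Qed.

Lemma coN u i : co (- u) i = - co u i.
Proof. by rewrite /co; case: (unlift _ _) => [j|] //=; rewrite ?ffunE ?oppr0. Qed.

Lemma coMn u m i : co (u *+ m) i = co u i *+ m.
Proof. by elim: m => [|m IH]; rewrite ?mulr0n ?mulrSr ?coD ?IH // /co; case: (unlift _ _) => //= j; rewrite ffunE. Qed.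

Lemma co_ve i k : co (ve i) k = (k == i)%:R - (i == ord_max)%:R.
Proof.
have [j ->|->] := unliftP ord_max k; first by rewrite co_lift ffunE.
by rewrite co_max [ord_max == i]eq_sym subrr.
Qed.

Lemma co_inj u v : (forall i, co u i = co v i) -> u = v.
Proof. by move=> h; apply/ffunP => j; rewrite -!co_lift. Qed.

Lemma co_mfun u i : - co u i <= mfun u.
Proof.
rewrite /mfun; have [j ->|->] := unliftP ord_max i.
  by rewrite co_lift; apply: le_bigmax.
by rewrite co_max oppr0; apply: bigmax_ge_id.
Qed.

Lemma mfun_at u : exists i, mfun u = - co u i.
Proof.
rewrite /mfun; elim/big_rec: _ => [|j x _ [i ->]]; first by exists ord_max; rewrite co_max oppr0.
by case: leP => _; [exists i|exists (lift ord_max j); rewrite co_lift].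
Qed.

Lemma cc_ge0 u i : 0 <= cc u i.
Proof. by rewrite /cc -lerBlDr sub0r co_mfun. Qed.

Lemma cc_zero u : exists i, cc u i = 0.
Proof. by have [i h] := mfun_at u; exists i; rewrite /cc h addNr. Qed.

(** The differences c i - c ord_max fix c up to a common shift, and nonnegativity together with a
    zero fixes the shift. *)
Lemma cc_uniq u (c : 'I_n.+1 -> int) : (forall i, 0 <= c i) -> (exists i, c i = 0) ->
  (forall i, co u i = c i - c ord_max) -> forall i, cc u i = c i.
Proof.
move=> c0 [i0 ci0] h i; suff e : mfun u = c ord_max by rewrite /cc e h addrC subrK.
apply/eqP; rewrite eq_le; apply/andP; split.
  by have [j ->] := mfun_at u; rewrite h opprB lerBlDr lerDl.
by apply: le_trans (co_mfun u i0); rewrite h ci0 sub0r opprK.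
Qed.

Lemma co_cc u i : co u i = cc u i - cc u ord_max.
Proof. by rewrite /cc co_max addr0 addrC addKr. Qed.

Lemma cc_inj u v : (forall i, cc u i = cc v i) -> u = v.
Proof. by move=> h; apply: co_inj => i; rewrite !co_cc !h. Qed.

Lemma weightE u : weight u = \sum_i cc u i.
Proof.
rewrite /weight big_ord_recr /= /cc co_max addr0 big_split /= sumr_const card_ord.
rewrite mulrSr addrA [X in X + _]addrC; congr (_ + _ + _); apply: eq_bigr => j _.
rewrite -co_lift; congr co; apply/val_inj => /=; by rewrite /bump leqNgt ltn_ord.
Qed.

Lemma weight_ge0 u : 0 <= weight u.
Proof. by rewrite weightE sumr_ge0 // => i _; exact: cc_ge0. Qed.

Lemma cc_le_weight u i : cc u i <= weight u.
Proof. by rewrite weightE (bigD1 i) //= lerDl sumr_ge0 // => j _; exact: cc_ge0. Qed.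

Lemma mfunD u v : mfun (u + v) <= mfun u + mfun v.
Proof. by have [i ->] := mfun_at (u + v); rewrite coD opprD lerD // co_mfun. Qed.

Lemma weightDE u v : weight (u + v) = weight u + weight v -
  (mfun u + mfun v - mfun (u + v)) *+ n.+1.
Proof.
rewrite /weight [in X in X + _](eq_bigr (fun l : 'I_n => u l + v l)); last by move=> l _; rewrite ffunE.
by rewrite big_split mulrnBl mulrnDl /=; ring.
Qed.

Lemma weightD u v : weight (u + v) <= weight u + weight v.
Proof. by rewrite weightDE lerBlDr lerDl mulrn_wge0 // subr_ge0 mfunD. Qed.

(** Equality in [weightD] means that u and v lie in a common cone, on which coordinates add. *)
Lemma weightD_cc u v : weight u + weight v <= weight (u + v) ->
  forall i, cc (u + v) i = cc u i + cc v i.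
Proof.
rewrite weightDE lerBrDr gerDl pmulrn_lle0 // subr_le0 => h i.
have e : mfun (u + v) = mfun u + mfun v by apply/eqP; rewrite eq_le mfunD h.
by rewrite /cc coD e; ring.
Qed.

Hypothesis n_gt0 : (0 < n)%N.

Lemma other i : exists k, k != i.
Proof.
have [->|h] := eqVneq i ord0; last by exists ord0; rewrite eq_sym.
by exists ord_max; rewrite -val_eqE /= -lt0n.
Qed.

Lemma cc_ve i m j : cc (ve i *+ m) j = (j == i)%:R *+ m.
Proof.
apply: (@cc_uniq _ (fun j => (j == i)%:R *+ m)).
- by move=> k; rewrite mulrn_wge0 // ler0n.
- by have [k /negbTE ki] := other i; exists k; rewrite ki mul0rn.
- by move=> k; rewrite coMn co_ve mulrnBl [i == _]eq_sym.
Qed.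

Lemma weight_ve i m : weight (ve i *+ m) = m.
Proof.
rewrite weightE (bigD1 i) //= cc_ve eqxx big1 ?addr0 => [|j /negbTE ji]; first by rewrite -[RHS]natz.
by rewrite cc_ve ji mul0rn.
Qed.

Lemma cc0 i : cc 0 i = 0.
Proof. by rewrite -(mulr0n (ve ord0)) cc_ve mulr0n. Qed.

Lemma weight0 : weight (0 : expo) = 0.
Proof. by rewrite weightE big1 // => i _; exact: cc0. Qed.

Lemma weight_eq0 u : weight u = 0 -> u = 0.
Proof.
move=> h; apply: cc_inj => i; rewrite cc0; apply/eqP.
by rewrite eq_le cc_ge0 -h cc_le_weight.
Qed.

Lemma cc_Mn u m i : (0 < m)%N -> cc (u *+ m) i = cc u i *+ m.
Proof.
move=> m0; apply: (@cc_uniq _ (fun j => cc u j *+ m)).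
- by move=> k; rewrite mulrn_wge0 // cc_ge0.
- by have [k e] := cc_zero u; exists k; rewrite e mul0rn.
- by move=> k; rewrite coMn co_cc mulrnBl.
Qed.

Lemma weightMn u m : (0 < m)%N -> weight (u *+ m) = weight u *+ m.
Proof.
by move=> m0; rewrite !weightE -sumrMnl; apply: eq_bigr => i _; exact: cc_Mn.
Qed.

(** The vertex k is missing from both u and [ve i], so the two lie in a common cone. *)
Lemma cc_addve u i k : cc u k = 0 -> k != i -> forall j, cc (u + ve i) j = cc u j + (j == i)%:R.
Proof.
move=> uk ki; apply: cc_uniq.
- by move=> j; rewrite addr_ge0 ?cc_ge0 ?ler0n.
- by exists k; rewrite uk (negbTE ki).
- by move=> j; rewrite coD co_ve co_cc [ord_max == i]eq_sym; ring.
Qed.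

Lemma weight_addve u i k : cc u k = 0 -> k != i -> weight (u + ve i) = weight u + 1.
Proof.
move=> uk ki; rewrite !weightE (eq_bigr (fun j => cc u j + (j == i)%:R)) => [|j _].
  rewrite big_split /= [X in _ + X](bigD1 i) //= eqxx [X in _ + (_ + X)]big1 ?addr0 //.
  by move=> j /negbTE ->.
exact: cc_addve uk ki j.
Qed.

Lemma cc_subve u i : 1 <= cc u i -> forall j, cc (u - ve i) j = cc u j - (j == i)%:R.
Proof.
move=> ui; apply: cc_uniq.
- by move=> j; have [->|_] := eqVneq j i; [rewrite subr_ge0|rewrite subr0 cc_ge0].
- have [k e] := cc_zero u; exists k; rewrite e; have [ki|_] := eqVneq k i; last by rewrite subr0.
  by rewrite -ki e in ui.
- by move=> j; rewrite coD coN co_ve co_cc [ord_max == i]eq_sym; ring.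
Qed.

Fact kkP u : exists i, (cc u i == 0) && [forall j, (cc u j == 0) ==> (i <= j)%N].
Proof.
have [i0 /eqP e] := cc_zero u.
have [i Pi mi] := arg_minnP (fun i : 'I_n.+1 => nat_of_ord i) (e : (fun i => cc u i == 0) i0).
by exists i; rewrite Pi; apply/forallP => j; apply/implyP; exact: mi.
Qed.

(* The first vertex which does not occur in u. *)
Definition kk u : 'I_n.+1 := xchoose (kkP u).

Lemma cc_kk u : cc u (kk u) = 0.
Proof. by have /andP[/eqP] := xchooseP (kkP u). Qed.

Lemma kk_le u j : cc u j = 0 -> (kk u <= j)%N.
Proof. by move=> h; have /andP[_ /forallP/(_ j)] := xchooseP (kkP u); rewrite h eqxx. Qed.

Lemma kk_lt u j : (j < kk u)%N -> 1 <= cc u j.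
Proof.
rewrite ltnNge; have := cc_ge0 u j; rewrite le_eqVlt => /orP[/eqP h|]; last by rewrite gtz0_ge1.
by rewrite kk_le.
Qed.

Lemma kk_uniq u k : cc u k = 0 -> (forall j, (j < k)%N -> 1 <= cc u j) -> kk u = k.
Proof.
move=> h1 h2; apply/val_inj/eqP; rewrite /= eqn_leq kk_le //= leqNgt; apply/negP => /h2.
by rewrite cc_kk.
Qed.

Definition corner k : expo := [ffun j : 'I_n => (j < k)%:R].

Lemma cc_corner k i : cc (corner k) i = (i < k)%:R.
Proof.
have mk : (@ord_max n < k)%N = false by rewrite ltnNge leq_ord.
apply: (@cc_uniq _ (fun i => (i < k)%:R)).
- by move=> j; rewrite ler0n.
- by exists k; rewrite ltnn.
- move=> j; rewrite mk subr0; have [l ->|->] := unliftP ord_max j; last by rewrite co_max mk.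
  by rewrite co_lift ffunE lift_max.
Qed.

Lemma kk_corner k : kk (corner k) = k.
Proof.
apply: kk_uniq; first by rewrite cc_corner ltnn.
by move=> j jk; rewrite cc_corner jk.
Qed.

Lemma weight_corner k : weight (corner k) = k.
Proof.
rewrite weightE (eq_bigr (fun i : 'I_n.+1 => ((i < k)%N%:R : int))) => [|i _]; last exact: cc_corner.
rewrite -natr_sum natz; congr Posz; rewrite (eq_bigr (fun i : 'I_n.+1 => if (i < k)%N then 1 else 0)%N).
  by rewrite -big_mkcond /= -(big_ord_widen n.+1 (fun=> 1%N) (ltnW (ltn_ord k))) sum1_card card_ord.
by move=> i _; case: (_ < _)%N.
Qed.

Lemma kk_addve u i : i != kk u -> kk (u + ve i) = kk u.
Proof.
move=> ik; have ki : kk u != i by rewrite eq_sym.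
have h := cc_addve (cc_kk u) ki.
apply: kk_uniq; first by rewrite h cc_kk eq_sym (negbTE ik).
by move=> j jk; rewrite h; have := kk_lt jk; case: (_ == _); lia.
Qed.

Lemma kk_subve u i : ((i < kk u)%N%:R < cc u i)%R -> kk (u - ve i) = kk u /\ i != kk u.
Proof.
move=> h; have ik : i != kk u by apply: contraTneq h => ->; rewrite cc_kk ltnn.
have u1 : 1 <= cc u i by have := h; case: (i < _)%N; lia.
split=> //; apply: kk_uniq.
  by rewrite cc_subve // cc_kk eq_sym (negbTE ik).
move=> j jk; rewrite cc_subve //; have := kk_lt jk.
have [ji|_] := eqVneq j i; last by rewrite subr0.
by move=> _; move: h; rewrite -ji jk lerBrDr; lia.
Qed.

Lemma corner_or u : u = corner (kk u) \/ exists i : 'I_n.+1, (i < kk u)%N%:R < cc u i.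
Proof.
have [/existsP[i hi]|] := boolP [exists i : 'I_n.+1, (i < kk u)%N%:R < cc u i]; first by right; exists i.
rewrite negb_exists => /forallP h; left; apply: cc_inj => i; rewrite cc_corner.
apply/eqP; rewrite eq_le leNgt h /=; case E: (i < kk u)%N; last exact: cc_ge0.
exact: kk_lt.
Qed.

(** Lexicographic order packed into one number: weight first, then a later first missing vertex
    counts as smaller. All eliminations below go by this rank. *)
Definition rk u : nat := (`|weight u| * n.+1 + (n - kk u))%N.

(* When adding a vertex keeps the product on a common facet, the first
   missing vertex can only move up. *)
Lemma kk_cofacial u i : weight u + 1 <= weight (u + ve i) -> (kk u <= kk (u + ve i)%R)%N.
Proof.
have := weight_ve i 1; rewrite mulr1n => w1; rewrite -[1]w1 => /weightD_cc h.
apply: kk_le; apply/eqP.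
by have := cc_kk (u + ve i); rewrite h; have := cc_ge0 u (kk (u + ve i)); have := cc_ge0 (ve i) (kk (u + ve i)); lia.
Qed.

(** Without loss of weight the coordinates add, so the vertex [kk u] is now present and the first
    missing one lies strictly later. *)
Lemma kk_addkk u : weight (u + ve (kk u)) = weight u + 1 -> (kk u < kk (u + ve (kk u))%R)%N.
Proof.
move=> we; have le : (kk u <= kk (u + ve (kk u))%R)%N by apply: kk_cofacial; rewrite we.
have w1 := weight_ve (kk u) 1; rewrite mulr1n in w1.
have cck : cc (u + ve (kk u)) (kk u) = 1.
  have /weightD_cc -> : weight u + weight (ve (kk u)) <= weight (u + ve (kk u)) by rewrite we w1.
  by rewrite cc_kk add0r -[ve _]mulr1n cc_ve eqxx.
rewrite ltn_neqAle le andbT; apply/negP => /eqP/val_inj e1.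
by move: (cc_kk (u + ve (kk u))); rewrite -e1 cck.
Qed.

Lemma rk_addve u i : i != kk u -> rk (u + ve i) = (rk u + n.+1)%N.
Proof.
move=> ik; have ki : kk u != i by rewrite eq_sym.
rewrite /rk kk_addve // (weight_addve (cc_kk u) ki).
by have := weight_ge0 u; case: (weight u) => // w _; rewrite -PoszD /= mulnDl; lia.
Qed.

(** Either the weight fails to rise by 1, or [kk] moves up. Compared with [rk_addve], this shows
    that D_i - D_k has a single term of top rank, x^(u + v_i). *)
Lemma rk_addkk u : (rk (u + ve (kk u))%R < rk u + n.+1)%N.
Proof.
have := weightD u (ve (kk u)); have w1 := weight_ve (kk u) 1; rewrite mulr1n in w1; rewrite w1.
have h0 := weight_ge0 u; have h1 := weight_ge0 (u + ve (kk u)).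
have b1 := leq_ord (kk u); have b2 := leq_ord (kk (u + ve (kk u))).
rewrite le_eqVlt => /orP[/eqP we|wl].
  have := kk_addkk we; rewrite /rk we; move: h0; case: (weight u) => // w _.
  by rewrite -PoszD /= mulnDl; lia.
rewrite /rk; move: h0 h1 wl; case: (weight u) => // w _; case: (weight _) => // w' _ /=.
rewrite -PoszD ltz_nat addn1 ltnS => ww.
have : (w' * n.+1 <= w * n.+1)%N by rewrite leq_mul2r ww orbT.
lia.
Qed.

Lemma rk_sub u i : weight u = weight (u - ve i) + 1 -> (rk u <= rk (u - ve i)%R + n.+1)%N.
Proof.
move=> we; have := @kk_cofacial (u - ve i) i; rewrite subrK we => /(_ (lexx _)) kle.
rewrite /rk we; have := weight_ge0 (u - ve i); case: (weight (u - ve i)) => // w _.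
by rewrite -PoszD /= mulnDl; lia.
Qed.

Lemma corner_inj : injective corner.
Proof. by move=> i j h; rewrite -(kk_corner i) h kk_corner. Qed.

Lemma cc_ge_lt u i : (i < kk u)%N%:R <= cc u i.
Proof. by case E: (i < kk u)%N; [exact: kk_lt|exact: cc_ge0]. Qed.

Lemma not_corner u i : (i < kk u)%N%:R < cc u i -> u != corner (kk u).
Proof. by move=> h; apply/eqP => e1; move: h; rewrite {2}e1 cc_corner ltxx. Qed.

(** The box of exponents with all entries in [-N, N]. It contains every exponent of weight below N,
    since an entry is a difference of two coordinates bounded by the weight. *)
Definition wlist (N : nat) : seq expo :=
  [seq [ffun j => (f j)%:Z - N%:Z] | f : {ffun 'I_n -> 'I_(N + N).+1}].

Lemma wlistP N u : u \notin wlist N -> N%:Z <= weight u.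
Proof.
rewrite leNgt; apply: contra => h.
have hb (j : 'I_n) : (`|(u j + N%:Z)%R| < (N + N).+1)%N.
  have h1 := cc_le_weight u (lift ord_max j); have h2 := cc_le_weight u ord_max.
  have h3 := cc_ge0 u (lift ord_max j); have h4 := cc_ge0 u ord_max.
  move: (co_cc u (lift ord_max j)); rewrite co_lift; lia.
apply/mapP; exists [ffun j => Ordinal (hb j)]; first by rewrite mem_enum.
apply/ffunP => j; rewrite !ffunE /=.
have h1 := cc_le_weight u (lift ord_max j); have h2 := cc_le_weight u ord_max.
have h3 := cc_ge0 u (lift ord_max j); have h4 := cc_ge0 u ord_max.
move: (co_cc u (lift ord_max j)); rewrite co_lift; lia.
Qed.

Lemma ve_lift (l : 'I_n) : ve (lift ord_max l) = evec l.
Proof.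
apply/ffunP => j; rewrite !ffunE (inj_eq lift_inj) [lift _ _ == ord_max]eq_sym.
by rewrite (negbTE (neq_lift _ _)) subr0.
Qed.

Lemma ve_max : ve ord_max = - ones n.
Proof.
apply/ffunP => j; rewrite !ffunE eqxx [lift _ _ == ord_max]eq_sym.
by rewrite (negbTE (neq_lift _ _)) sub0r.
Qed.

End Weights.

(** * Operators on Laurent series *)

Section Laurent.
Variables (p n : nat) (p_prime : prime p) (n_gt0 : (0 < n)%N).
Variables (Qp : fieldType) (K : fieldExtType Qp).
Variables (ord : K -> \bar rat) (ord_val : valuation ord) (ord_p : ord p%:R = 1%:E).
Hypothesis K_complete : complete_valuation ord.
Variables (gamma lambda : K).
Let e : rat := (p.-1)%:R^-1.
Hypotheses (gamma_neq0 : gamma != 0) (vl_gamma : vl ord gamma = e).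
Notation vge := (vge ord).
Notation vl := (vl ord).
Notation expo := {ffun 'I_n -> int}.
Notation laurent := (expo -> K).
Implicit Types (u v : expo) (f g : laurent) (N : int).

Let e_gt0 : 0 < e.
Proof. by rewrite /e invr_gt0 ltr0n; have := prime_gt1 p_prime; case: (p) => [|[]]. Qed.

Let p1e : (p.-1)%:R * e = 1.
Proof. by rewrite /e divff // pnatr_eq0; have := prime_gt1 p_prime; case: (p) => [|[]]. Qed.

(* x is divisible by gamma^N in the ring of integers *)
Definition dvg N x : bool := vge (N%:~R * e) x.

Lemma dvg0 N : dvg N 0. Proof. exact: vge0. Qed.

Lemma dvgD N x y : dvg N x -> dvg N y -> dvg N (x + y).
Proof. exact: vgeD. Qed.

Lemma dvgN N x : dvg N (- x) = dvg N x.
Proof. exact: vgeN. Qed.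

Lemma dvgB N x y : dvg N x -> dvg N y -> dvg N (x - y).
Proof. exact: vgeB. Qed.

Lemma dvgM N M x y : dvg N x -> dvg M y -> dvg (N + M) (x * y).
Proof. by rewrite /dvg intrD mulrDl; exact: vgeM. Qed.

Lemma dvg_le N M x : N <= M -> dvg M x -> dvg N x.
Proof. by move=> h; apply: vge_le => //; rewrite ler_pM2r // ler_int. Qed.

Lemma dvg_vge0 x : dvg 0 x = vge 0 x. Proof. by rewrite /dvg mul0r. Qed.

Lemma dvgM0 N x y : dvg 0 x -> dvg N y -> dvg N (x * y).
Proof. by move=> h h'; have := dvgM h h'; rewrite add0r. Qed.

Lemma dvgM0r N x y : dvg N x -> dvg 0 y -> dvg N (x * y).
Proof. by move=> h h'; have := dvgM h h'; rewrite addr0. Qed.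

Lemma dvg_sum N (I : Type) (r : seq I) (P : pred I) (F : I -> K) :
  (forall i, P i -> dvg N (F i)) -> dvg N (\sum_(i <- r | P i) F i).
Proof. exact: vge_sum. Qed.

Lemma dvg_infsum N (I : eqType) (s : I -> K) :
  (forall i, dvg N (s i)) -> dvg N (infsum ord s).
Proof. exact: infsum_vge. Qed.

Lemma dvg_int (m : int) : dvg 0 m%:~R.
Proof. by rewrite dvg_vge0 vge_int. Qed.

Lemma dvg_nat m : dvg 0 m%:R.
Proof. by rewrite dvg_vge0 vge_nat. Qed.

Lemma dvg1 : dvg 0 1. Proof. exact: (dvg_nat 1). Qed.

Lemma dvgX0 x m : dvg 0 x -> dvg 0 (x ^+ m).
Proof. by rewrite !dvg_vge0; exact: vgeX0. Qed.

Lemma gammaz_neq0 N : gamma ^ N != 0. Proof. exact: expfz_neq0. Qed.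

Lemma vl_gammaz N : vl (gamma ^ N) = N%:~R * e.
Proof. by rewrite vlXz // vl_gamma. Qed.

Lemma dvg_gammaz N : dvg N (gamma ^ N).
Proof. by rewrite /dvg -vl_gammaz vge_val. Qed.

Lemma dvg_mulgz N M x : dvg N (x * gamma ^ M) = dvg (N - M) x.
Proof.
have h : N%:~R * e = (N - M)%:~R * e + vl (gamma ^ M) by rewrite vl_gammaz -mulrDl -intrD subrK.
by rewrite /dvg h vge_mulK ?gammaz_neq0.
Qed.

Lemma dvg_eq0 x : (forall m : nat, dvg m x) -> x = 0.
Proof.
(* The valuation of gamma^((p-1)m) is m. *)
move=> h; apply: (vge_eq0 ord_val) => m; have := h (p.-1 * m)%N.
by rewrite /dvg -pmulrn natrM mulrAC p1e mul1r.
Qed.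

Lemma tends_dvg (I : eqType) (s : I -> K) :
  (forall m : nat, exists S0 : seq I, forall i, i \notin S0 -> dvg m (s i)) -> tends_to_0 ord s.
Proof.
move=> h m; have [S0 hS] := h (p.-1 * m)%N; exists S0 => i /hS.
by rewrite /dvg -pmulrn natrM mulrAC p1e mul1r.
Qed.

Lemma tends2_dvg (I J : eqType) (s : I -> J -> K) :
  (forall m : nat, exists I0 : seq I, exists J0 : seq J, forall i j,
     (i \notin I0) || (j \notin J0) -> dvg m (s i j)) -> tends2 ord s.
Proof.
move=> h m; have [I0 [J0 hS]] := h (p.-1 * m)%N; exists I0, J0 => i j /hS.
by rewrite /dvg -pmulrn natrM mulrAC p1e mul1r.
Qed.

(** Like C_0 but without the condition that the coefficients tend to 0; it already ensures
    convergence of [shift_sum] and [lmul]. *)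
Definition Bd f : Prop := forall u, dvg (weight u) (f u).

(* sum_m a_m x^(p^m v), acting by multiplication *)
Definition shift_sum (a : nat -> K) (i : 'I_n.+1) f : laurent :=
  fun u => infsum ord (fun m => a m * f (u - ve i *+ (p ^ m))).

(** The exponent [ve i *+ (p ^ m)] has weight p^m, so this divisibility is what keeps [shift_sum]
    inside [Bd]. *)
Definition Sh (a : nat -> K) : Prop := forall m, dvg (p ^ m)%N (a m).

Let ltp m : (m < p ^ m)%N. Proof. exact: ltn_expl (prime_gt1 p_prime). Qed.

Lemma weight_sub u i m : weight u <= (p ^ m)%N%:Z + weight (u - ve i *+ (p ^ m)).
Proof. by rewrite -(weight_ve n_gt0 i (p ^ m)) -[in X in X <= _](subrK (ve i *+ (p ^ m)) u) addrC weightD. Qed.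

Lemma shift_sum_dvg a i f u m : Sh a -> Bd f ->
  dvg (weight u) (a m * f (u - ve i *+ (p ^ m))) /\ dvg m (a m * f (u - ve i *+ (p ^ m))).
Proof.
move=> ha hf; have h := dvgM (ha m) (hf (u - ve i *+ (p ^ m))); split.
  by apply: dvg_le h; exact: weight_sub.
apply: dvg_le h; have := weight_ge0 (u - ve i *+ (p ^ m)); have := ltp m; lia.
Qed.

Lemma shift_sum_tends a i f u : Sh a -> Bd f -> tends_to_0 ord (fun m => a m * f (u - ve i *+ (p ^ m))).
Proof.
move=> ha hf; apply: tends_dvg => N; exists (iota 0 N) => m.
rewrite mem_iota /= add0n -leqNgt => Nm; have [_] := shift_sum_dvg i u m ha hf.
by apply: dvg_le; rewrite lez_nat.
Qed.

Lemma Bd_shift_sum a i f : Sh a -> Bd f -> Bd (shift_sum a i f).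
Proof. by move=> ha hf u; apply: dvg_infsum => m; case: (shift_sum_dvg i u m ha hf). Qed.

Lemma BdD f g : Bd f -> Bd g -> Bd (fun u => f u + g u).
Proof. by move=> hf hg u; apply: dvgD. Qed.

Lemma BdN f : Bd f -> Bd (fun u => - f u).
Proof. by move=> hf u; rewrite dvgN. Qed.

Lemma BdZ c f : dvg 0 c -> Bd f -> Bd (fun u => c * f u).
Proof. by move=> hc hf u; apply: dvgM0. Qed.

Lemma Bd_sum (I : Type) (r : seq I) (F : I -> laurent) :
  (forall i, Bd (F i)) -> Bd (fun u => \sum_(i <- r) F i u).
Proof. by move=> h u; apply: dvg_sum => i _; exact: h. Qed.

Lemma shift_sumD a i f g : Sh a -> Bd f -> Bd g ->
  shift_sum a i (fun u => f u + g u) =1 (fun u => shift_sum a i f u + shift_sum a i g u).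
Proof.
move=> ha hf hg u; rewrite /shift_sum -infsumD //; try exact: shift_sum_tends.
by apply: eq_infsum => m; rewrite mulrDr.
Qed.

Lemma shift_sumZ a i c f : Sh a -> Bd f -> shift_sum a i (fun u => c * f u) =1 (fun u => c * shift_sum a i f u).
Proof.
move=> ha hf u; rewrite /shift_sum -infsumZ //; last exact: shift_sum_tends.
by apply: eq_infsum => m; rewrite mulrCA.
Qed.

Lemma shift_sumB a i f g : Sh a -> Bd f -> Bd g ->
  shift_sum a i (fun u => f u - g u) =1 (fun u => shift_sum a i f u - shift_sum a i g u).
Proof.
move=> ha hf hg u; rewrite /shift_sum -infsumB //; try exact: shift_sum_tends.
by apply: eq_infsum => m; rewrite mulrBr.
Qed.

Lemma shift_sum_a0 a i : shift_sum a i (fun=> 0) =1 (fun=> 0).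
Proof. by move=> u; rewrite /shift_sum infsum0 // => m; rewrite mulr0. Qed.

Lemma shift_sum_aD a b i f : Sh a -> Sh b -> Bd f ->
  shift_sum (fun m => a m + b m) i f =1 (fun u => shift_sum a i f u + shift_sum b i f u).
Proof.
move=> ha hb hf u; rewrite /shift_sum -infsumD //; try exact: shift_sum_tends.
by apply: eq_infsum => m; rewrite mulrDl.
Qed.

Lemma shift_sum_comm a b i j f : Sh a -> Sh b -> Bd f ->
  shift_sum a i (shift_sum b j f) =1 shift_sum b j (shift_sum a i f).
Proof.
move=> ha hb hf u.
pose s m m' := a m * (b m' * f (u - ve i *+ (p ^ m) - ve j *+ (p ^ m'))).
transitivity (infsum ord (fun m => infsum ord (s m))).
  by apply: eq_infsum => m; rewrite -infsumZ //; exact: shift_sum_tends.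
rewrite infsum_exchange //.
  apply: eq_infsum => m'; rewrite -infsumZ //; last exact: shift_sum_tends.
  by apply: eq_infsum => m; rewrite /s mulrCA addrAC.
apply: tends2_dvg => N; exists (iota 0 N), (iota 0 N) => m m'.
rewrite !mem_iota /= !add0n -!leqNgt => h.
have := dvgM (ha m) (dvgM (hb m') (hf (u - ve i *+ (p ^ m) - ve j *+ (p ^ m')))).
apply: dvg_le; have := weight_ge0 (u - ve i *+ (p ^ m) - ve j *+ (p ^ m')).
have := ltp m; have := ltp m'; lia.
Qed.

Lemma lmul_dvg f g u v : Bd f -> Bd g ->
  dvg (weight u) (f v * g (u - v)) /\ dvg (weight v) (f v * g (u - v)).
Proof.
move=> hf hg; have h := dvgM (hf v) (hg (u - v)); split; apply: dvg_le h.
  by rewrite -[in X in X <= _](subrK v u) addrC weightD.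
by have := weight_ge0 (u - v); lia.
Qed.

Lemma lmul_tends f g u : Bd f -> Bd g -> tends_to_0 ord (fun v => f v * g (u - v)).
Proof.
move=> hf hg; apply: tends_dvg => N; exists (wlist n N) => v /(wlistP n_gt0) h.
by have [_] := lmul_dvg u v hf hg; apply: dvg_le.
Qed.

Lemma Bd_lmul f g : Bd f -> Bd g -> Bd (lmul ord f g).
Proof. by move=> hf hg u; apply: dvg_infsum => v; case: (lmul_dvg u v hf hg). Qed.

Lemma lmul_shift_sum_r F a i g : Bd F -> Sh a -> Bd g ->
  lmul ord F (shift_sum a i g) =1 shift_sum a i (lmul ord F g).
Proof.
move=> hF ha hg u.
pose s v m := F v * (a m * g (u - v - ve i *+ (p ^ m))).
transitivity (infsum ord (fun v => infsum ord (s v))).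
  by apply: eq_infsum => v; rewrite -infsumZ //; exact: shift_sum_tends.
rewrite infsum_exchange //.
  apply: eq_infsum => m; rewrite -infsumZ //; last exact: lmul_tends.
  by apply: eq_infsum => v; rewrite /s mulrCA addrAC.
apply: tends2_dvg => N; exists (wlist n N), (iota 0 N) => v m.
rewrite !mem_iota /= !add0n -!leqNgt => h.
have := dvgM (hF v) (dvgM (ha m) (hg (u - v - ve i *+ (p ^ m)))).
apply: dvg_le; have := weight_ge0 (u - v - ve i *+ (p ^ m)).
have := ltp m; have := weight_ge0 v; case/orP: h => [/(wlistP n_gt0)|]; lia.
Qed.

Lemma lmul_shift_sum_l F a i g : Bd F -> Sh a -> Bd g ->
  lmul ord (shift_sum a i F) g =1 shift_sum a i (lmul ord F g).
Proof.
move=> hF ha hg u.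
pose s v m := (a m * F (v - ve i *+ (p ^ m))) * g (u - v).
transitivity (infsum ord (fun v => infsum ord (s v))).
  apply: eq_infsum => v; rewrite mulrC -infsumZ //; last exact: shift_sum_tends.
  by apply: eq_infsum => m; rewrite /s mulrC.
rewrite infsum_exchange //.
  apply: eq_infsum => m; rewrite -infsumZ //; last exact: lmul_tends.
  rewrite -(@infsum_reindex _ _ ord_val _ _ _ (fun v => v + ve i *+ (p ^ m)) (fun v => v - ve i *+ (p ^ m))) //.
  - by apply: eq_infsum => v; rewrite /s addrK -mulrA opprD addrA addrAC.
  - by move=> v; rewrite addrK.
  - by move=> v; rewrite subrK.
  - apply: tends_dvg => N; exists (wlist n N) => v /(wlistP n_gt0) h.
    have := dvgM (dvgM (ha m) (hF (v - ve i *+ (p ^ m)))) (hg (u - v)).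
    by apply: dvg_le; have := weight_sub v i m; have := weight_ge0 (u - v); lia.
apply: tends2_dvg => N; exists (wlist n N), (iota 0 N) => v m.
rewrite !mem_iota /= !add0n -!leqNgt => h.
have := dvgM (dvgM (ha m) (hF (v - ve i *+ (p ^ m)))) (hg (u - v)).
apply: dvg_le; have := weight_sub v i m; have := weight_ge0 (u - v).
have := weight_ge0 (v - ve i *+ (p ^ m)).
have := ltp m; have := weight_ge0 v; case/orP: h => [/(wlistP n_gt0)|]; lia.
Qed.

Lemma lmulDl f g h : Bd f -> Bd g -> Bd h ->
  lmul ord (fun u => f u + g u) h =1 (fun u => lmul ord f h u + lmul ord g h u).
Proof.
move=> hf hg hh u; rewrite /lmul -infsumD //; try exact: lmul_tends.
by apply: eq_infsum => v; rewrite mulrDl.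
Qed.

Lemma lmulDr f g h : Bd f -> Bd g -> Bd h ->
  lmul ord f (fun u => g u + h u) =1 (fun u => lmul ord f g u + lmul ord f h u).
Proof.
move=> hf hg hh u; rewrite /lmul -infsumD //; try exact: lmul_tends.
by apply: eq_infsum => v; rewrite mulrDr.
Qed.

Lemma lmulZl c f g : Bd f -> Bd g -> lmul ord (fun u => c * f u) g =1 (fun u => c * lmul ord f g u).
Proof.
move=> hf hg u; rewrite /lmul -infsumZ //; last exact: lmul_tends.
by apply: eq_infsum => v; rewrite mulrA.
Qed.

Lemma lmulZr c f g : Bd f -> Bd g -> lmul ord f (fun u => c * g u) =1 (fun u => c * lmul ord f g u).
Proof.
move=> hf hg u; rewrite /lmul -infsumZ //; last exact: lmul_tends.
by apply: eq_infsum => v; rewrite mulrCA.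
Qed.

(** The Euler operator E_i - E_k, where E_i is x_i d/dx_i and E_n = 0 at the last index. *)
Definition eu (i k : 'I_n.+1) f : laurent := fun u => (co u i - co u k)%:~R * f u.

Lemma Bd_eu i k f : Bd f -> Bd (eu i k f).
Proof. by move=> hf u; apply: dvgM0 => //; exact: dvg_int. Qed.

Lemma eu_lmul i k f g : Bd f -> Bd g ->
  eu i k (lmul ord f g) =1 (fun u => lmul ord (eu i k f) g u + lmul ord f (eu i k g) u).
Proof.
move=> hf hg u; rewrite /eu /lmul -infsumZ //; last exact: lmul_tends.
rewrite -infsumD //; last 2 first.
- by apply: (lmul_tends (f := eu i k f)) => //; exact: Bd_eu.
- by apply: (lmul_tends (g := eu i k g)) => //; exact: Bd_eu.
apply: eq_infsum => v; rewrite !coD !coN.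
rewrite (_ : co u i - co u k = (co v i - co v k) + (co u i - co v i - (co u k - co v k))); last by ring.
by rewrite intrD; ring.
Qed.

(** Coefficients of the Euler derivative of the multiplier, for use in the Leibniz rule. *)
Definition shift_sum' (a : nat -> K) (m : nat) : K := a m * (p ^ m)%:R.

Lemma Sh_shift_sum' a : Sh a -> Sh (shift_sum' a).
Proof. by move=> ha m; apply: dvgM0r => //; exact: dvg_nat. Qed.

Lemma eu_shift_sum i k a j f : Sh a -> Bd f ->
  eu i k (shift_sum a j f) =1
  (fun u => shift_sum a j (eu i k f) u + ((i == j)%:R - (k == j)%:R) * shift_sum (shift_sum' a) j f u).
Proof.
move=> ha hf u; have ha' := Sh_shift_sum' ha.
rewrite /eu /shift_sum -infsumZ //; last exact: shift_sum_tends.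
rewrite -infsumZ //; last exact: shift_sum_tends.
rewrite -infsumD //; last 2 first.
- by apply: (@shift_sum_tends a j (eu i k f)) => //; exact: Bd_eu.
- by apply: tends_to_0Z => //; exact: shift_sum_tends.
apply: eq_infsum => m; rewrite /shift_sum' !coD !coN !coMn !co_ve.
have alg (x y z : int) (b1 b2 q : nat) (A F : K) :
    (x - y)%:~R * (A * F) = A * ((x - (b1%:R - z) *+ q - (y - (b2%:R - z) *+ q))%:~R * F)
      + (b1%:R - b2%:R) * (A * q%:R * F).
  rewrite (_ : x - _ - _ = (x - y) - (b1%:R - b2%:R) *+ q); last by rewrite !mulrnBl; ring.
  have h : ((x - y) - (b1%:R - b2%:R) *+ q)%:~R = (x - y)%:~R - (b1%:R - b2%:R) * q%:R :> K.
    rewrite [LHS]intrB; congr (_ - _).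
    by rewrite -[X in X%:~R]mulr_natr intrM natz intrB !rmorph_nat -pmulrn.
  rewrite h; move: ((x - y)%:~R : K) (b1%:R : K) (b2%:R : K) (q%:R : K) => X B1 B2 Q; ring.
exact: alg.
Qed.

(** * The operators D_i - D_k *)

Definition lam (i : 'I_n.+1) : K := if i == ord_max then lambda else 1.

Hypothesis gamma__coef : forall m,
  vge ((p ^ m)%:R * e + ((p ^ m)%:R - 1)) (p%:R ^+ m * gamma_ p gamma m).
Hypotheses (lambda_neq0 : lambda != 0) (vl_lambda : vl lambda = 0).

Lemma lam_neq0 i : lam i != 0.
Proof. by rewrite /lam; case: ifP => _ //; exact: oner_neq0. Qed.

Lemma vl_lam i : vl (lam i) = 0.
Proof. by rewrite /lam; case: ifP => _ //; exact: vl1. Qed.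

Lemma dvg_lam i : dvg 0 (lam i).
Proof. by rewrite dvg_vge0 -(vl_lam i) vge_val. Qed.

Lemma dvg_lamV i : dvg 0 (lam i)^-1.
Proof. by rewrite dvg_vge0 -oppr0 -(vl_lam i) -vlV // vge_val. Qed.

(** The three series belonging to the monomial v_i: [aS] occurs in the connection, [aR] in the
    logarithmic derivative of F, and [aP] is their difference. The latter starts at m = 1 and is p
    times a shifted copy of [aS], which is what makes Frobenius commute with the connection up to
    p. *)
Definition aS i m : K := p%:R ^+ m * gamma_ p gamma m * lam i ^+ (p ^ m).
Definition aR i m : K := gamma ^+ (p ^ m) * lam i ^+ (p ^ m).
Definition aP i m : K :=
  if m is m'.+1 then p%:R * (p%:R ^+ m' * gamma_ p gamma m' * lam i ^+ (p ^ m)) else 0.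

Lemma aS_dvg i m : dvg ((p ^ m)%N%:Z + p.-1%:Z * ((p ^ m)%N%:Z - 1)) (aS i m).
Proof.
apply: dvgM0r; last by apply: dvgX0; exact: dvg_lam.
rewrite /dvg; apply: vge_le (gamma__coef m) => //.
rewrite intrD intrM intrB mulrDl mulrAC -!pmulrn p1e mul1r //.
Qed.

Lemma Sh_aS i : Sh (aS i).
Proof.
move=> m; apply: dvg_le (aS_dvg i m); have : (0 < p ^ m)%N by rewrite expn_gt0 prime_gt0.
set q := (p ^ m)%N; set p1 := p.-1; nia.
Qed.

Lemma Sh_aR i : Sh (aR i).
Proof.
move=> m; apply: dvgM0r; last by apply: dvgX0; exact: dvg_lam.
by rewrite exprnP; exact: dvg_gammaz.
Qed.

Lemma aSE i m : aS i m = aR i m + aP i m.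
Proof.
have pn := pnat_neq0 ord_val ord_p; rewrite /aS /aR; case: m => [|m] /=.
  by rewrite /gamma_ big_ord1 expr0 divr1 mul1r addr0.
rewrite /gamma_ big_ord_recr /= exprS; move: (gamma ^+ _) (lam i ^+ _) => G L.
by field; rewrite expf_neq0.
Qed.

Lemma Sh_aP i : Sh (aP i).
Proof.
move=> m; rewrite (_ : aP i m = aS i m - aR i m); last by rewrite aSE addrAC subrr add0r.
by apply: dvgB; [exact: Sh_aS|exact: Sh_aR].
Qed.

Hint Resolve Sh_aS Sh_aR Sh_aP : core.

(* For i < n, the operator D_i - D_k, with the convention D_n = 0. *)
Definition Dg (i k : 'I_n.+1) f : laurent :=
  fun u => eu i k f u + (shift_sum (aS i) i f u - shift_sum (aS k) k f u).

Lemma Bd_Dg i k f : Bd f -> Bd (Dg i k f).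
Proof.
move=> hf u; apply: dvgD; first exact: Bd_eu.
by apply: dvgB; exact: Bd_shift_sum.
Qed.

Lemma DgD i k f g : Bd f -> Bd g -> Dg i k (fun u => f u + g u) =1 (fun u => Dg i k f u + Dg i k g u).
Proof.
move=> hf hg u; rewrite /Dg !shift_sumD // /eu.
have alg (m x y a b c d : K) : m * (x + y) + (a + b - (c + d)) = m * x + (a - c) + (m * y + (b - d)) by ring.
exact: alg.
Qed.

Lemma DgZ i k c f : Bd f -> Dg i k (fun u => c * f u) =1 (fun u => c * Dg i k f u).
Proof.
move=> hf u; rewrite /Dg !shift_sumZ // /eu.
have alg (m x y a b : K) : m * (x * y) + (x * a - x * b) = x * (m * y + (a - b)) by ring.
exact: alg.
Qed.

Lemma Dg0 i k : Dg i k (fun=> 0) =1 (fun=> 0).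
Proof. by move=> u; rewrite /Dg !shift_sum_a0 /eu mulr0 subrr addr0. Qed.

Lemma Dg_sum i k (I : Type) (r : seq I) (c : I -> K) (F : I -> laurent) :
  (forall t, dvg 0 (c t)) -> (forall t, Bd (F t)) ->
  Dg i k (fun u => \sum_(t <- r) c t * F t u) =1 (fun u => \sum_(t <- r) c t * Dg i k (F t) u).
Proof.
move=> hc hF; elim: r => [|t r IH] u.
  rewrite big_nil -[RHS](Dg0 i k u); congr (Dg i k _ u).
  by apply: funext => v; rewrite big_nil.
rewrite big_cons -IH -DgZ // -DgD //; last 2 first.
- exact: BdZ.
- by apply: Bd_sum => t'; exact: BdZ.
by congr (Dg i k _ u); apply: funext => v; rewrite big_cons.
Qed.

Lemma Dg_sub i k f : Dg i k f =1 (fun u => Dg i ord_max f u - Dg k ord_max f u).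
Proof.
move=> u; rewrite /Dg /eu co_max !subr0 intrB.
have alg (x y z a b c : K) : (x - y) * z + (a - b) = x * z + (a - c) - (y * z + (b - c)) by ring.
exact: alg.
Qed.

Lemma Dg_diag i f : Dg i i f =1 (fun=> 0).
Proof. by move=> u; rewrite /Dg /eu !subrr mul0r addr0. Qed.

(** Multipliers commute with each other, as do Euler operators. For distinct i and j the Leibniz
    terms come only from the k-th multiplier, and they agree on both sides; [alg] covers the cases i
    = k and j = k. *)
Lemma Dg_comm i j k f : Bd f -> Dg i k (Dg j k f) =1 Dg j k (Dg i k f).
Proof.
move=> hf u; have [->//|ij] := eqVneq i j.
have exp (x y : 'I_n.+1) : Dg x k (Dg y k f) u =
    eu x k (eu y k f) u + eu x k (shift_sum (aS y) y f) u - eu x k (shift_sum (aS k) k f) u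
    + (shift_sum (aS x) x (eu y k f) u + shift_sum (aS x) x (shift_sum (aS y) y f) u - shift_sum (aS x) x (shift_sum (aS k) k f) u)
    - (shift_sum (aS k) k (eu y k f) u + shift_sum (aS k) k (shift_sum (aS y) y f) u - shift_sum (aS k) k (shift_sum (aS k) k f) u).
  have h z : shift_sum (aS z) z (Dg y k f) u = shift_sum (aS z) z (eu y k f) u
     + shift_sum (aS z) z (shift_sum (aS y) y f) u - shift_sum (aS z) z (shift_sum (aS k) k f) u.
    rewrite /Dg shift_sumD //; [|exact: Bd_eu|]; last first.
      by apply: BdD; [exact: Bd_shift_sum|apply: BdN; exact: Bd_shift_sum].
    by rewrite shift_sumB ?addrA //; exact: Bd_shift_sum.
  have D1 (g : laurent) : Dg x k g u = eu x k g u + (shift_sum (aS x) x g u - shift_sum (aS k) k g u) by [].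
  have D2 : eu x k (Dg y k f) u = (co u x - co u k)%:~R *
    (eu y k f u + (shift_sum (aS y) y f u - shift_sum (aS k) k f u)) by [].
  rewrite D1 D2 (h x) (h k).
  have alg (m f1 f2 f3 a b c d e' g : K) : m * (f1 + (f2 - f3)) + (a + b - c - (d + e' - g)) =
    m * f1 + m * f2 - m * f3 + (a + b - c) - (d + e' - g) by ring.
  exact: alg.
rewrite (exp i j) (exp j i) (shift_sum_comm i k (Sh_aS i) (Sh_aS k) hf) (shift_sum_comm j k (Sh_aS j) (Sh_aS k) hf).
rewrite (shift_sum_comm j i (Sh_aS j) (Sh_aS i) hf).
rewrite [eu j k (eu i k f) u](_ : _ = eu i k (eu j k f) u); last by rewrite /eu mulrCA.
rewrite (eu_shift_sum i k j (Sh_aS j) hf u) (eu_shift_sum i k k (Sh_aS k) hf u).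
rewrite (eu_shift_sum j k i (Sh_aS i) hf u) (eu_shift_sum j k k (Sh_aS k) hf u).
rewrite eqxx (negbTE ij) [j == i]eq_sym (negbTE ij).
rewrite [k == j]eq_sym [k == i]eq_sym.
have alg (x1 a1 s1 a2 s2 a3 b3 c3 a4 b4 c4 t : K) (b1 b2 : bool) :
  (b1 -> s1 = s2) -> (b2 -> t = s2) ->
  x1 + (a1 + (false%:R - b1%:R) * s1) - (a2 + (b2%:R - true%:R) * s2) + (a3 + b3 - c3) - (a4 + b4 - c4) =
  x1 + (a3 + (false%:R - b2%:R) * t) - (a4 + (b1%:R - true%:R) * s2) + (a1 + b3 - b4) - (a2 + c3 - c4).
  case: b1 => [/(_ isT) ->|_]; case: b2 => [/(_ isT) ->|_] /=; ring.
apply: alg => /eqP h; last by rewrite h.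
by rewrite h.
Qed.

Lemma Dop_Dg l f : Bd f -> Dop p ord gamma lambda l f =1 Dg (lift ord_max l) ord_max f.
Proof.
move=> hf u; rewrite /Dop /Dg /eu co_lift co_max subr0; congr (_ + _).
rewrite /shift_sum -infsumB //; try exact: shift_sum_tends.
apply: eq_infsum => m; rewrite /aS /lam eqxx [lift _ _ == ord_max]eq_sym (negbTE (neq_lift _ _)).
rewrite ve_lift ve_max mulNrn opprK expr1n mulr1.
have alg (x t y z : K) : x * (y - t * z) = x * y - x * t * z by ring.
exact: alg.
Qed.

(** * The series F and its differential equation *)

Hypothesis AH_integral : forall m, vge 0 (AH p K m).

Definition th (i : 'I_n.+1) : laurent := theta_at p ord gamma (lam i) (ve i).

Lemma theta_dvg (m : nat) : dvg m (theta p gamma m).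
Proof. by rewrite -[m%:Z]add0r; apply: dvgM; [rewrite dvg_vge0|exact: dvg_gammaz]. Qed.

Lemma ve_Mn_inj (i : 'I_n.+1) m m' : ve i *+ m = ve i *+ m' -> m = m'.
Proof.
by move=> h; have := weight_ve n_gt0 i m; rewrite h weight_ve // => -[].
Qed.

Lemma th_ve i m : th i (ve i *+ m) = theta p gamma m * lam i ^+ m.
Proof.
rewrite /th /theta_at (@infsum1 _ _ ord_val _ _ m) ?eqxx ?mul1r // => m' mm.
by case: eqP => [/ve_Mn_inj h|_]; [rewrite h eqxx in mm|rewrite mul0r].
Qed.

Lemma th_out i u : (forall m, u <> ve i *+ m) -> th i u = 0.
Proof.
move=> h; rewrite /th /theta_at infsum0 // => m.
by case: eqP => [hm|_]; [case: (h m)|rewrite mul0r].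
Qed.

Lemma th_cases (P : expo -> Prop) (i : 'I_n.+1) : (forall m, P (ve i *+ m)) ->
  (forall u, (forall m, u <> ve i *+ m) -> P u) -> forall u, P u.
Proof.
move=> h1 h2 u; have [[m ->]|hn] := pselect (exists m, u = ve i *+ m); first exact: h1.
by apply: h2 => m um; apply: hn; exists m.
Qed.

Lemma Bd_th i : Bd (th i).
Proof.
apply: (@th_cases _ i) => [m|u h]; last by rewrite th_out // dvg0.
rewrite th_ve weight_ve //; apply: dvgM0r; first exact: theta_dvg.
by apply: dvgX0; exact: dvg_lam.
Qed.

Lemma th_sub i m q : th i (ve i *+ m - ve i *+ q) =
  if (q <= m)%N then theta p gamma (m - q) * lam i ^+ (m - q) else 0.
Proof.
case: leqP => h; first by rewrite -mulrnBr // th_ve.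
apply: th_out => m' /(canRL (subrK _)); rewrite -mulrnDr => /ve_Mn_inj e1.
by move: h; rewrite e1; lia.
Qed.

Lemma theta_rec (m : nat) : m%:R * theta p gamma m =
  \sum_(j < m.+1) gamma ^+ (p ^ j) * (if (p ^ j <= m)%N then theta p gamma (m - p ^ j) else 0).
Proof.
rewrite /theta mulrA (AH_rec p_prime ord_val ord_p) mulr_suml; apply: eq_bigr => j _.
case: ifP => h; last by rewrite mul0r mulr0.
by rewrite mulrCA -exprD subnKC.
Qed.

(** The recursion of the Artin-Hasse coefficients, read as a differential equation for one factor of
    F. *)
Lemma eu_th i j k : eu j k (th i) =1
  (fun u => ((j == i)%:R - (k == i)%:R) * shift_sum (aR i) i (th i) u).
Proof.
apply: (@th_cases _ i) => [m|u hu]; last first.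
  rewrite /eu th_out // mulr0 /shift_sum infsum0 ?mulr0 // => m.
  rewrite th_out ?mulr0 // => m' /(canRL (subrK _)); rewrite -mulrnDr; exact: hu.
rewrite /eu !coMn !co_ve th_ve.
have -> : ((j == i)%:R - (i == ord_max)%:R) *+ m - ((k == i)%:R - (i == ord_max)%:R) *+ m
    = ((j == i)%:R - (k == i)%:R) * m%:R :> int.
  by rewrite mulr_natr -mulrnBl; congr (_ *+ m); ring.
rewrite intrM intrB !rmorph_nat -mulrA; congr (_ * _).
rewrite mulrA theta_rec mulr_suml /shift_sum (@infsum_fin _ _ ord_val _ _ (iota 0 m.+1)) ?iota_uniq //.
  rewrite -(big_mkord xpredT (fun q => gamma ^+ (p ^ q) *
    (if (p ^ q <= m)%N then theta p gamma (m - p ^ q) else 0) * lam i ^+ m)) /index_iota subn0.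
  apply: eq_bigr => q _; rewrite th_sub /aR; case: ifP => h; last by rewrite !mulr0 mul0r.
  have -> : lam i ^+ m = lam i ^+ (p ^ q) * lam i ^+ (m - p ^ q) by rewrite -exprD subnKC.
  have alg (A B C D : K) : A * B * (C * D) = A * C * (B * D) by ring.
  exact: alg.
move=> q; rewrite mem_iota /= add0n -leqNgt => h.
rewrite th_sub ifF ?mulr0 //; apply/negbTE; rewrite -ltnNge.
by apply: leq_ltn_trans (ltp q); exact: leq_trans h.
Qed.

Definition Pth (s : seq 'I_n) : laurent := \big[lmul ord/lone K (n:=n)]_(j <- s) th (lift ord_max j).

Lemma Bd_lone : Bd (lone K (n:=n)).
Proof.
move=> u; rewrite /lone; case: eqP => [->|_]; last exact: dvg0.
by rewrite weight0 // dvg1.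
Qed.

Lemma Bd_Pth s : Bd (Pth s).
Proof.
rewrite /Pth; elim: s => [|j s IH]; first by rewrite big_nil; exact: Bd_lone.
by rewrite big_cons; apply: Bd_lmul => //; exact: Bd_th.
Qed.

Lemma eu_Pth (l : 'I_n) s : uniq s -> eu (lift ord_max l) ord_max (Pth s) =1
  (fun u => (l \in s)%:R * shift_sum (aR (lift ord_max l)) (lift ord_max l) (Pth s) u).
Proof.
elim: s => [|j s IH] /=.
  move=> _ u; rewrite mul0r /eu /Pth big_nil /lone; case: eqP => [->|_]; last by rewrite mulr0.
  by rewrite /co; case: (unlift _ _); case: (unlift _ _) => *; rewrite /= ?ffunE subrr mul0r.
case/andP => js us u; have BP := Bd_Pth s; have Bj := Bd_th (lift ord_max j).
have Pc : Pth (j :: s) = lmul ord (th (lift ord_max j)) (Pth s) by rewrite /Pth big_cons.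
rewrite Pc eu_lmul //.
have -> : eu (lift ord_max l) ord_max (th (lift ord_max j)) =
   (fun u => (l == j)%:R * shift_sum (aR (lift ord_max j)) (lift ord_max j) (th (lift ord_max j)) u).
  apply: funext => v; rewrite eu_th (inj_eq lift_inj).
  by rewrite (negbTE (neq_lift _ _)) subr0.
have -> : eu (lift ord_max l) ord_max (Pth s) =
   (fun u => (l \in s)%:R * shift_sum (aR (lift ord_max l)) (lift ord_max l) (Pth s) u).
  by apply: funext => v; exact: IH.
rewrite lmulZl ?lmulZr //; try exact: Bd_shift_sum.
rewrite lmul_shift_sum_l // lmul_shift_sum_r // inE.
have [lj|_] := eqVneq l j; last by rewrite mul0r add0r.
by rewrite lj (negbTE js) mul0r addr0.
Qed.

Definition Fs : laurent := Fseries p ord gamma lambda (n:=n).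

Lemma FsE : Fs = lmul ord (th ord_max) (Pth (index_enum 'I_n)).
Proof.
rewrite /Fs /Fseries /th ve_max /lam eqxx; congr lmul; rewrite /Pth.
by apply: eq_bigr => j _; rewrite /th ve_lift /lam [lift _ _ == _]eq_sym (negbTE (neq_lift _ _)).
Qed.

Lemma Bd_Fs : Bd Fs.
Proof. by rewrite FsE; apply: Bd_lmul; [exact: Bd_th|exact: Bd_Pth]. Qed.

Lemma eu_Fs (l : 'I_n) : eu (lift ord_max l) ord_max Fs =1
  (fun u => shift_sum (aR (lift ord_max l)) (lift ord_max l) Fs u - shift_sum (aR ord_max) ord_max Fs u).
Proof.
move=> u; rewrite FsE; set s := index_enum _; have BP := Bd_Pth s; have Bm := Bd_th ord_max.
rewrite eu_lmul //.
have -> : eu (lift ord_max l) ord_max (th ord_max) =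
   (fun u => (-1) * shift_sum (aR ord_max) ord_max (th ord_max) u).
  apply: funext => v; rewrite eu_th eqxx [lift _ _ == _]eq_sym (negbTE (neq_lift _ _)).
  by rewrite sub0r.
have -> : eu (lift ord_max l) ord_max (Pth s) =
   (fun u => 1 * shift_sum (aR (lift ord_max l)) (lift ord_max l) (Pth s) u).
  apply: funext => v; rewrite eu_Pth ?index_enum_uniq //.
  by rewrite mem_index_enum.
rewrite lmulZl ?lmulZr //; try exact: Bd_shift_sum.
by rewrite lmul_shift_sum_l // lmul_shift_sum_r // mul1r mulN1r addrC.
Qed.

(** The [aR] part of the connection is the logarithmic derivative of F, so by the Leibniz rule it is
    absorbed when F is moved inside the Euler operator; only [aP] remains. *)
Lemma lmul_Dg g (l : 'I_n) : Bd g -> lmul ord Fs (Dg (lift ord_max l) ord_max g) =1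
  (fun u => eu (lift ord_max l) ord_max (lmul ord Fs g) u
    + (shift_sum (aP (lift ord_max l)) (lift ord_max l) (lmul ord Fs g) u
     - shift_sum (aP ord_max) ord_max (lmul ord Fs g) u)).
Proof.
move=> hg u; set L := lift ord_max l; have hF := Bd_Fs; have hFg := Bd_lmul hF hg.
have N1 : (fun v => - shift_sum (aS ord_max) ord_max g v) = (fun v => (-1) * shift_sum (aS ord_max) ord_max g v).
  by apply: funext => v; rewrite mulN1r.
have BN : Bd (fun v => - shift_sum (aS ord_max) ord_max g v) by apply: BdN; exact: Bd_shift_sum.
have e1 : lmul ord Fs (Dg L ord_max g) u = lmul ord Fs (eu L ord_max g) u +
    (shift_sum (aS L) L (lmul ord Fs g) u - shift_sum (aS ord_max) ord_max (lmul ord Fs g) u).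
  rewrite /Dg lmulDr //; [|exact: Bd_eu|by apply: BdD => //; exact: Bd_shift_sum].
  rewrite (lmulDr hF (Bd_shift_sum L (Sh_aS L) hg) BN) N1.
  by rewrite (lmulZr (-1) hF (Bd_shift_sum ord_max (Sh_aS ord_max) hg))
    (lmul_shift_sum_r L hF (Sh_aS L) hg) (lmul_shift_sum_r ord_max hF (Sh_aS ord_max) hg) mulN1r.
have e2 : eu L ord_max (lmul ord Fs g) u =
    (shift_sum (aR L) L (lmul ord Fs g) u - shift_sum (aR ord_max) ord_max (lmul ord Fs g) u) +
    lmul ord Fs (eu L ord_max g) u.
  rewrite eu_lmul //; congr (_ + _).
  have -> : eu L ord_max Fs = (fun v => shift_sum (aR L) L Fs v + (-1) * shift_sum (aR ord_max) ord_max Fs v).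
    by apply: funext => v; rewrite eu_Fs mulN1r.
  have BR i : Bd (shift_sum (aR i) i Fs) by exact: Bd_shift_sum.
  rewrite lmulDl //; last by apply: BdZ => //; rewrite dvgN dvg1.
  congr (_ + _); first exact: lmul_shift_sum_l.
  transitivity (-1 * lmul ord (shift_sum (aR ord_max) ord_max Fs) g u); first exact: lmulZl.
  by rewrite mulN1r; congr (- _); exact: lmul_shift_sum_l.
have S_split i : shift_sum (aS i) i (lmul ord Fs g) u =
    shift_sum (aR i) i (lmul ord Fs g) u + shift_sum (aP i) i (lmul ord Fs g) u.
  rewrite -shift_sum_aD //; congr (shift_sum _ i _ u); apply: funext => m; exact: aSE.
rewrite e1 e2 !S_split.
have alg (x a b c d : K) : x + (a + b - (c + d)) = a - c + x + (b - d) by ring.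
exact: alg.
Qed.

(** * The Frobenius operator, with tau in the role of the inverse of sigma *)

Variable tau : {rmorphism K -> K}.
Hypotheses (tau_vge0 : forall x, vge 0 x -> vge 0 (tau x)) (tau_gamma : tau gamma = gamma).
Hypothesis tau_lambda : tau (lambda ^+ p) = lambda.

Lemma tau_gammaz N : tau (gamma ^ N) = gamma ^ N.
Proof. by rewrite fmorphXz tau_gamma. Qed.

Lemma tau_dvg N x : dvg N x -> dvg N (tau x).
Proof.
rewrite -[x](divfK (gammaz_neq0 N)) rmorphM tau_gammaz !dvg_mulgz subrr !dvg_vge0.
exact: tau_vge0.
Qed.

Lemma tau_vge_nat (m : nat) x : vge m%:R x -> vge m%:R (tau x).
Proof.
have h y : vge m%:R y = dvg (p.-1 * m)%N y.
  by rewrite /dvg -pmulrn natrM mulrAC p1e mul1r.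
by rewrite !h; exact: tau_dvg.
Qed.

Lemma tau_infsum (I : eqType) (s : I -> K) : tends_to_0 ord s ->
  tau (infsum ord s) = infsum ord (fun i => tau (s i)).
Proof.
move=> hs; symmetry; apply: (infsumE ord_val) => m.
have [S hS] := has_infsum ord_val K_complete hs m; exists S => S' uS sub.
by rewrite -rmorph_sum -rmorphB; apply: tau_vge_nat; exact: hS.
Qed.

Lemma tau_lam i : tau (lam i ^+ p) = lam i.
Proof. by rewrite /lam; case: ifP => // _; rewrite expr1n rmorph1. Qed.

Lemma tau_gamma_ m : tau (gamma_ p gamma m) = gamma_ p gamma m.
Proof.
rewrite /gamma_ rmorph_sum; apply: eq_bigr => j _.
by rewrite fmorph_div !rmorphXn rmorph_nat tau_gamma.
Qed.

Definition frob f : laurent := fun u => tau (lmul ord Fs f (u *+ p)).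

Lemma frob_dvg f u : Bd f -> dvg (weight u *+ p) (frob f u).
Proof.
move=> hf; rewrite -(weightMn u (prime_gt0 p_prime)); apply: tau_dvg.
by apply: Bd_lmul => //; exact: Bd_Fs.
Qed.

Lemma Bd_frob f : Bd f -> Bd (frob f).
Proof.
move=> hf u; apply: dvg_le (frob_dvg u hf); have := weight_ge0 u.
by rewrite -mulr_natr natz; have := prime_gt0 p_prime; nia.
Qed.

Lemma frobZ c f : Bd f -> frob (fun u => c * f u) =1 (fun u => tau c * frob f u).
Proof. by move=> hf u; rewrite /frob -rmorphM lmulZr //; exact: Bd_Fs. Qed.

Lemma frobD f g : Bd f -> Bd g -> frob (fun u => f u + g u) =1 (fun u => frob f u + frob g u).
Proof. by move=> hf hg u; rewrite /frob -rmorphD lmulDr //; exact: Bd_Fs. Qed.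

Lemma frob_0 : frob (fun=> 0) =1 (fun=> 0).
Proof.
move=> u; rewrite /frob /lmul infsum0 ?rmorph0 // => v; by rewrite mulr0.
Qed.

(** The term m = 0 of [aP] vanishes. In the others, psi divides the shift p^(m+1) v_i by p, and tau
    turns lambda^(p^(m+1)) into lambda^(p^m). *)
Lemma tau_shift_sum_aP i f u : Bd f ->
  tau (shift_sum (aP i) i f (u *+ p)) = p%:R * shift_sum (aS i) i (fun v => tau (f (v *+ p))) u.
Proof.
move=> hf; have hB : Bd (fun v => tau (f (v *+ p))).
  move=> v; apply: tau_dvg; apply: dvg_le (hf (v *+ p)).
  rewrite weightMn ?prime_gt0 // -mulr_natr natz; have := weight_ge0 v.
  by have := prime_gt0 p_prime; nia.
rewrite /shift_sum tau_infsum; last exact: shift_sum_tends.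
rewrite infsum_recl //; last first.
  move=> m; have [S hS] := shift_sum_tends i (u *+ p) (Sh_aP i) hf m; exists S => j /hS.
  exact: tau_vge_nat.
rewrite /= mul0r rmorph0 add0r -infsumZ //; last first.
  exact: (shift_sum_tends i u (Sh_aS i) hB).
apply: eq_infsum => m /=.
have -> : u *+ p - ve i *+ p ^ m.+1 = (u - ve i *+ p ^ m) *+ p.
  by rewrite mulrnBl -mulrnA expnSr.
rewrite !rmorphM rmorph_nat rmorphXn rmorph_nat tau_gamma_ expnS exprM rmorphXn /= tau_lam.
by rewrite /aS -!mulrA.
Qed.

Lemma frob_Dg (l : 'I_n) g : Bd g ->
  frob (Dg (lift ord_max l) ord_max g) =1 (fun u => p%:R * Dg (lift ord_max l) ord_max (frob g) u).
Proof.
move=> hg u; have hFg := Bd_lmul Bd_Fs hg; set L := lift ord_max l.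
transitivity (tau (eu L ord_max (lmul ord Fs g) (u *+ p) + (shift_sum (aP L) L (lmul ord Fs g) (u *+ p)
   - shift_sum (aP ord_max) ord_max (lmul ord Fs g) (u *+ p)))).
  by congr (tau _); exact: lmul_Dg.
have t1 : tau (shift_sum (aP L) L (lmul ord Fs g) (u *+ p)) = p%:R * shift_sum (aS L) L (frob g) u.
  exact: tau_shift_sum_aP.
have t2 : tau (shift_sum (aP ord_max) ord_max (lmul ord Fs g) (u *+ p)) =
    p%:R * shift_sum (aS ord_max) ord_max (frob g) u.
  exact: tau_shift_sum_aP.
have t3 : tau (eu L ord_max (lmul ord Fs g) (u *+ p)) = p%:R * eu L ord_max (frob g) u.
  rewrite /eu rmorphM rmorph_int !coMn -mulrnBl -[X in X%:~R]mulr_natl intrM natz -pmulrn.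
  by rewrite mulrA.
have lin (a b c a' b' c' q : K) : tau a = q * a' -> tau b = q * b' -> tau c = q * c' ->
    tau (a + (b - c)) = q * (a' + (b' - c')).
  by rewrite rmorphD rmorphB /= => -> -> ->; ring.
exact: lin t3 t1 t2.
Qed.

(** * Reduction modulo the image of the connection *)

Opaque shift_sum lmul.

(** The condition that xi(u) tends to 0, in gamma-adic form. *)
Definition Tf f : Prop := forall m : nat, exists S0 : seq expo, forall u, u \notin S0 ->
  dvg (weight u + m) (f u).

(* Cz and, below, DC describe C0 and DC0 through divisibility of the coefficients: see C0_Cz and DC0_DC. *)
Definition Cz f : Prop := Bd f /\ Tf f.

Definition Gk (k : nat) f : Prop := forall u, dvg (weight u + k) (f u).

(* p^(w - d) divides the coefficient of gamma^w x^u, w = w(u) *)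
Definition hd (d w : int) : int := w + p.-1%:Z * Num.max 0 (w - d).

Definition Ld (d : int) f : Prop := forall u, dvg (hd d (weight u)) (f u).

Lemma Gk0 f : Gk 0 f <-> Bd f.
Proof. by split=> h u; have := h u; rewrite ?addr0. Qed.

Lemma Gk_Bd k f : Gk k f -> Bd f.
Proof. by move=> h u; apply: dvg_le (h u); lia. Qed.

Lemma GkD k f g : Gk k f -> Gk k g -> Gk k (fun u => f u + g u).
Proof. by move=> hf hg u; apply: dvgD. Qed.

Lemma GkZ k m c f : dvg k%:Z c -> Gk m f -> Gk (k + m) (fun u => c * f u).
Proof. by move=> hc hf u; apply: dvg_le (dvgM hc (hf u)); lia. Qed.

Lemma TfD f g : Tf f -> Tf g -> Tf (fun u => f u + g u).
Proof.
move=> hf hg m; have [S hS] := hf m; have [S' hS'] := hg m; exists (S ++ S') => u.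
by rewrite mem_cat negb_or => /andP[/hS h1 /hS' h2]; exact: dvgD.
Qed.

Lemma TfZ c f : dvg 0 c -> Tf f -> Tf (fun u => c * f u).
Proof. by move=> hc hf m; have [S hS] := hf m; exists S => u /hS; exact: dvgM0. Qed.

Lemma CzD f g : Cz f -> Cz g -> Cz (fun u => f u + g u).
Proof. by move=> [h1 h2] [h3 h4]; split; [exact: BdD|exact: TfD]. Qed.

Lemma CzZ c f : dvg 0 c -> Cz f -> Cz (fun u => c * f u).
Proof. by move=> hc [h1 h2]; split; [exact: BdZ|exact: TfZ]. Qed.

Lemma Cz0 : Cz (fun=> 0).
Proof. by split=> [u|m]; [exact: dvg0|exists [::] => u _; exact: dvg0]. Qed.

Lemma Cz_ext f g : f =1 g -> Cz f -> Cz g.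
Proof. by move=> /funext ->. Qed.

Lemma CzN f : Cz f -> Cz (fun u => - f u).
Proof.
move=> hf; apply: (@Cz_ext (fun u => (-1) * f u)); first by move=> u; rewrite mulN1r.
by apply: CzZ => //; rewrite dvgN dvg1.
Qed.

Lemma Cz_sum (I : Type) (r : seq I) (F : I -> laurent) :
  (forall i, Cz (F i)) -> Cz (fun u => \sum_(i <- r) F i u).
Proof.
move=> h; elim: r => [|i r IH].
  by apply: Cz_ext Cz0 => u; rewrite big_nil.
by apply: Cz_ext (CzD (h i) IH) => u; rewrite big_cons.
Qed.

Lemma Cz_fin f (S : seq expo) : Bd f -> (forall u, u \notin S -> f u = 0) -> Cz f.
Proof. by move=> hf hS; split=> // m; exists S => u /hS ->; exact: dvg0. Qed.

(** The extra gamma^m makes the terms with m >= N small for all u at once; the finitely many others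
    only translate the exceptional set of f. *)
Lemma Cz_shift_sum a i f : (forall m, dvg ((p ^ m)%N + m)%:Z (a m)) -> Cz f -> Cz (shift_sum a i f).
Proof.
move=> ha [hB hT].
have hSh : Sh a by move=> m; apply: dvg_le (ha m); lia.
split=> [|N]; first exact: Bd_shift_sum.
have [S hS] := hT N.
exists [seq u + ve i *+ (p ^ m) | m <- iota 0 N, u <- S] => u hu.
Transparent shift_sum. rewrite /shift_sum. Opaque shift_sum.
apply: dvg_infsum => m; have hw := weight_sub u i m.
have [mN|Nm] := ltnP m N; last by apply: dvg_le (dvgM (ha m) (hB _)); lia.
apply: dvg_le (dvgM (hSh m) (hS (u - ve i *+ (p ^ m)) _)); first by lia.
apply: contra hu => hu; apply/allpairsP; exists (m, u - ve i *+ (p ^ m)); split=> //=.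
  by rewrite mem_iota.
by rewrite subrK.
Qed.

Lemma aS_dvgm z m : dvg ((p ^ m)%N + m)%:Z (aS z m).
Proof.
apply: dvg_le (aS_dvg z m); have := ltp m; set q := (p ^ m)%N.
  have : (0 < p.-1)%N by have := prime_gt1 p_prime; case: (p) => [|[]].
by set p1 := p.-1; nia.
Qed.

Lemma Cz_Dg i k f : Cz f -> Cz (Dg i k f).
Proof.
have ha := aS_dvgm; move=> hf; apply: CzD; last by apply: CzD; [|apply: CzN]; exact: Cz_shift_sum.
case: hf => hB hT; split; first exact: Bd_eu.
by move=> m; have [S hS] := hT m; exists S => u /hS h; apply: dvgM0 => //; exact: dvg_int.
Qed.

Lemma LdD d f g : Ld d f -> Ld d g -> Ld d (fun u => f u + g u).
Proof. by move=> hf hg u; apply: dvgD. Qed.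

Lemma LdZ d c f : dvg 0 c -> Ld d f -> Ld d (fun u => c * f u).
Proof. by move=> hc hf u; apply: dvgM0. Qed.

Lemma hd_mono d d' w : d <= d' -> hd d' w <= hd d w.
Proof.
move=> h; rewrite /hd lerD2l ler_wpM2l //.
lia.
Qed.

Lemma Ld_mono d d' f : d <= d' -> Ld d f -> Ld d' f.
Proof. by move=> h hf u; apply: dvg_le (hf u); exact: hd_mono. Qed.

Definition tl i f : laurent :=
  fun u => infsum ord (fun m => aS i m.+1 * f (u - ve i *+ (p ^ m.+1))).

Lemma shift_sum_split i f u : Bd f -> shift_sum (aS i) i f u = gamma * lam i * f (u - ve i) + tl i f u.
Proof.
move=> hf; rewrite -[shift_sum _ _ _ _]/(infsum _ _) infsum_recl //; last exact: shift_sum_tends.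
by rewrite expn0 mulr1n /aS expr0 expn0 expr1 mul1r /gamma_ big_ord1 expn0 expr1 expr0 divr1.
Qed.

(** For m >= 1 the coefficient has at least one power of gamma, in fact (p-1)(p^m - 1), beyond
    gamma^(p^m). *)
Lemma tl_Gk i f : Bd f -> Gk 1 (tl i f).
Proof.
move=> hf u; apply: dvg_infsum => m; have hw := weight_sub u i m.+1.
apply: dvg_le (dvgM (aS_dvg i m.+1) (hf _)); move: hw.
have := ltp m.+1; set q := (p ^ m.+1)%N.
have : (0 < p.-1)%N by have := prime_gt1 p_prime; case: (p) => [|[]].
by set p1 := p.-1; nia.
Qed.

(** A shift by q = p^(m+1) raises the weight by at most q, while its coefficient has the surplus
    p^(q-1): only one unit of d is lost. *)
Lemma tl_Ld i d f : Ld d f -> Ld (d + 1) (tl i f).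
Proof.
move=> hf u; apply: dvg_infsum => m; have hw := weight_sub u i m.+1.
apply: dvg_le (dvgM (aS_dvg i m.+1) (hf _)); move: hw; rewrite /hd.
have := ltp m.+1; set q := (p ^ m.+1)%N; set w := weight u; set w' := weight _.
move=> hq hw; set p1 := p.-1.
have h : 0 <= p1%:Z * ((q%:Z - 1) + Num.max 0 (w' - d) - Num.max 0 (w - (d + 1))).
  by rewrite mulr_ge0 //; lia.
rewrite mulrBr mulrDr in h; lia.
Qed.

(** * Reduction of a single monomial *)

Definition monom v : laurent := fun u => (u == v)%:R * gamma ^ weight v.

Lemma monom_dvg v u : dvg (weight u) (monom v u).
Proof.
rewrite /monom; case: eqP => [->|_]; last by rewrite mul0r dvg0.
by rewrite mul1r dvg_gammaz.
Qed.

Lemma Bd_monom v : Bd (monom v). Proof. by move=> u; exact: monom_dvg. Qed.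

Lemma Cz_monom v : Cz (monom v).
Proof.
apply: (Cz_fin (S := [:: v])); first exact: Bd_monom.
by move=> u; rewrite inE /monom => /negbTE ->; rewrite mul0r.
Qed.

Lemma Ld_monom v : Ld (weight v) (monom v).
Proof.
move=> u; rewrite /monom; case: eqP => [->|_]; last by rewrite mul0r dvg0.
by rewrite mul1r /hd subrr maxxx mulr0 addr0 dvg_gammaz.
Qed.

Definition Dl (l : 'I_n) f : laurent := Dg (lift ord_max l) ord_max f.

Definition DC f : Prop := exists2 g : 'I_n -> laurent,
  forall l, Cz (g l) & f =1 (fun u => \sum_l Dl l (g l) u).

Lemma Dl0 l : Dl l (fun=> 0) =1 (fun=> 0). Proof. exact: Dg0. Qed.

Lemma DCD f g : DC f -> DC g -> DC (fun u => f u + g u).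
Proof.
move=> [a ha fa] [b hb gb]; exists (fun l u => a l u + b l u) => [l|u]; first exact: CzD.
rewrite fa gb -big_split; apply: eq_bigr => l _; symmetry; apply: DgD.
  by case: (ha l).
by case: (hb l).
Qed.

Lemma DCZ c f : dvg 0 c -> DC f -> DC (fun u => c * f u).
Proof.
move=> hc [a ha fa]; exists (fun l u => c * a l u) => [l|u]; first exact: CzZ.
rewrite fa mulr_sumr; apply: eq_bigr => l _; symmetry; apply: DgZ.
by case: (ha l).
Qed.

Lemma DC0' : DC (fun=> 0).
Proof.
exists (fun _ => fun=> 0) => [l|u]; first exact: Cz0.
by rewrite big1 // => l _; exact: Dl0.
Qed.

Lemma DC_ext f g : f =1 g -> DC f -> DC g. Proof. by move=> /funext ->. Qed.

Lemma DC_Cz f : DC f -> Cz f.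
Proof.
move=> [a ha fa]; apply: (@Cz_ext (fun u => \sum_l Dl l (a l) u)) => [u|]; first by rewrite fa.
by apply: Cz_sum => l; apply: Cz_Dg.
Qed.

Lemma DC_max i f : Cz f -> DC (Dg i ord_max f).
Proof.
move=> hf; have [l ->|->] := unliftP ord_max i; last first.
  by apply: DC_ext DC0' => u; rewrite Dg_diag.
exists (fun l' => if l' == l then f else (fun=> 0)) => [l'|u].
  by case: ifP => _ //; exact: Cz0.
rewrite (bigD1 l) //= eqxx [X in _ + X]big1 ?addr0 // => l' /negbTE ->; exact: Dl0.
Qed.

Lemma DC_Dg i k f : Cz f -> DC (Dg i k f).
Proof.
move=> hf; have h := DCD (DC_max i hf) (DCZ (c := -1) _ (DC_max k hf)).
apply: DC_ext (h _) => [u|]; last by rewrite dvgN dvg1.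
by rewrite [RHS]Dg_sub mulN1r.
Qed.

Definition corner_monom (i : 'I_n.+1) : laurent := monom (corner i).

(** The remainder is required both to be divisible by gamma and to lie in [Ld w]: the first makes
    the iteration converge, the second preserves the powers of p. *)
Definition reducible (w : int) f : Prop := exists c : 'I_n.+1 -> K, exists h r : laurent,
  [/\ forall i, dvg 0 (c i), forall i : 'I_n.+1, w < i%:Z -> c i = 0, DC h,
      Cz r /\ Gk 1 r & Ld w r /\ f =1 (fun u => \sum_i c i * corner_monom i u + h u + r u)].

Lemma reducibleD w f g : reducible w f -> reducible w g -> reducible w (fun u => f u + g u).
Proof.
move=> [c [h [r [c1 c2 hh [r1 r2] [r3 fE]]]]] [c' [h' [r' [c1' c2' hh' [r1' r2'] [r3' fE']]]]].
exists (fun i => c i + c' i), (fun u => h u + h' u), (fun u => r u + r' u); split.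
- by move=> i; exact: dvgD.
- by move=> i wi; rewrite c2 // c2' // addr0.
- exact: DCD.
- by split; [exact: CzD|exact: GkD].
- split=> [|u]; first exact: LdD.
  have -> : \sum_i (c i + c' i) * corner_monom i u = \sum_i c i * corner_monom i u + \sum_i c' i * corner_monom i u.
    by rewrite -big_split; apply: eq_bigr => i _; rewrite mulrDl.
  rewrite fE fE'; have alg (a b x a' b' y : K) : a + b + x + (a' + b' + y) =
    a + a' + (b + b') + (x + y) by ring.
  exact: alg.
Qed.

Lemma reducibleZ w x f : dvg 0 x -> reducible w f -> reducible w (fun u => x * f u).
Proof.
move=> hx [c [h [r [c1 c2 hh [r1 r2] [r3 fE]]]]].
exists (fun i => x * c i), (fun u => x * h u), (fun u => x * r u); split.
- by move=> i; exact: dvgM0.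
- by move=> i wi; rewrite c2 // mulr0.
- exact: DCZ.
- by split; [exact: CzZ|exact: (GkZ (k := 0) hx)].
- split=> [|u]; first exact: LdZ.
  rewrite fE !mulrDr mulr_sumr; congr (_ + _ + _); apply: eq_bigr => i _; exact: mulrA.
Qed.

Lemma reducible_mono w w' f : w <= w' -> reducible w f -> reducible w' f.
Proof.
move=> ww [c [h [r [c1 c2 hh r1 [r3 fE]]]]]; exists c, h, r; split=> //.
- by move=> i wi; apply: c2; lia.
- by split=> //; exact: Ld_mono r3.
Qed.

Lemma reducible_ext w f g : f =1 g -> reducible w f -> reducible w g. Proof. by move=> /funext ->. Qed.

Lemma Ld0 d : Ld d (fun=> 0). Proof. by move=> u; exact: dvg0. Qed.
Lemma Gk00 k : Gk k (fun=> 0). Proof. by move=> u; exact: dvg0. Qed.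

Lemma reducible_DC w f : DC f -> reducible w f.
Proof.
move=> hf; exists (fun=> 0), f, (fun=> 0); split=> //.
- by move=> i; exact: dvg0.
- by split; [exact: Cz0|exact: Gk00].
- split; first exact: Ld0.
  by move=> u; rewrite big1 ?add0r ?addr0 // => i _; rewrite mul0r.
Qed.

Lemma reducible_small w f : Cz f -> Gk 1 f -> Ld w f -> reducible w f.
Proof.
move=> h1 h2 h3; exists (fun=> 0), (fun=> 0), f; split=> //.
- by move=> i; exact: dvg0.
- exact: DC0'.
- by split=> // u; rewrite big1 ?add0r // => i _; rewrite mul0r.
Qed.

Lemma reducible_corner_monom (i : 'I_n.+1) : reducible i%:Z (corner_monom i).
Proof.
exists (fun j => (j == i)%:R), (fun=> 0), (fun=> 0); split.
- by move=> j; exact: dvg_nat.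
- by move=> j ij; case: eqP => // e1; move: ij; rewrite e1 ltxx.
- exact: DC0'.
- by split; [exact: Cz0|exact: Gk00].
- split; first exact: Ld0.
  move=> u; rewrite (bigD1 i) //= eqxx mul1r !addr0 big1 ?addr0 // => j /negbTE ->.
  by rewrite mul0r.
Qed.

Lemma monom_shift u i v : gamma * monom u (v - ve i) = (v == u + ve i)%:R * gamma ^ (weight u + 1).
Proof.
by rewrite /monom subr_eq mulrCA; congr (_ * _); rewrite (expfzDr (weight u) 1 gamma_neq0) expr1z mulrC.
Qed.

Lemma Dg_monom i k u v : Dg i k (monom u) v =
  (co u i - co u k)%:~R * monom u v
  + (lam i * ((v == u + ve i)%:R * gamma ^ (weight u + 1)) + tl i (monom u) v
  - (lam k * ((v == u + ve k)%:R * gamma ^ (weight u + 1)) + tl k (monom u) v)).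
Proof.
have h z : shift_sum (aS z) z (monom u) v =
    lam z * ((v == u + ve z)%:R * gamma ^ (weight u + 1)) + tl z (monom u) v.
  rewrite shift_sum_split; last exact: Bd_monom.
  by rewrite -monom_shift; congr (_ + _); rewrite mulrA [lam z * gamma]mulrC.
rewrite /Dg (h i) (h k); congr (_ + _).
by rewrite /eu /monom; case: eqP => [->|_] //; rewrite !mul0r !mulr0.
Qed.

(** If v is not a corner, choose i in excess, put u = v - v_i and apply D_i - D_k to the monomial u
    with k = kk v. Solving for the monomial v divides by [lam i] alone; monomial u has smaller
    weight, the term at u + v_k smaller rank or an extra gamma, and the tails are remainders. *)
Lemma red_monom v : reducible (weight v) (monom v).
Proof.
have [m] := ubnP (rk v); elim: m v => // m IH v; rewrite ltnS => rv.
have [vE|[i hi]] := corner_or v.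
  rewrite {2}vE {1}vE weight_corner; exact: reducible_corner_monom.
set k := kk v in hi *; pose u := v - ve i.
have [ku ik] := kk_subve n_gt0 hi; rewrite -/u -/k in ku ik.
have vu : v = u + ve i by rewrite subrK.
have uk : cc u k = 0 by rewrite -ku cc_kk.
have ki : k != i by rewrite eq_sym.
have wv : weight v = weight u + 1 by rewrite {1}vu (weight_addve uk ki).
have wu0 := weight_ge0 u.
have rku : (rk u < rk v)%N.
  by rewrite /rk ku -/k wv; move: wu0; case: (weight u) => // w _; rewrite -PoszD /= mulnDl; lia.
have hlam : forall z, dvg 0 (lam z) by move=> z; exact: dvg_lam.
have red_u : reducible (weight v) (monom u).
  by apply: (@reducible_mono (weight u)); [rewrite wv; lia|apply: IH; exact: leq_trans rku rv].
have red_k : reducible (weight v) (fun x : expo => (x == u + ve k)%:R * gamma ^ (weight u + 1)).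
  have := weightD u (ve k); have w1 := weight_ve n_gt0 k 1; rewrite mulr1n in w1; rewrite w1.
  rewrite le_eqVlt => /orP[/eqP we|wl].
    rewrite -we; rewrite wv -we; apply: IH; apply: leq_trans rv.
    have le : (k <= kk (u + ve k)%R)%N by rewrite -{1}ku; apply: kk_cofacial => //; rewrite we.
    have cck : cc (u + ve k) k = 1.
      have /weightD_cc -> : weight u + weight (ve k) <= weight (u + ve k) by rewrite we w1.
      by rewrite uk add0r -[ve k]mulr1n cc_ve // eqxx.
    have nk : kk (u + ve k) != k.
      by apply/eqP => e1; move: (cc_kk (u + ve k)); rewrite e1 cck.
    rewrite /rk -/k we wv ltn_add2l.
    have : (kk (u + ve k)%R != k :> nat) by rewrite val_eqE.
    have := leq_ord (kk (u + ve k)); lia.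
  (* The weight of u + v_k is at most that of u, so gamma^(w(u)+1) x^(u + v_k) is a multiple of
     gamma in C_0. *)
  have Bs : forall x : expo, dvg (weight u + 1) ((x == u + ve k)%:R * gamma ^ (weight u + 1)).
    by move=> x; apply: dvgM0; [exact: dvg_nat|exact: dvg_gammaz].
  have out : forall x : expo, x != u + ve k -> (x == u + ve k)%:R * gamma ^ (weight u + 1) = 0.
    by move=> x /negbTE ->; rewrite mul0r.
  have G1 : Gk 1 (fun x : expo => (x == u + ve k)%:R * gamma ^ (weight u + 1)).
    move=> x; have [->|_] := eqVneq x (u + ve k); last by rewrite mul0r dvg0.
    by rewrite mul1r; apply: dvg_le (dvg_gammaz _); lia.
  apply: reducible_small => //.
  - apply: (Cz_fin (S := [:: u + ve k])); first exact: Gk_Bd G1.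
    by move=> x; rewrite inE; exact: out.
  - move=> x; have [->|_] := eqVneq x (u + ve k); last by rewrite mul0r dvg0.
    rewrite mul1r; apply: dvg_le (dvg_gammaz _).
    rewrite /hd wv (_ : Num.max _ _ = 0) ?mulr0 ?addr0; first by lia.
    lia.
have Cu := Cz_monom u; have Bu := Bd_monom u.
have red_tl z : reducible (weight v) (tl z (monom u)).
  apply: reducible_small; last by rewrite wv; apply: tl_Ld; exact: Ld_monom.
    have h : Cz (fun x : expo => shift_sum (aS z) z (monom u) x - lam z * (gamma * monom u (x - ve z))).
      apply: CzD; first by apply: Cz_shift_sum => //; exact: aS_dvgm.
      apply: CzN; apply: CzZ => //; apply: (Cz_fin (S := [:: u + ve z])).
        move=> x; rewrite monom_shift; case: eqP => [->|_]; last by rewrite mul0r dvg0.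
        rewrite mul1r; apply: dvg_le (dvg_gammaz _).
        by have := weightD u (ve z); have := weight_ve n_gt0 z 1; rewrite mulr1n => ->.
      by move=> x; rewrite inE monom_shift => /negbTE ->; rewrite mul0r.
    apply: Cz_ext h => x; rewrite shift_sum_split // mulrA [lam z * _]mulrC addrAC subrr add0r //.
  exact: tl_Gk.
have hD := reducible_DC (weight v) (DC_Dg i k Cu).
pose c := (co u i - co u k)%:~R : K.
have hsum : reducible (weight v) (fun x : expo => Dg i k (monom u) x + ((- c) * monom u x + ((-1) * tl i (monom u) x +
    (lam k * ((x == u + ve k)%:R * gamma ^ (weight u + 1)) + tl k (monom u) x)))).
  apply: reducibleD => //; apply: reducibleD; first by apply: reducibleZ => //; rewrite dvgN dvg_int.
  apply: reducibleD; first by apply: reducibleZ => //; rewrite dvgN dvg1.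
  by apply: reducibleD => //; apply: reducibleZ.
apply: reducible_ext (reducibleZ (dvg_lamV i) hsum) => x; rewrite Dg_monom.
have -> : monom v x = (x == u + ve i)%:R * gamma ^ (weight u + 1) by rewrite /monom -vu wv.
have alg (c' y L a' t1 q t2 : K) : L != 0 ->
    L^-1 * (c' * y + (L * a' + t1 - (q + t2)) + (- c' * y + (-1 * t1 + (q + t2)))) = a'.
  by move=> L0; rewrite -[RHS](mulKf L0); congr (_ * _); ring.
exact: (alg _ _ _ _ _ _ _ (lam_neq0 i)).
Qed.

(** * Reduction of a series by successive approximation *)

Lemma dvg_divgz N M x : dvg N (x / gamma ^ M) = dvg (N + M) x.
Proof.
have := dvg_mulgz (N + M) M (x / gamma ^ M).
by rewrite divfK ?gammaz_neq0 // addrK.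
Qed.

Lemma infsum_sum (I : eqType) (J : Type) (r : seq J) (s : J -> I -> K) :
  (forall j, tends_to_0 ord (s j)) ->
  tends_to_0 ord (fun i => \sum_(j <- r) s j i) /\
  infsum ord (fun i => \sum_(j <- r) s j i) = \sum_(j <- r) infsum ord (s j).
Proof.
move=> h; elim: r => [|j r [IH1 IH2]].
  have e0 : (fun i : I => \sum_(j <- [::]) s j i) = (fun=> 0) by apply: funext => i; rewrite big_nil.
  rewrite e0 big_nil; split; first by apply: (@tends_to_0_fin _ _ ord_val _ _ [::]).
  exact: infsum0.
have e0 : (fun i : I => \sum_(j' <- j :: r) s j' i) = (fun i => s j i + \sum_(j' <- r) s j' i).
  by apply: funext => i; rewrite big_cons.
rewrite e0 big_cons; split; first exact: tends_to_0D.
by rewrite infsumD // IH2.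
Qed.

Lemma tends_nat (s : nat -> K) : (forall m : nat, dvg m (s m)) -> tends_to_0 ord s.
Proof.
move=> h; apply: tends_dvg => N; exists (iota 0 N) => m.
rewrite mem_iota /= add0n -leqNgt => Nm; apply: dvg_le (h m); by rewrite lez_nat.
Qed.

Lemma telescope (s : nat -> K) : (forall m : nat, dvg m (s m)) ->
  infsum ord (fun m => s m - s m.+1) = s 0%N.
Proof.
move=> h; have ht (m : nat) : dvg m (s m - s m.+1).
  by apply: dvgB => //; apply: dvg_le (h m.+1); rewrite lez_nat.
apply/subr0_eq; apply: dvg_eq0 => N.
have h1 : vge (N%:Z%:~R * e) (infsum ord (fun m => s m - s m.+1) - \sum_(m <- iota 0 N) (s m - s m.+1)).
  apply: infsum_approx => //; [exact: tends_nat|exact: iota_uniq|].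
  move=> m; rewrite mem_iota /= add0n -leqNgt => Nm; apply: (dvg_le _ (ht m)).
  by rewrite lez_nat.
have h2 : \sum_(m <- iota 0 N) (s m - s m.+1) = s 0%N - s N.
  elim: N {h1} => [|N IH]; first by rewrite big_nil subrr.
  have -> : iota 0 N.+1 = iota 0 N ++ [:: N] by rewrite -addn1 iotaD add0n.
    by rewrite big_cat IH big_seq1 /= addrA subrK.
rewrite h2 in h1; rewrite -[X in X - _](subrK (s 0%N - s N)) -addrA dvgD //.
by rewrite addrAC subrr add0r dvgN.
Qed.

Lemma Dg_infsum i k (G : nat -> laurent) : (forall m, Gk m (G m)) ->
  Dg i k (fun u => infsum ord (fun m => G m u)) =1 (fun u => infsum ord (fun m => Dg i k (G m) u)).
Proof.
move=> hG u; have hB m := Gk_Bd (hG m).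
have hT v : tends_to_0 ord (fun m => G m v).
  by apply: tends_nat => m; apply: dvg_le (hG m v); have := weight_ge0 v; lia.
have hs z : tends2 ord (fun q m => aS z q * G m (u - ve z *+ p ^ q)).
  apply: tends2_dvg => N; exists (iota 0 N), (iota 0 N) => q m.
  rewrite !mem_iota /= !add0n -!leqNgt => h.
  apply: dvg_le (dvgM (Sh_aS z q) (hG m (u - ve z *+ p ^ q))).
  have := weight_ge0 (u - ve z *+ p ^ q); have := ltp q; lia.
have hshop z : shift_sum (aS z) z (fun v => infsum ord (fun m => G m v)) u =
    infsum ord (fun m => shift_sum (aS z) z (G m) u).
  rewrite -[LHS]/(infsum ord _).
  transitivity (infsum ord (fun q => infsum ord (fun m => aS z q * G m (u - ve z *+ p ^ q)))).
    by apply: eq_infsum => q; rewrite infsumZ //; exact: hT.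
  by rewrite infsum_exchange.
have ts z : tends_to_0 ord (fun m => shift_sum (aS z) z (G m) u).
  exact: tends2_inf (tends2_sym (hs z)).
have te : tends_to_0 ord (fun m => eu i k (G m) u) by apply: tends_to_0Z.
rewrite /Dg !hshop infsumD //; last by apply: tends_to_0D => //; exact: tends_to_0N.
by rewrite infsumB // infsumZ.
Qed.

(** Only finitely many terms are not yet divisible by gamma^(k+1), and [red_monom] applies to each.
    A monomial of weight w has coefficient divisible by p^(w-d) and meets only corners i <= w, which
    gives the bound on c_i. *)
Lemma red_step (k : nat) f : Cz f -> Gk k f ->
  exists c : 'I_n.+1 -> K, exists g : 'I_n -> laurent, exists f' : laurent,
  [/\ forall i, dvg k (c i), forall l, Cz (g l) /\ Gk k (g l), Cz f' /\ Gk k.+1 f',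
      forall d, Ld d f -> Ld d f' /\ forall i : 'I_n.+1, dvg (p.-1%:Z * Num.max 0 (i%:Z - d)) (c i) &
      f =1 (fun u => \sum_i c i * corner_monom i u + \sum_l Dl l (g l) u + f' u)].
Proof.
move=> [hB hT] hk.
have [S hS] := hT k.+1; pose S0 := undup S; have uS : uniq S0 by exact: undup_uniq.
have [R hR] : exists R : expo -> ('I_n.+1 -> K) * ('I_n -> laurent) * laurent, forall v,
    [/\ forall i, dvg 0 ((R v).1.1 i), forall i : 'I_n.+1, weight v < i%:Z -> (R v).1.1 i = 0,
      forall l, Cz ((R v).1.2 l), Cz (R v).2 /\ Gk 1 (R v).2 & Ld (weight v) (R v).2 /\
      monom v =1 (fun u => \sum_i (R v).1.1 i * corner_monom i u + \sum_l Dl l ((R v).1.2 l) u + (R v).2 u)].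
  apply: (@ex_choice _ _ (fun v (R : ('I_n.+1 -> K) * ('I_n -> laurent) * laurent) =>
    [/\ forall i, dvg 0 (R.1.1 i), forall i : 'I_n.+1, weight v < i%:Z -> R.1.1 i = 0,
      forall l, Cz (R.1.2 l), Cz R.2 /\ Gk 1 R.2 & Ld (weight v) R.2 /\
      monom v =1 (fun u => \sum_i R.1.1 i * corner_monom i u + \sum_l Dl l (R.1.2 l) u + R.2 u)])) => v.
  have [c [h [r [h1 h2 [g hg hE] h3 [h4 h5]]]]] := red_monom v.
  exists (c, g, r); split=> //; split=> // u; by rewrite h5 hE.
pose a v := f v / gamma ^ weight v.
have aE v : a v * gamma ^ weight v = f v by rewrite divfK // gammaz_neq0.
have ak v : dvg k (a v) by rewrite dvg_divgz addrC; exact: hk.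
have a0 v : dvg 0 (a v) by apply: dvg_le (ak v).
have ad d v : Ld d f -> dvg (p.-1%:Z * Num.max 0 (weight v - d)) (a v).
  by move=> hL; rewrite dvg_divgz addrC; exact: hL.
exists (fun i => \sum_(v <- S0) a v * (R v).1.1 i), (fun l u => \sum_(v <- S0) a v * (R v).1.2 l u),
  (fun u => (if u \in S0 then 0 else f u) + \sum_(v <- S0) a v * (R v).2 u).
have kk1 (F : expo -> laurent) : (forall v, Bd (F v)) -> Gk k (fun u => \sum_(v <- S0) a v * F v u).
  move=> hF u; apply: dvg_sum => v _; apply: dvg_le (dvgM (ak v) (hF v u)); lia.
split.
- by move=> i; apply: dvg_sum => v _; have [h1 _ _ _ _] := hR v; apply: dvgM0r.
- move=> l; split.
    by apply: Cz_sum => v; have [_ _ h3 _ _] := hR v; apply: CzZ.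
  by apply: kk1 => v; have [_ _ h3 _ _] := hR v; case: (h3 l).
- split.
    apply: CzD; last by apply: Cz_sum => v; have [_ _ _ [h3 _] _] := hR v; apply: CzZ.
    split=> [u|m]; first by case: ifP => _ //; exact: dvg0.
    by have [S' hS'] := hT m; exists S' => u /hS' h; case: ifP => _ //; exact: dvg0.
  apply: GkD => [u|u].
    case: ifP => [_|/negbT h]; first exact: dvg0.
    by apply: hS; rewrite mem_undup in h.
  apply: dvg_sum => v _; have [_ _ _ [_ h3] _] := hR v.
  by apply: dvg_le (dvgM (ak v) (h3 u)); lia.
- move=> d hL; split=> [|i].
    apply: LdD => [u|u]; first by case: ifP => _ //; exact: dvg0.
    apply: dvg_sum => v _; have [_ _ _ _ [h4 _]] := hR v.
    (* Subadditivity of max(0, .) applied to w - d = (w' - d) + (w - w'). *)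
    apply: dvg_le (dvgM (ad d v hL) (h4 u)); rewrite /hd; set w := weight u; set w' := weight v.
    set p1 := p.-1; have h : 0 <= p1%:Z * (Num.max 0 (w' - d) + Num.max 0 (w - w') - Num.max 0 (w - d)).
      by rewrite mulr_ge0 //; lia.
    rewrite mulrBr mulrDr in h; lia.
  apply: dvg_sum => v _; have [h1 h2 _ _ _] := hR v.
  have [wi|iw] := ltP (weight v) i%:Z; first by rewrite h2 // mulr0 dvg0.
  apply: dvgM0r => //; apply: dvg_le (ad d v hL); rewrite ler_wpM2l //; lia.
- move=> u.
  have e1 : f u = (if u \in S0 then 0 else f u) + \sum_(v <- S0) a v * monom v u.
    case: ifP => [uS0|/negbT uS0].
      rewrite (bigD1_seq u) //= /monom eqxx mul1r aE add0r big1 ?addr0 // => v vu.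
      by rewrite eq_sym (negbTE vu) mul0r mulr0.
    rewrite big_seq big1 ?addr0 // => v vS; rewrite /monom; case: eqP => [e1|_]; last by rewrite mul0r mulr0.
    by rewrite e1 vS in uS0.
  rewrite [LHS]e1 {e1}.
  have e2 : \sum_(v <- S0) a v * monom v u = \sum_i (\sum_(v <- S0) a v * (R v).1.1 i) * corner_monom i u
      + \sum_l Dl l (fun u => \sum_(v <- S0) a v * (R v).1.2 l u) u + \sum_(v <- S0) a v * (R v).2 u.
    have e3 : \sum_i (\sum_(v <- S0) a v * (R v).1.1 i) * corner_monom i u =
        \sum_(v <- S0) a v * \sum_i (R v).1.1 i * corner_monom i u.
      rewrite (eq_bigr (fun i => \sum_(v <- S0) a v * ((R v).1.1 i * corner_monom i u))) => [|i _].
        by rewrite exchange_big; apply: eq_bigr => v _; rewrite mulr_sumr.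
      by rewrite mulr_suml; apply: eq_bigr => v _; rewrite mulrA.
    have e4 : \sum_l Dl l (fun u => \sum_(v <- S0) a v * (R v).1.2 l u) u =
        \sum_(v <- S0) a v * \sum_l Dl l ((R v).1.2 l) u.
      rewrite (eq_bigr (fun l => \sum_(v <- S0) a v * Dl l ((R v).1.2 l) u)) => [|l _].
        by rewrite exchange_big; apply: eq_bigr => v _; rewrite mulr_sumr.
      by apply: Dg_sum => // v; have [_ _ h3 _ _] := hR v; case: (h3 l).
    rewrite e3 e4 -!big_split; apply: eq_bigr => v _.
    by have [_ _ _ _ [_ ->]] := hR v; rewrite !mulrDr.
  rewrite e2; have alg (x y z t : K) : x + (y + z + t) = y + z + (x + t) by ring.
  exact: alg.
Qed.

(** Summing the corrections of all the steps. One decomposition serves every d, so a bound valid for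
    f passes to its coefficients without a new choice. *)
Lemma red_main f : Cz f ->
  exists c : 'I_n.+1 -> K, exists2 h : laurent,
  (forall d, Ld d f -> forall i : 'I_n.+1, dvg (p.-1%:Z * Num.max 0 (i%:Z - d)) (c i)) /\ DC h &
  f =1 (fun u => \sum_i c i * corner_monom i u + h u).
Proof.
move=> hf.
pose P (kf : nat * laurent) := Cz kf.2 /\ Gk kf.1 kf.2.
pose T : Type := ('I_n.+1 -> K) * ('I_n -> laurent) * laurent.
pose Q (kf : nat * laurent) (R : T) := P kf ->
  [/\ forall i, dvg kf.1 (R.1.1 i), forall l, Cz (R.1.2 l) /\ Gk kf.1 (R.1.2 l), P (kf.1.+1, R.2),
      forall d, Ld d kf.2 -> Ld d R.2 /\ forall i : 'I_n.+1, dvg (p.-1%:Z * Num.max 0 (i%:Z - d)) (R.1.1 i) &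
      kf.2 =1 (fun u => \sum_i R.1.1 i * corner_monom i u + \sum_l Dl l (R.1.2 l) u + R.2 u)].
(* The step is made total, with dummy values where P fails, so that a single choice function can be
   iterated. *)
have [st hst] : exists st : nat * laurent -> T, forall kf, Q kf (st kf).
  apply: ex_choice => -[k h]; have [Ph|nP] := pselect (P (k, h)).
    case: Ph => /= h1 h2; have [c [g [f' [a1 a2 a3 a4 a5]]]] := red_step h1 h2.
    by exists (c, g, f') => _; split.
  by exists (fun=> 0, fun=> fun=> 0, fun=> 0) => Ph.
pose fix F (k : nat) : laurent := if k is k'.+1 then (st (k', F k')).2 else f.
have PF k : P (k, F k).
  elim: k => [|k IH]; first by split=> //=; apply/Gk0; case: hf.
  by have [] := hst _ IH.
pose ck (k : nat) := (st (k, F k)).1.1; pose gg (k : nat) := (st (k, F k)).1.2.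
have L d : Ld d f -> forall k, Ld d (F k).
  by move=> hL; elim=> [//|k IH]; have [_ _ _ h _] := hst _ (PF k); case: (h d IH).
have H (k : nat) : [/\ forall i, dvg k (ck k i),
      forall l, Cz (gg k l) /\ Gk k (gg k l) &
      forall u, F k u - F k.+1 u = \sum_i ck k i * corner_monom i u + \sum_l Dl l (gg k l) u].
  have [h1 h2 _ _ h3] := hst _ (PF k); split=> // u.
  by rewrite [X in X - _]h3 /= addrK.
have tc i : tends_to_0 ord (fun k : nat => ck k i).
  by apply: tends_nat => k; have [h1 _ _] := H k; exact: h1.
have Gg l (k : nat) : Gk k (gg k l) by have [_ h _] := H k; case: (h l).
exists (fun i => infsum ord (fun k : nat => ck k i)).
exists (fun u => \sum_l Dl l (fun u => infsum ord (fun k => gg k l u)) u); [split|].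
- move=> d hL i; apply: dvg_infsum => k; have [_ _ _ h _] := hst _ (PF k).
  by case: (h d (L d hL k)).
- exists (fun l u => infsum ord (fun k => gg k l u)) => // l; split=> [u|N].
    by apply: dvg_infsum => k; exact: (Gk_Bd (Gg l k)).
  have [S hS] : exists S : nat -> seq expo, forall k u, u \notin S k -> dvg (weight u + N) (gg k l u).
    apply: (@ex_choice _ _ (fun k S => forall u, u \notin S -> dvg (weight u + N) (gg k l u))) => k.
    by have [_ h _] := H k; case: (h l) => -[_ /(_ N)[S hS] _]; exists S.
  exists (flatten [seq S k | k <- iota 0 N]) => u hu; apply: dvg_infsum => k.
  have [kN|Nk] := ltnP k N; last by apply: dvg_le (Gg l k u); lia.
  apply: hS; apply: contra hu => hu; apply/flattenP; exists (S k) => //.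
  by apply: map_f; rewrite mem_iota.
- move=> u.
  have hF (m : nat) : dvg m (F m u).
    have [_ h] := PF m; apply: dvg_le (h u); have := weight_ge0 u; rewrite /=; lia.
  rewrite -[LHS](telescope (s := fun k => F k u) hF).
  have tD l : tends_to_0 ord (fun k => Dl l (gg k l) u).
    apply: tends_nat => k; have : Gk k (Dl l (gg k l)); last first.
      by move=> h; apply: dvg_le (h u); have := weight_ge0 u; lia.
    move=> v; rewrite /Dl.
    (* By linearity gamma^k is pulled out of D_l, and [Bd_Dg] applies to the quotient. *)
    have hg : Bd (fun v => gamma ^ (- k%:Z) * gg k l v).
      move=> z; rewrite mulrC dvg_mulgz opprK; exact: Gg.
    have : Dl l (fun v => gamma ^ k%:Z * (gamma ^ (- k%:Z) * gg k l v)) v =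
       gamma ^ k%:Z * Dl l (fun v => gamma ^ (- k%:Z) * gg k l v) v by exact: DgZ.
    have -> : (fun v => gamma ^ k%:Z * (gamma ^ (- k%:Z) * gg k l v)) = gg k l.
      by apply: funext => z; rewrite mulrA -(expfzDr k%:Z (- k%:Z) gamma_neq0) subrr expr0z mul1r.
    rewrite /Dl => ->; rewrite mulrC dvg_mulgz addrK; exact: Bd_Dg.
  have -> : infsum ord (fun k => F k u - F k.+1 u) =
      infsum ord (fun k => \sum_i ck k i * corner_monom i u + \sum_l Dl l (gg k l) u).
    by apply: eq_infsum => k; have [_ _ h] := H k; exact: h.
  have tce i : tends_to_0 ord (fun k => ck k i * corner_monom i u).
    by under eq_fun do rewrite mulrC; apply: tends_to_0Z.
  have [t1 e1] := infsum_sum (index_enum 'I_n.+1) tce.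
  have [t2 e2] := infsum_sum (index_enum 'I_n) tD.
  rewrite infsumD // e1 e2; congr (_ + _); apply: eq_bigr => i _.
    by rewrite [RHS]mulrC -infsumZ //; apply: eq_infsum => k; exact: mulrC.
  by symmetry; apply: Dg_infsum => k; exact: Gg.
Qed.

(** * Independence of the corner monomials *)

(* f = unit * gamma^w(u) x^u modulo gamma and terms of smaller rank *)
Definition Lead u f : Prop := Cz f /\ exists L : K,
  [/\ L != 0, dvg 0 L^-1, dvg (weight u + 1) (f u - L * gamma ^ weight u) &
      forall v, v != u -> (rk u <= rk v)%N -> dvg (weight v + 1) (f v)].

Lemma ve_inj i k : ve i = ve k :> expo -> i = k.
Proof.
move=> h; apply/eqP; have := cc_ve n_gt0 i 1 i; rewrite h cc_ve // eqxx !mulr1n.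
by case: eqP => // _ /eqP; rewrite eq_sym oner_eq0.
Qed.

(** Multiplication by gamma x^(v_j) without weight loss raises the rank by at most n + 1, so a term
    in the top rank at v other than u + v_i could only come from u + v_k, excluded by [rk_addkk].
    The Euler term stays below this rank and the tails are divisible by gamma. *)
Lemma Lead_step u f i : i != kk u -> Lead u f -> Lead (u + ve i) (Dg i (kk u) f).
Proof.
set k := kk u => ik [fC [L [L0 LV fu fv]]]; split; first exact: Cz_Dg.
have [fB _] := fC; have ki : k != i by rewrite eq_sym.
have wu : weight (u + ve i) = weight u + 1 by rewrite (weight_addve (cc_kk u)).
have ru := rk_addve n_gt0 ik.
exists (lam i * L).
have DgE v : Dg i k f v = (co v i - co v k)%:~R * f v
    + (lam i * (gamma * f (v - ve i)) + tl i f v - (lam k * (gamma * f (v - ve k)) + tl k f v)).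
  rewrite /Dg !shift_sum_split // /eu; have alg (g l x : K) : g * l * x = l * (g * x) by ring.
  by rewrite !alg.
have dg N x : dvg N x -> dvg (N + 1) (gamma * x).
  by move=> h; rewrite addrC; apply: dvgM => //; exact: (dvg_gammaz 1).
have small v j : (rk u + n.+1 <= rk v)%N -> v - ve j != u -> dvg (weight v + 1) (gamma * f (v - ve j)).
  move=> rv vj; have := weight_sub v j 0; rewrite expn0 mulr1n addrC => wv.
  have [wle|wlt] := leP (weight v) (weight (v - ve j)).
    by apply: dvg_le (dg _ _ (fB _)); rewrite lerD2r.
  have we : weight v = weight (v - ve j) + 1.
    by apply/eqP; rewrite eq_le wv -ltzD1 ltrD2r wlt.
  have r1 := rk_sub n_gt0 we; rewrite we; apply: (dg (weight (v - ve j) + 1)).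
  by apply: fv => //; rewrite -(leq_add2r n.+1) (leq_trans rv r1).
have small_lam v j : (rk u + n.+1 <= rk v)%N -> v - ve j != u ->
    dvg (weight v + 1) (lam j * (gamma * f (v - ve j))).
  by move=> h1 h2; apply: dvgM0; [exact: dvg_lam|exact: small].
have small_f v : (rk u + n.+1 <= rk v)%N -> dvg (weight v + 1) ((co v i - co v k)%:~R * f v).
  move=> h; apply: dvgM0; first exact: dvg_int.
  apply: fv; last by apply: leq_trans h; exact: leq_addr.
  by apply/eqP => e1; move: h; rewrite e1 addnS ltnNge leq_addr.
have small_tl v j : dvg (weight v + 1) (tl j f v) by exact: tl_Gk.
split.
- by rewrite mulf_neq0 // lam_neq0.
- by rewrite invfM; apply: dvgM0 => //; exact: dvg_lamV.
- have hk : u + ve i - ve k != u.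
    by rewrite subr_eq; apply/eqP => /addrI/ve_inj e1; rewrite e1 eqxx in ik.
  have h1 := small_f (u + ve i); have h2 := small_lam (u + ve i) k.
  rewrite ru leqnn in h1 h2; have {h1}h1 := h1 isT; have {h2}h2 := h2 isT hk.
  rewrite DgE addrK.
  have -> : lam i * L * gamma ^ weight (u + ve i) = lam i * (gamma * (L * gamma ^ weight u)).
    rewrite wu (expfzDr (weight u) 1 gamma_neq0) expr1z.
    have alg (l x g w : K) : l * x * (w * g) = l * (g * (x * w)) by ring.
    exact: alg.
  have h3 : dvg (weight (u + ve i) + 1) (lam i * (gamma * (f u - L * gamma ^ weight u))).
    by apply: dvgM0; [exact: dvg_lam|rewrite wu; exact: dg].
  have alg (x l g fu' w t1 q t2 : K) : x + (l * (g * fu') + t1 - (q + t2)) - l * (g * w) =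
     x + l * (g * (fu' - w)) + t1 - q - t2 by ring.
  by rewrite alg; do 2![apply: dvgB => //]; do 2![apply: dvgD => //].
- move=> v vu; rewrite ru => rv; rewrite DgE.
  have hi : v - ve i != u by rewrite subr_eq.
  have hk : v - ve k != u.
    rewrite subr_eq; apply/eqP => e1; rewrite e1 in rv.
    by have := leq_ltn_trans rv (rk_addkk n_gt0 u); rewrite ltnn.
  by apply: dvgD; [exact: small_f|apply: dvgB; apply: dvgD => //; exact: small_lam].
Qed.

Lemma Lead_corner_monom k : Lead (corner k) (corner_monom k).
Proof.
split; first exact: Cz_monom.
exists 1; rewrite oner_neq0 invr1 dvg1; split=> // [|v vk _].
  by rewrite /corner_monom /monom eqxx subrr dvg0.
by rewrite /corner_monom /monom (negbTE vk) mul0r dvg0.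
Qed.

(* For k = kk u, the coordinates of u are at least those of corner k; applying D_i - D_k once for each unit of
   excess in direction i turns corner_monom k into a series with leading term x^u. *)
Definition mexp u (i : 'I_n.+1) : nat := (`|cc u i| - (i < kk u))%N.

Definition Bs u (m : 'I_n.+1 -> nat) (s : seq 'I_n.+1) : laurent :=
  foldr (fun i f => iter (m i) (Dg i (kk u)) f) (corner_monom (kk u)) s.

Definition Bu u : laurent := Bs u (mexp u) (enum 'I_n.+1).

Lemma Cz_iter i k m f : Cz f -> Cz (iter m (Dg i k) f).
Proof. by move=> hf; elim: m => //= m; exact: Cz_Dg. Qed.

Lemma Cz_Bs u m s : Cz (Bs u m s).
Proof. by elim: s => [|i s IH] /=; [exact: Cz_monom|exact: Cz_iter]. Qed.

Lemma Cz_Bu u : Cz (Bu u). Proof. exact: Cz_Bs. Qed.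

Lemma iter_Dg_comm i j k m f : Cz f -> iter m (Dg j k) (Dg i k f) = Dg i k (iter m (Dg j k) f).
Proof.
move=> hf; elim: m => //= m ->; apply: funext => u; apply: Dg_comm.
by case: (Cz_iter j k m hf).
Qed.

Lemma Bs_step u (m m' : 'I_n.+1 -> nat) i s : uniq s ->
  (forall j, j != i -> m' j = m j) -> m' i = (m i).+1 ->
  Bs u m' s = if i \in s then Dg i (kk u) (Bs u m s) else Bs u m s.
Proof.
move=> us h1 h2; elim: s us => //= j s IH /andP[js us]; rewrite inE IH //.
have [ij|ij] := eqVneq i j; first by rewrite -ij (negbTE (_ : i \notin s)) ?ij //= -ij h2.
rewrite /= h1; last by rewrite eq_sym.
by case: ifP => // _; apply: iter_Dg_comm; exact: Cz_Bs.
Qed.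

(** Adding v_i with i different from kk u keeps the base corner and raises a single multiplicity by
    1; the operators commute, so the extra one can be moved to the front. *)
Lemma Bu_step u i : i != kk u -> Bu (u + ve i) = Dg i (kk u) (Bu u).
Proof.
move=> ik; have ki : kk u != i by rewrite eq_sym.
have kE := kk_addve n_gt0 ik; have cE := cc_addve (cc_kk u) ki.
have -> : Bu (u + ve i) = Bs u (mexp (u + ve i)) (enum 'I_n.+1) by rewrite /Bu /Bs kE.
rewrite (@Bs_step u (mexp u) _ i) ?enum_uniq ?mem_enum //.
  by move=> j /negbTE ji; rewrite /mexp kE cE ji addr0.
rewrite /mexp kE cE eqxx; have := cc_ge_lt u i; have := cc_ge0 u i; clear.
case: (cc u i) => // c _; case: (_ < _)%N.
  by rewrite -[true%:R]/(1%N%:Z) lez_nat -PoszD /= => h; lia.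
by move=> _; rewrite -[true%:R]/(1%N%:Z) -PoszD /= !subn0 addn1.
Qed.

Lemma Bu_corner k : Bu (corner k) = corner_monom k.
Proof.
have kE := kk_corner k; rewrite /Bu /Bs kE.
elim: (enum _) => //= i s ->.
by rewrite /mexp kE cc_corner; case: (_ < _)%N.
Qed.

Lemma not_corner_split v : v != corner (kk v) -> exists u, exists i,
  [/\ i != kk u, v = u + ve i & (rk u < rk v)%N].
Proof.
move=> /eqP nv; have [//|[i hi]] := corner_or v.
have [ku ik] := kk_subve n_gt0 hi; exists (v - ve i), i.
rewrite ku subrK; split=> //.
have ik' : i != kk (v - ve i) by rewrite ku.
by have := rk_addve n_gt0 ik'; rewrite subrK => ->; lia.
Qed.

Lemma Lead_Bu v : Lead v (Bu v).
Proof.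
have [m] := ubnP (rk v); elim: m v => // m IH v; rewrite ltnS => rv.
have [->|/not_corner_split[u [i [ik vE ru]]]] := eqVneq v (corner (kk v)).
  by rewrite Bu_corner; exact: Lead_corner_monom.
by rewrite vE Bu_step //; apply: Lead_step => //; apply: IH; exact: leq_trans ru rv.
Qed.

Lemma DC_Bu v : v != corner (kk v) -> DC (Bu v).
Proof.
by move=> /not_corner_split[u [i [ik -> _]]]; rewrite Bu_step //; apply: DC_Dg; exact: Cz_Bu.
Qed.

Lemma add_not_corner u i : i != kk u -> u + ve i != corner (kk (u + ve i)).
Proof.
move=> ik; have ki : kk u != i by rewrite eq_sym.
apply: (not_corner (i := i)); rewrite kk_addve // (cc_addve (cc_kk u) ki) eqxx.
by have := cc_ge_lt u i; rewrite -ltzD1.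
Qed.

(** * The series [Bu v] as a basis modulo gamma *)

Definition lc (s : seq (K * expo)) : laurent := fun u => \sum_(x <- s) x.1 * Bu x.2 u.

Lemma lc_cat s t u : lc (s ++ t) u = lc s u + lc t u.
Proof. by rewrite /lc big_cat. Qed.

Lemma lcZ c s u : lc [seq (c * x.1, x.2) | x <- s] u = c * lc s u.
Proof. by rewrite /lc big_map mulr_sumr; apply: eq_bigr => x _; rewrite mulrA. Qed.

Definition dvs (s : seq (K * expo)) : Prop := forall x, x \in s -> dvg 0 x.1.

Definition spanned f : Prop := exists s : seq (K * expo), exists r : laurent,
  [/\ dvs s, Cz r /\ Gk 1 r & f =1 (fun u => lc s u + r u)].

Lemma dvs_cat s t : dvs s -> dvs t -> dvs (s ++ t).
Proof. by move=> hs ht x; rewrite mem_cat => /orP[/hs|/ht]. Qed.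

Lemma spannedD f g : spanned f -> spanned g -> spanned (fun u => f u + g u).
Proof.
move=> [s [r [h1 [h2 h3] h4]]] [s' [r' [h1' [h2' h3'] h4']]].
exists (s ++ s'), (fun u => r u + r' u); split; first exact: dvs_cat.
  by split; [exact: CzD|exact: GkD].
by move=> u; rewrite h4 h4' lc_cat addrACA.
Qed.

Lemma spannedZ c f : dvg 0 c -> spanned f -> spanned (fun u => c * f u).
Proof.
move=> hc [s [r [h1 [h2 h3] h4]]]; exists [seq (c * x.1, x.2) | x <- s], (fun u => c * r u); split.
- by move=> _ /mapP[x xs ->] /=; apply: dvgM0 => //; exact: h1.
- by split; [exact: CzZ|exact: (GkZ (k := 0) hc)].
- by move=> u; rewrite h4 lcZ mulrDr.
Qed.

Lemma spanned_small f : Cz f -> Gk 1 f -> spanned f.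
Proof. by move=> h1 h2; exists [::], f; split=> // u; rewrite /lc big_nil add0r. Qed.

Lemma spanned_Bu v : spanned (Bu v).
Proof.
exists [:: (1, v)], (fun=> 0); split.
- by move=> x; rewrite inE => /eqP -> /=; exact: dvg1.
- by split; [exact: Cz0|exact: Gk00].
- by move=> u; rewrite /lc big_seq1 mul1r addr0.
Qed.

Lemma spanned_ext f g : f =1 g -> spanned f -> spanned g. Proof. by move=> /funext ->. Qed.

Lemma spanned_sum (I : eqType) (s : seq I) (F : I -> laurent) : (forall i, i \in s -> spanned (F i)) ->
  spanned (fun u => \sum_(i <- s) F i u).
Proof.
elim: s => [|i s IH] h.
  apply: spanned_ext (spanned_small Cz0 (Gk00 1)) => u; by rewrite big_nil.
have h1 := h i (mem_head _ _); have h2 := IH (fun j js => h j (mem_behead (s := i :: s) js)).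
by apply: spanned_ext (spannedD h1 h2) => u; rewrite big_cons.
Qed.

Lemma Cz_finite_part f v0 : Cz f -> exists2 S : seq expo, uniq S /\ v0 \in S &
  exists r, [/\ Cz r, Gk 1 r & f =1 (fun u => \sum_(v <- S) (f v / gamma ^ weight v) * monom v u + r u)].
Proof.
move=> [fB fT]; have [S0 hS0] := fT 1%N; pose S := undup (v0 :: S0).
have uS : uniq S by exact: undup_uniq.
exists S; first by split=> //; rewrite mem_undup mem_head.
exists (fun u => if u \in S then 0 else f u).
have Bz : Bd (fun u => if u \in S then 0 else f u) by move=> u; case: ifP => _ //; exact: dvg0.
split.
- split=> // m; have [S' hS'] := fT m; exists S' => u /hS' h; case: ifP => _ //; exact: dvg0.
- move=> u; case: ifP => [_|/negbT]; first exact: dvg0.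
  by rewrite mem_undup inE negb_or => /andP[_]; exact: hS0.
- move=> u; case: ifP => [uS0|/negbT uS0].
    rewrite (bigD1_seq u) //= /monom eqxx mul1r divfK ?gammaz_neq0 // big1 ?addr0 // => v vu.
    by rewrite eq_sym (negbTE vu) mul0r mulr0.
  rewrite big_seq big1 ?add0r // => v vS; rewrite /monom; case: eqP => [e1|_]; last by rewrite mul0r mulr0.
  by rewrite e1 vS in uS0.
Qed.

(** Induction on the rank: modulo gamma, [Bu v] is a unit times the monomial v plus monomials of
    smaller rank. *)
Lemma spanned_monom v : spanned (monom v).
Proof.
have [m] := ubnP (rk v); elim: m v => // m IH v; rewrite ltnS => rv.
have [hC [L [L0 LV hv hout]]] := Lead_Bu v; have [hB _] := hC.
have [S [uS vS] [r [rC rG rE]]] := Cz_finite_part v hC.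
pose a v' := Bu v v' / gamma ^ weight v'.
have a0 v' : dvg 0 (a v') by rewrite dvg_divgz add0r; exact: hB.
pose b v' := if v' == v then a v - L else a v'.
have bs v' : spanned (fun u => b v' * monom v' u).
  have [r1|r1] := ltnP (rk v') (rk v).
    apply: spannedZ; last by apply: IH; exact: leq_trans r1 rv.
    rewrite /b; case: eqP => [e1|_] //; by rewrite e1 ltnn in r1.
  have b1 : dvg 1%N (b v').
    rewrite /b; case: eqP => [_|/eqP vv].
      rewrite (_ : a v - L = (Bu v v - L * gamma ^ weight v) / gamma ^ weight v).
        by rewrite dvg_divgz addrC.
      by rewrite mulrBl mulfK // gammaz_neq0.
    by rewrite dvg_divgz addrC; apply: hout.
  apply: spanned_small; last exact: (GkZ (k := 1) (m := 0) b1 (iffRL (Gk0 _) (Bd_monom _))).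
  by apply: CzZ; [exact: dvg_le b1|exact: Cz_monom].
have hs : spanned (fun u => L^-1 * (Bu v u + ((-1) * r u + (-1) * (\sum_(v' <- S) b v' * monom v' u)))).
  apply: spannedZ => //; apply: spannedD; first exact: spanned_Bu.
  have n1 : dvg 0 (-1) by rewrite dvgN dvg1.
  by apply: spannedD; apply: spannedZ => //; [exact: spanned_small|apply: spanned_sum].
apply: spanned_ext hs => u; rewrite rE !mulN1r -/a.
have -> : \sum_(v' <- S) a v' * monom v' u = L * monom v u + \sum_(v' <- S) b v' * monom v' u.
  have bv : b v = a v - L by rewrite /b eqxx.
  have bn : \sum_(v' <- S | v' != v) b v' * monom v' u = \sum_(v' <- S | v' != v) a v' * monom v' u.
    by apply: eq_bigr => v' vv; rewrite /b (negbTE vv).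
  rewrite (bigD1_seq v) //= [X in _ = _ + X](bigD1_seq v) //= bn bv.
  have alg (x l y t : K) : x * y + t = l * y + ((x - l) * y + t) by ring.
  exact: alg.
have alg (y t q : K) : L^-1 * (L * y + t + q + (- q - t)) = y.
  by rewrite -[RHS](mulKf L0); congr (_ * _); ring.
exact: alg.
Qed.

Lemma spanned_Cz f : Cz f -> spanned f.
Proof.
move=> hf; have [fB _] := hf; have [S _ [r [rC rG rE]]] := Cz_finite_part 0 hf.
have h : spanned (fun u => \sum_(v <- S) (f v / gamma ^ weight v) * monom v u).
  by apply: spanned_sum => v _; apply: spannedZ (spanned_monom v); rewrite dvg_divgz add0r; exact: fB.
by apply: spanned_ext (spannedD h (spanned_small rC rG)) => u; rewrite rE.
Qed.

Definition coeff (s : seq (K * expo)) v : K := \sum_(x <- s | x.2 == v) x.1.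

Lemma lc_coeff s (U : seq expo) u : uniq U -> {subset map snd s <= U} ->
  lc s u = \sum_(v <- U) coeff s v * Bu v u.
Proof.
move=> uU sU; rewrite /lc big_seq.
rewrite (eq_bigr (fun x => \sum_(v <- U | x.2 == v) x.1 * Bu v u)) => [|x xs].
  rewrite -big_seq (exchange_big_dep predT) //=; apply: eq_bigr => v _.
  by rewrite /coeff mulr_suml.
rewrite big_mkcond (bigD1_seq x.2) /=; [|by apply: sU; exact: map_f|done].
by rewrite eqxx big1 ?addr0 // => v vx; rewrite eq_sym (negbTE vx).
Qed.

Lemma coeff_dvg s v : dvs s -> dvg 0 (coeff s v).
Proof. by move=> hs; rewrite /coeff big_seq_cond; apply: dvg_sum => x /andP[/hs]. Qed.

(** Descending induction on the rank, starting at the maximum M. In the coefficient at v, series of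
    rank at most that of v other than [Bu v] contribute a multiple of gamma by [Lead], and those of
    larger rank by induction. *)
Lemma uniq_mod s : dvs s -> Gk 1 (lc s) -> forall v, dvg 1 (coeff s v).
Proof.
move=> hs hG; pose U := undup (map snd s); have uU : uniq U by exact: undup_uniq.
have sU : {subset map snd s <= U} by move=> x; rewrite mem_undup.
have out v : v \notin U -> coeff s v = 0.
  move=> vU; rewrite /coeff big_seq_cond big1 // => x /andP[xs /eqP xv].
  by move: vU; rewrite -xv (sU _ (map_f snd xs)).
pose M := (\max_(v <- U) rk v)%N.
have hM v : v \in U -> (rk v <= M)%N by move=> vU; apply: leq_bigmax_seq.
suff H m : forall v, (M - rk v < m)%N -> dvg 1 (coeff s v) by move=> v; apply: (H (M - rk v).+1).
elim: m => // m IH v; rewrite ltnS => vm.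
have [vU|/out ->] := boolP (v \in U); last exact: dvg0.
have [hC [L [L0 LV hv _]]] := Lead_Bu v; have [hB _] := hC.
have h1 : dvg (weight v + 1) (coeff s v * Bu v v).
  have := hG v; rewrite (lc_coeff v uU sU) (bigD1_seq v) //= => h.
  rewrite -[X in dvg _ X](addrK (\sum_(v' <- U | v' != v) coeff s v' * Bu v' v)).
  apply: dvgB => //; rewrite big_seq_cond; apply: dvg_sum => v' /andP[v'U vv'].
  have [[B' _] [L' [_ _ _ out']]] := Lead_Bu v'.
  have [rr|rr] := leqP (rk v') (rk v).
    by apply: dvgM0; [exact: coeff_dvg|apply: out' => //; rewrite eq_sym].
  rewrite addrC; apply: (dvgM (IH v' _) (B' v)).
  by apply: leq_trans vm; exact: (ltn_sub2l (leq_trans rr (hM _ v'U)) rr).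
have h2 : dvg (weight v + 1) (coeff s v * L * gamma ^ weight v).
  have -> : coeff s v * L * gamma ^ weight v =
     coeff s v * Bu v v - coeff s v * (Bu v v - L * gamma ^ weight v) by ring.
  by apply: dvgB => //; apply: dvgM0 => //; exact: coeff_dvg.
rewrite dvg_mulgz addrAC subrr add0r in h2.
by rewrite -(mulfK L0 (coeff s v)); apply: dvgM0r.
Qed.

Definition nc (s : seq (K * expo)) : Prop := forall x, x \in s -> x.2 != corner (kk x.2).

(** With k = kk v, write D_l = (D_l - D_k) - (D_n - D_k) where D_n = 0; each difference D_i - D_k
    sends [Bu v] to [Bu (v + ve i)], or to 0 if i = k. No corner is ever produced. *)
Lemma Dl_Bu l v : exists t : seq (K * expo), [/\ dvs t, nc t & Dl l (Bu v) =1 lc t].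
Proof.
have one i : exists t : seq (K * expo), [/\ dvs t, nc t & Dg i (kk v) (Bu v) =1 lc t].
  have [->|ik] := eqVneq i (kk v).
    by exists [::]; split=> // u; rewrite Dg_diag /lc big_nil.
  exists [:: (1, v + ve i)]; split.
  - by move=> x; rewrite inE => /eqP -> /=; exact: dvg1.
  - by move=> x; rewrite inE => /eqP -> /=; exact: add_not_corner.
  - by move=> u; rewrite /lc big_seq1 mul1r /= Bu_step.
have [t [t1 t2 t3]] := one (lift ord_max l); have [t' [t1' t2' t3']] := one ord_max.
exists (t ++ [seq ((-1) * x.1, x.2) | x <- t']); split.
- apply: dvs_cat => // _ /mapP[x xs ->] /=; apply: dvgM0; last exact: t1'.
  by rewrite dvgN dvg1.
- by move=> x; rewrite mem_cat => /orP[/t2//|/mapP[y ys ->] /=]; exact: t2'.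
- move=> u; rewrite lc_cat lcZ -t3 -t3' /Dl mulN1r [in RHS]Dg_sub [X in _ - X]Dg_sub.
  have z : Dg ord_max ord_max (Bu v) u = 0 by exact: Dg_diag.
  by rewrite z sub0r opprK subrK.
Qed.

Lemma nc_cat s t : nc s -> nc t -> nc (s ++ t).
Proof. by move=> hs ht x; rewrite mem_cat => /orP[/hs|/ht]. Qed.

Lemma Dl_lc l s : dvs s -> exists t : seq (K * expo),
  [/\ dvs t, nc t & (fun u => \sum_(x <- s) x.1 * Dl l (Bu x.2) u) =1 lc t].
Proof.
elim: s => [|x s IH] hs; first by exists [::]; split=> // u; rewrite /lc !big_nil.
have [|t [t1 t2 t3]] := IH; first by move=> y ys; apply: hs; rewrite inE ys orbT.
have [t' [t1' t2' t3']] := Dl_Bu l x.2.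
exists ([seq (x.1 * y.1, y.2) | y <- t'] ++ t); split.
- apply: dvs_cat => // _ /mapP[y ys ->] /=; apply: dvgM0; last exact: t1'.
  by apply: hs; rewrite mem_head.
- by apply: nc_cat => // _ /mapP[y ys ->] /=; exact: t2'.
- by move=> u; rewrite big_cons lc_cat lcZ; congr (_ * _ + _); [exact: t3'|exact: t3].
Qed.

Lemma Dl_sum_seq l (I : eqType) (s : seq I) (c : I -> K) (F : I -> laurent) :
  (forall i, i \in s -> dvg 0 (c i)) -> (forall i, Bd (F i)) ->
  Dl l (fun u => \sum_(x <- s) c x * F x u) =1 (fun u => \sum_(x <- s) c x * Dl l (F x) u).
Proof.
move=> hc hF u; pose c' i := if i \in s then c i else 0.
have e1 (G : I -> K) : \sum_(x <- s) c x * G x = \sum_(x <- s) c' x * G x.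
  by apply: eq_big_seq => i js; rewrite /c' js.
rewrite e1; have -> : (fun v => \sum_(x <- s) c x * F x v) = (fun v => \sum_(x <- s) c' x * F x v).
  by apply: funext => v; exact: e1.
apply: Dg_sum => // i; rewrite /c'; case: ifP => [/hc|_] //; exact: dvg0.
Qed.

Lemma sum_Dl_mod (g : 'I_n -> laurent) : (forall l, Cz (g l)) ->
  exists t : seq (K * expo), exists2 h : laurent, [/\ dvs t, nc t & DC h] &
  (fun u => \sum_l Dl l (g l) u) =1 (fun u => lc t u + gamma * h u).
Proof.
move=> hg.
have one l : exists t : seq (K * expo), exists2 h : laurent, [/\ dvs t, nc t & DC h] &
    Dl l (g l) =1 (fun u => lc t u + gamma * h u).
  have [s [r [s1 [r1 r2] gE]]] := spanned_Cz (hg l).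
  have [t [t1 t2 t3]] := Dl_lc l s1.
  (* The remainder is gamma times r' with r' still in C_0, so its image is gamma times an exact
     series. *)
  pose r' u := gamma ^ (-1) * r u.
  have r'E : r = (fun u => gamma * r' u).
    by apply: funext => u; rewrite /r' mulrA -{1}[gamma]expr1z -(expfzDr 1 (-1) gamma_neq0) subrr expr0z mul1r.
  have r'C : Cz r'.
    split=> [u|m]; first by rewrite /r' mulrC dvg_mulgz opprK; exact: r2.
    case: r1 => _ /(_ m.+1)[S hS]; exists S => u /hS h.
    by rewrite /r' mulrC dvg_mulgz opprK; apply: dvg_le h; lia.
  exists t, (Dl l r'); first by split=> //; exact: DC_Dg.
  move=> u; have -> : g l = (fun u => \sum_(x <- s) x.1 * Bu x.2 u + gamma * r' u).
    by apply: funext => v; rewrite gE r'E.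
  have BB : Bd (fun u => \sum_(x <- s) x.1 * Bu x.2 u).
    move=> v; rewrite big_seq; apply: dvg_sum => x xs; apply: dvgM0; first exact: s1.
    by case: (Cz_Bu x.2).
  have Br : Bd r' by case: r'C.
  have dg : dvg 0 gamma by apply: dvg_le (dvg_gammaz 1).
  rewrite {1}/Dl DgD //; last exact: BdZ.
  rewrite DgZ // -t3; congr (_ + _).
  apply: (@Dl_sum_seq l _ s (fun x => x.1) (fun x => Bu x.2)) => // x; by case: (Cz_Bu x.2).
have [T hT] : exists T : 'I_n -> seq (K * expo) * laurent, forall l,
    [/\ dvs (T l).1, nc (T l).1 & DC (T l).2] /\ Dl l (g l) =1 (fun u => lc (T l).1 u + gamma * (T l).2 u).
  apply: (@ex_choice _ _ (fun l (T : seq (K * expo) * laurent) =>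
    [/\ dvs T.1, nc T.1 & DC T.2] /\ Dl l (g l) =1 (fun u => lc T.1 u + gamma * T.2 u))) => l.
  by have [t [h h1 h2]] := one l; exists (t, h).
suff H (I : seq 'I_n) : exists t : seq (K * expo), exists2 h : laurent, [/\ dvs t, nc t & DC h] &
    (fun u => \sum_(l <- I) Dl l (g l) u) =1 (fun u => lc t u + gamma * h u) by exact: H.
elim: I => [|l I [t [h [h1 h2 h3] h4]]].
  exists [::], (fun=> 0); first by split=> //; exact: DC0'.
  by move=> u; rewrite /lc !big_nil mulr0 addr0.
have [[a1 a2 a3] a4] := hT l.
exists ((T l).1 ++ t), (fun u => (T l).2 u + h u).
  by split; [exact: dvs_cat|exact: nc_cat|exact: DCD].
move=> u; rewrite big_cons a4 h4 lc_cat mulrDr; exact: addrACA.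
Qed.

(** Modulo gamma the image is spanned by non-corner [Bu v], so uniqueness makes all coefficients
    divisible by gamma. Non-corner [Bu v] are themselves exact, hence the whole relation can be
    divided by gamma and [indep_step] iterated. *)
Lemma indep_step (c : 'I_n.+1 -> K) : (forall i, dvg 0 (c i)) ->
  DC (fun u => \sum_i c i * corner_monom i u) ->
  (forall i, dvg 1 (c i)) /\ DC (fun u => \sum_i (c i / gamma) * corner_monom i u).
Proof.
move=> hc [g hg gE]; have [t [h [t1 t2 hD] tE]] := sum_Dl_mod hg.
pose s1 := [seq (c i, corner i) | i <- index_enum 'I_n.+1].
pose s2 := [seq ((-1) * x.1, x.2) | x <- t]; pose s := s1 ++ s2.
have ds : dvs s.
  apply: dvs_cat => [_ /mapP[i _ ->]|_ /mapP[x xs ->] /=]; first exact: hc.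
  by apply: dvgM0; [rewrite dvgN dvg1|exact: t1].
have lcs u : lc s u = gamma * h u.
  rewrite lc_cat lcZ /lc big_map mulN1r -/(lc t u).
  have -> : \sum_(i <- index_enum 'I_n.+1) (c i, corner i).1 * Bu (c i, corner i).2 u =
     lc t u + gamma * h u.
    by rewrite -tE -gE; apply: eq_bigr => i _ /=; rewrite Bu_corner.
  by rewrite addrAC subrr add0r.
have hG : Gk 1 (lc s).
  move=> u; rewrite lcs addrC; apply: dvgM; first exact: (dvg_gammaz 1).
  by have [hB _] := DC_Cz hD.
have co1 := uniq_mod ds hG.
have ct v : coeff s2 v = - coeff t v.
  by rewrite /coeff big_map /= -[RHS]mulN1r [RHS]mulr_sumr.
have cs v : coeff s v = coeff s1 v - coeff t v by rewrite -ct /coeff big_cat.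
have cs1 i : coeff s1 (corner i) = c i.
  rewrite /coeff big_map /= (eq_bigl (fun j => j == i)) ?big_pred1_eq // => j.
  by rewrite (inj_eq (@corner_inj n)).
have ct0 i : coeff t (corner i) = 0.
  rewrite /coeff big_seq_cond big1 // => x /andP[/t2 nx /eqP ex].
  by move: nx; rewrite ex kk_corner eqxx.
have cs0 v : v != corner (kk v) -> coeff s1 v = 0.
  move=> nv; rewrite /coeff big_map /= big1 // => i /eqP ei.
  by move: nv; rewrite -ei kk_corner eqxx.
have ctd v : v != corner (kk v) -> dvg 1 (coeff t v).
  by move=> nv; have := co1 v; rewrite cs (cs0 v nv) sub0r dvgN.
split=> [i|]; first by have := co1 (corner i); rewrite cs cs1 ct0 subr0.
pose U := undup (map snd t); have uU : uniq U by exact: undup_uniq.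
have sU : {subset map snd t <= U} by move=> x; rewrite mem_undup.
have ncU v : v \in U -> v != corner (kk v).
  by rewrite mem_undup => /mapP[x xs ->]; exact: t2.
have dU (V : seq expo) : {subset V <= U} -> DC (fun u => \sum_(v <- V) (coeff t v / gamma) * Bu v u).
  elim: V => [|v V IH] hV; first by apply: DC_ext DC0' => u; rewrite big_nil.
  have vU : v \in U by apply: hV; rewrite mem_head.
  have h1 : dvg 0 (coeff t v / gamma).
    by have := ctd v (ncU v vU); rewrite -[gamma]expr1z dvg_divgz.
  have h2 := DCZ h1 (DC_Bu (ncU v vU)).
  have h3 := IH (fun x xV => hV x (mem_behead (s := v :: V) xV)).
  by apply: DC_ext (DCD h2 h3) => u; rewrite big_cons.
apply: DC_ext (DCD (dU U (fun x xU => xU)) hD) => u.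
have e1 : \sum_i c i * corner_monom i u = \sum_(v <- U) coeff t v * Bu v u + gamma * h u.
  by rewrite gE tE (lc_coeff u uU sU).
apply: (mulfI gamma_neq0); rewrite mulrDr !mulr_sumr.
rewrite (eq_bigr (fun v => coeff t v * Bu v u)); last first.
  by move=> v _; rewrite mulrA (mulrC gamma) divfK.
by rewrite -e1; apply: eq_bigr => i _; rewrite [RHS]mulrA (mulrC gamma) divfK.
Qed.

Lemma corner_monom_indep (c : 'I_n.+1 -> K) : DC (fun u => \sum_i c i * corner_monom i u) -> forall i, c i = 0.
Proof.
move=> hD; have [hB _] := DC_Cz hD.
have c0 i : dvg 0 (c i).
  have := hB (corner i); rewrite (bigD1 i) //= /corner_monom {1}/monom eqxx mul1r big1 ?addr0.
    by rewrite dvg_mulgz subrr.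
  by move=> j ji; rewrite /monom (inj_eq (@corner_inj n)) eq_sym (negbTE ji) mul0r mulr0.
suff H (m : nat) : forall c : 'I_n.+1 -> K, (forall i, dvg 0 (c i)) ->
    DC (fun u => \sum_i c i * corner_monom i u) -> forall i, dvg m (c i).
  by move=> i; apply: dvg_eq0 => m; exact: H.
elim: m {c hD hB c0} => [//|m IH] c c0 hD i.
have [c1 hD'] := indep_step c0 hD.
have h : forall i, dvg 0 (c i / gamma) by move=> j; rewrite -[gamma]expr1z dvg_divgz.
by have := IH _ h hD' i; rewrite -[gamma]expr1z dvg_divgz -addn1 PoszD.
Qed.

(** * Frobenius modulo gamma *)

Hypothesis gammaX_p : exists2 x, dvg 1 x & gamma ^+ p.-1 = - p%:R * (1 + x).

Lemma dvg_divp N i x : dvg N (x / p%:R ^+ i) = dvg (N + p.-1%:Z * i%:Z) x.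
Proof.
have pn : (p%:R : K) != 0 := pnat_neq0 ord_val ord_p.
have v1 := vl_p ord_p.
have ep : (p.-1%:Z * i%:Z)%:~R * e = i%:R by rewrite intrM -!pmulrn mulrAC p1e mul1r.
rewrite /dvg !(vgeE ord_val) mulf_eq0 invr_eq0 expf_eq0 (negbTE pn) andbF orbF.
case: eqP => //= /eqP x0n.
rewrite (vlM ord_val) ?invr_eq0 ?expf_neq0 // (vlV ord_val) (vlX ord_val) // v1 mulr1.
by rewrite lerBrDr intrD mulrDl ep.
Qed.

Transparent shift_sum lmul.

(** For v nonzero, w(v) + w(-v) >= 1, so only the product of constant terms survives modulo
    gamma. *)
Lemma lmul_at0 f g : Bd f -> Bd g -> dvg 1 (lmul ord f g 0 - f 0 * g 0).
Proof.
move=> hf hg; rewrite /lmul.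
have -> : f 0 * g 0 = infsum ord (fun v : expo => if v == 0 then f 0 * g 0 else 0).
  by rewrite (@infsum1 _ _ ord_val _ _ 0) ?eqxx // => v /negbTE ->.
rewrite -infsumB //; [|exact: lmul_tends|]; last first.
  by apply: (tends_to_0_fin ord_val (S0 := [:: 0])) => v; rewrite inE => /negbTE ->.
apply: dvg_infsum => v; case: eqP => [->|/eqP v0]; first by rewrite subr0 subrr dvg0.
rewrite subr0; apply: dvg_le (dvgM (hf v) (hg _)).
have v1 : weight v != 0 by apply: contra v0 => /eqP /(weight_eq0 n_gt0) ->.
by apply: ler_wpDr; [exact: weight_ge0|rewrite -gtz0_ge1 lt_def v1 weight_ge0].
Qed.

Lemma th0 i : th i 0 = 1.
Proof.
have := th_ve i 0; rewrite mulr0n => ->; rewrite expr0 mulr1 /theta expr0 mulr1 /AH.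
by rewrite big_ord1 fact0 invr1 scale1r expr0 coef1.
Qed.

Lemma dvg1_mul x y : dvg 1 (x - 1) -> dvg 1 (y - 1) -> dvg 1 (x * y - 1).
Proof.
move=> hx hy; have hx0 : dvg 0 x.
  by rewrite -(subrK 1 x); apply: dvgD; [exact: dvg_le hx|exact: dvg1].
have alg (s t : K) : s * t - 1 = s * (t - 1) + (s - 1) by ring.
by rewrite alg; apply: dvgD => //; exact: dvgM0.
Qed.

Lemma Pth0 s : dvg 1 (Pth s 0 - 1).
Proof.
elim: s => [|j s IH]; first by rewrite /Pth big_nil /lone eqxx subrr dvg0.
have h := lmul_at0 (Bd_th (lift ord_max j)) (Bd_Pth s).
rewrite th0 mul1r in h; rewrite /Pth big_cons -/(Pth s).
by rewrite -(subrK (Pth s 0) (lmul _ _ _ _)) -addrA; exact: dvgD.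
Qed.

Lemma Fs0 : dvg 1 (Fs 0 - 1).
Proof.
have h := lmul_at0 (Bd_th ord_max) (Bd_Pth (index_enum 'I_n)).
rewrite th0 mul1r in h; rewrite FsE.
by rewrite -(subrK (Pth (index_enum 'I_n) 0) (lmul _ _ _ _)) -addrA; apply: dvgD => //; exact: Pth0.
Qed.

(** Without the extra 1, w - N v_i and N v_i would share a cone, forcing the i-th coordinate of w to
    be at least N. *)
Lemma weight_not_cofacial (w : expo) i (N : nat) : cc w i < N -> weight w + 1 <= N%:Z + weight (w - ve i *+ N).
Proof.
move=> hN; rewrite leNgt ltzD1; apply/negP => h.
have e1 : w - ve i *+ N + ve i *+ N = w by rewrite subrK.
have h2 : weight (w - ve i *+ N) + weight (ve i *+ N) <= weight (w - ve i *+ N + ve i *+ N).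
  by rewrite e1 (weight_ve n_gt0) addrC.
have := weightD_cc h2 i; rewrite e1 (cc_ve n_gt0) eqxx => h3.
have := cc_ge0 (w - ve i *+ N) i; move: hN; rewrite h3 -[X in _ + X]/(1 *+ N) natz; lia.
Qed.

(* Modulo higher powers of gamma, only the first term of each sum survives in the differential equation of F. *)
Lemma Fs_step (l : 'I_n) w : cc w ord_max = 0 -> cc w (lift ord_max l) < p%:Z ->
  dvg (weight w + 1) ((cc w (lift ord_max l))%:~R * Fs w - gamma * Fs (w - ve (lift ord_max l))).
Proof.
set i := lift ord_max l => w0 wp.
have hF := Bd_Fs; have := eu_Fs l w; rewrite /eu -/i co_max subr0 co_cc w0 subr0 => ->.
have -> : shift_sum (aR i) i Fs w - shift_sum (aR ord_max) ord_max Fs w - gamma * Fs (w - ve i)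
  = (shift_sum (aR i) i Fs w - gamma * Fs (w - ve i)) - shift_sum (aR ord_max) ord_max Fs w.
  by rewrite addrAC.
apply: dvgB.
  rewrite /shift_sum infsum_recl //; last by apply: shift_sum_tends => //; exact: Sh_aR.
  have -> : aR i 0 * Fs (w - ve i *+ (p ^ 0)) = gamma * Fs (w - ve i).
    by rewrite /aR expn0 !expr1 mulr1n /lam /i eq_sym (negbTE (neq_lift _ _)) mulr1.
  have alg (x y : K) : x + y - x = y by ring.
  rewrite alg; apply: dvg_infsum => m.
  apply: dvg_le (dvgM (Sh_aR i m.+1) (hF _)); apply: weight_not_cofacial.
  apply: (lt_le_trans wp); rewrite lez_nat; apply: (@leq_pexp2l p 1) => //; exact: prime_gt0.
apply: dvg_infsum => m; apply: dvg_le (dvgM (Sh_aR ord_max m) (hF _)).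
by apply: weight_not_cofacial; rewrite w0 ltz_nat expn_gt0 prime_gt0.
Qed.

Opaque shift_sum lmul.

Definition facprod (w : expo) : nat := (\prod_(i : 'I_n.+1) (`|cc w i|)`!)%N.

Lemma facprod_sub (w : expo) i : 1 <= cc w i -> facprod w = (`|cc w i| * facprod (w - ve i)%R)%N.
Proof.
move=> hi; have hc := cc_subve hi.
rewrite /facprod (bigD1 i) //= [in RHS](bigD1 i) //= hc eqxx mulnA; congr (_ * _)%N.
  have -> : `|cc w i|%N = `|cc w i - 1|.+1 by move: hi; clear; lia.
  by rewrite factS.
by apply: eq_bigr => j /negbTE ji; rewrite hc ji subr0.
Qed.

(** To leading order F is F(0) exp(gamma (x_1 + .. + x_n)) on this cone. The factorials are kept on
    the left, and [Fs_step] removes one unit of a coordinate at a time. *)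
Lemma Fs_fact (w : expo) : cc w ord_max = 0 -> (forall i, cc w i < p%:Z) ->
  dvg (weight w + 1) ((facprod w)%:R * Fs w - gamma ^ weight w * Fs 0).
Proof.
have [m] := ubnP `|weight w|; elim: m w => // m IH w; rewrite ltnS => wm w0 wp.
have [/existsP[i ci]|] := boolP [exists i, cc w i != 0]; last first.
  rewrite negb_exists => /forallP h.
  have c0 i : cc w i = 0 by apply/eqP; have := h i; rewrite negbK.
  have ww : weight w = 0 by rewrite weightE big1.
  rewrite (weight_eq0 n_gt0 ww) (weight0 n_gt0) expr0z.
  rewrite /facprod big1 ?subrr ?dvg0 // => i _; by rewrite (cc0 n_gt0).
have im : i != ord_max by apply: contraNneq ci => ->; rewrite w0.
have hi : 1 <= cc w i by have := cc_ge0 w i; move: ci; clear; lia.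
have [l il|] := unliftP ord_max i; last by move=> e1; rewrite e1 eqxx in im.
have hc := cc_subve hi; set w' := w - ve i.
have w'0 : cc w' ord_max = 0 by rewrite hc w0 eq_sym (negbTE im) subrr.
have ww : weight w = weight w' + 1.
  by rewrite -(@weight_addve n w' i ord_max w'0) 1?eq_sym // /w' subrK.
have st : dvg (weight w + 1) ((cc w i)%:~R * Fs w - gamma * Fs w').
  by rewrite /w' il; apply: Fs_step; rewrite // -il.
have ih : dvg (weight w' + 1) ((facprod w')%:R * Fs w' - gamma ^ weight w' * Fs 0).
  apply: IH => //; last by move=> j; rewrite hc; have := wp j; case: (j == i); clear; lia.
  by have := weight_ge0 w'; move: wm ww; clear; lia.
have cE : ((cc w i)%:~R : K) = (`|cc w i|)%N%:R by rewrite -[in LHS](gez0_abs (cc_ge0 w i)) -pmulrn.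
rewrite (facprod_sub hi) -/w' natrM -cE.
have gE : gamma ^ weight w = gamma * gamma ^ weight w'.
  by rewrite ww (expfzDr (weight w') 1 gamma_neq0) expr1z mulrC.
rewrite gE.
have alg (c P g F F' G F0 : K) : c * P * F - g * G * F0 = P * (c * F - g * F') + g * (P * F' - G * F0) by ring.
rewrite (alg _ _ _ _ (Fs w')); apply: dvgD; first by apply: dvgM0 => //; exact: dvg_nat.
by rewrite addrC; have := dvgM (dvg_gammaz 1) ih; rewrite expr1z ww.
Qed.

Lemma facprod_corner (j : 'I_n.+1) : facprod (corner j *+ p.-1) = (p.-1`! ^ j)%N.
Proof.
have p1 : (0 < p.-1)%N by have := prime_gt1 p_prime; case: (p) => [|[]].
have hj : (\sum_(i < n.+1) (i < j))%N = j.
  have := weight_corner j; rewrite weightE (eq_bigr (fun i : 'I_n.+1 => (i < j)%N%:R)) => [|i _].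
    by rewrite -natr_sum natz => -[].
  exact: cc_corner.
rewrite -[X in (_ ^ X)%N]hj expn_sum /facprod; apply: eq_bigr => i _.
by rewrite (cc_Mn (corner j) i p1) cc_corner; case: (i < j)%N; rewrite ?mul0rn //= expn1 -mulrnA mul1n natz.
Qed.

Lemma dvg1X x m : dvg 1 (x - 1) -> dvg 1 (x ^+ m - 1).
Proof.
move=> hx; elim: m => [|m IH]; first by rewrite expr0 subrr dvg0.
by rewrite exprS; exact: dvg1_mul.
Qed.

Lemma dvg_wilson : dvg 1 (- (p.-1`!)%:R - 1).
Proof.
have : (p %| p.-1`!.+1)%N by rewrite -(Wilson (prime_gt1 p_prime)).
case/dvdnP=> m hm; rewrite -opprD dvgN natr1 hm natrM; apply: dvgM0; first exact: dvg_nat.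
have := dvg_divp 0 1 (p%:R ^+ 1); rewrite divff ?dvg1 => [/esym h|]; last first.
  by rewrite expf_neq0 // (pnat_neq0 ord_val ord_p).
rewrite -[p%:R]expr1; apply: dvg_le h; rewrite add0r mulr1 lez_nat.
by have := prime_gt1 p_prime; case: (p) => [|[]].
Qed.

(** The factorials in [Fs_fact] are units since all coordinates are below p. The sign (-1)^j that
    Wilson's theorem gives to ((p-1)!)^j cancels the one in gamma^((p-1)j) = (-p)^j (1 +
    O(gamma)). *)
Lemma Fs_corner (j : 'I_n.+1) : dvg 1 (Fs (corner j *+ p.-1) / p%:R ^+ j - 1).
Proof.
have p1 : (0 < p.-1)%N by have := prime_gt1 p_prime; case: (p) => [|[]].
have pn : (p%:R : K) ^+ j != 0 by rewrite expf_neq0 // (pnat_neq0 ord_val ord_p).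
set w := corner j *+ p.-1.
have hcc i : cc w i = (i < j)%N%:R *+ p.-1 by rewrite (cc_Mn (corner j) i p1) cc_corner.
have wE : weight w = p.-1%:Z * j%:Z by rewrite (weightMn (corner j) p1) weight_corner -mulr_natl natz.
have w0 : cc w ord_max = 0 by rewrite hcc ltnNge leq_ord mul0rn.
have wp i : cc w i < p%:Z.
  rewrite hcc -mulrnA natz ltz_nat (leq_ltn_trans (_ : _ <= p.-1)%N) ?prednK ?prime_gt0 //.
  by case: (i < j)%N; rewrite ?mul1n.
have := Fs_fact w0 wp; rewrite facprod_corner wE natrX.
have [x hx gx] := gammaX_p.
have -> : gamma ^ (p.-1%:Z * j%:Z) = (-1) ^+ j * p%:R ^+ j * (1 + x) ^+ j.
  by rewrite -PoszM -exprnP exprM gx -exprMn -exprMn mulN1r.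
set c := p.-1`!%:R; set F := Fs w => h.
have k1 : dvg 1 (c ^+ j * (F / p%:R ^+ j) - (-1) ^+ j * (1 + x) ^+ j * Fs 0).
  have -> : c ^+ j * (F / p%:R ^+ j) - (-1) ^+ j * (1 + x) ^+ j * Fs 0 =
      (c ^+ j * F - (-1) ^+ j * p%:R ^+ j * (1 + x) ^+ j * Fs 0) / p%:R ^+ j.
    by field.
  by rewrite dvg_divp addrC.
have k0 : dvg 0 (F / p%:R ^+ j) by rewrite dvg_divp add0r -wE; exact: Bd_Fs.
have b1 : dvg 1 ((- c) ^+ j - 1) by apply: dvg1X; exact: dvg_wilson.
have x1 : dvg 1 ((1 + x) ^+ j * Fs 0 - 1).
  by apply: dvg1_mul; [apply: dvg1X; rewrite addrAC subrr add0r|exact: Fs0].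
have s1 : ((-1) ^+ j * (-1) ^+ j = 1 :> K) by rewrite -exprMn mulrNN mulr1 expr1n.
have cE : (- c) ^+ j = (-1) ^+ j * c ^+ j by rewrite -exprMn mulN1r.
have k2 := dvgM0 (_ : dvg 0 ((-1) ^+ j)) k1.
have s0 : dvg 0 ((-1) ^+ j) by rewrite -signr_odd; case: odd; rewrite ?expr1 ?expr0 ?dvgN dvg1.
have k3 := k2 s0.
have alg (s t X Y k : K) : s * s = 1 -> k - 1 = (s * (t * k - s * X * Y)) + (X * Y - 1) - (s * t - 1) * k.
  move=> ss; have -> : s * (t * k - s * X * Y) = s * t * k - (s * s) * X * Y by ring.
  by rewrite ss; ring.
rewrite (alg _ (c ^+ j) ((1 + x) ^+ j) (Fs 0) _ s1) -cE.
by apply: dvgB; [exact: dvgD|exact: dvgM0r].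
Qed.

Transparent lmul.

(** * Frobenius on the corner monomials *)

Lemma lmul_monom f v u : lmul ord f (monom v) u = f (u - v) * gamma ^ weight v.
Proof.
rewrite /lmul (@infsum1 _ _ ord_val _ _ (u - v)) => [|w wu]; rewrite /monom.
  by rewrite subKr eqxx mul1r.
case: eqP => [e1|_]; first by rewrite -e1 subKr eqxx in wu.
by rewrite mul0r mulr0.
Qed.

Opaque lmul.

Lemma frob_corner_monom j v : frob (corner_monom j) v = tau (Fs (v *+ p - corner j)) * gamma ^ j.
Proof. by rewrite /frob /corner_monom lmul_monom rmorphM tau_gammaz weight_corner. Qed.

Lemma hdE (w : int) : 0 <= w -> hd 0 w = w *+ p.
Proof.
move=> w0; rewrite /hd subr0 max_r // -[in RHS](prednK (prime_gt0 p_prime)) mulrS -mulr_natl natz.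
done.
Qed.

Lemma Ld_frob f : Bd f -> Ld 0 (frob f).
Proof. by move=> hf u; rewrite (hdE (weight_ge0 u)); exact: (frob_dvg u hf). Qed.

Lemma Ld_Cz d f : Ld d f -> Cz f.
Proof.
have p1 : 1 <= p.-1%:Z by have := prime_gt1 p_prime; case: (p) => [|[]].
move=> hf; split=> [u|m].
  apply: dvg_le (hf u); rewrite /hd lerDl mulr_ge0 //; last by rewrite le_max lexx.
exists (wlist n (m + `|d|)) => u /(wlistP n_gt0) hw; apply: dvg_le (hf u); rewrite /hd lerD2l.
have h : m%:Z <= Num.max 0 (weight u - d) by rewrite le_max; move: hw; clear; lia.
by apply: (le_trans h); apply: ler_peMl => //; rewrite le_max lexx.
Qed.

(** Otherwise p v - u_j and u_j share a cone, so v has coordinate at least 1 wherever u_j does;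
    weight at most j then forces v = u_j. *)
Lemma corner_cofacial (j : 'I_n.+1) (v : expo) : weight v <= j%:Z -> v != corner j ->
  weight v *+ p + 1 <= weight (v *+ p - corner j) + j%:Z.
Proof.
have p0 := prime_gt0 p_prime; move=> vj; apply: contraNle; rewrite ltzD1 -(weightMn v p0) => h.
have e1 : v *+ p - corner j + corner j = v *+ p by rewrite subrK.
have h2 : weight (v *+ p - corner j) + weight (corner j) <= weight (v *+ p - corner j + corner j).
  by rewrite e1 weight_corner.
have hc i : 0 <= cc v i - (i < j)%N%:R.
  have := weightD_cc h2 i; rewrite e1 (cc_Mn v i p0) cc_corner.
  have := cc_ge0 (v *+ p - corner j) i; have := cc_ge0 v i.
  case: (i < j)%N => /=; last by move=> h0 _ _; rewrite subr0.
  rewrite le_eqVlt => /orP[/eqP <- h0|]; first by rewrite mul0rn => h3; move: h0 h3; clear; lia.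
  by rewrite subr_ge0 gtz0_ge1.
have s0 : \sum_i (cc v i - (i < j)%N%:R) = 0.
  apply/eqP; rewrite eq_le sumr_ge0 ?andbT // sumrB -weightE subr_le0.
  apply: le_trans vj _; rewrite -(weight_corner j) weightE le_eqVlt; apply/orP; left; apply/eqP.
  by apply: eq_bigr => i _; rewrite cc_corner.
apply/eqP; apply: cc_inj => i; rewrite cc_corner; apply/eqP; rewrite -subr_eq0; apply/eqP.
exact: (psumr_eq0P (P := predT) (fun i _ => hc i) s0).
Qed.

(** The image is split at weight j, with the coefficient at u_j set apart. After division by
    suitable powers of gamma both other parts satisfy an [Ld] bound, which [red_main] turns into
    divisibility of the matrix entries. *)
Lemma frob_corner_monom_column (j : 'I_n.+1) : exists c : 'I_n.+1 -> K,
  [/\ forall i, dvg 0 (c i / p%:R ^+ i), forall i : 'I_n.+1, (i < j)%N -> dvg 1 (c i / p%:R ^+ i),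
      dvg 1 (c j / p%:R ^+ j - 1) & DC (fun u => frob (corner_monom j) u - \sum_i c i * corner_monom i u)].
Proof.
have p0 := prime_gt0 p_prime; have p1 : 1 <= p.-1%:Z by have := prime_gt1 p_prime; case: (p) => [|[]].
have Beb : Bd (corner_monom j) by exact: Bd_monom.
set f := frob (corner_monom j); have fp v : dvg (weight v *+ p) (f v) by exact: frob_dvg.
pose ka := tau (Fs (corner j *+ p.-1)).
(* Here gamma^N has the valuation of p^(j+1): weights above j allow this division at the cost of
   [Ld (j + 1)], and the i-th entry keeps p^max(i, j+1). *)
pose N := p.-1%:Z * (j%:Z + 1).
pose f1 v := if j%:Z < weight v then f v / gamma ^ N else 0.
(* The single power of gamma is the one gained in [corner_cofacial]. *)
pose f2 v := if (weight v <= j%:Z) && (v != corner j) then f v / gamma ^ 1 else 0.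
have fE v : f v = ka * corner_monom j v + (gamma ^ N * f1 v + gamma ^ 1 * f2 v).
  have mg (M : int) (x : K) : gamma ^ M * (x / gamma ^ M) = x by rewrite mulrC divfK // gammaz_neq0.
  rewrite /f1 /f2 /corner_monom /monom; case: eqP => [->|/eqP vj].
    rewrite andbF weight_corner ltxx !mulr0 !addr0 mul1r /f frob_corner_monom; congr (tau (Fs _) * _).
    by rewrite -[in LHS](prednK p0) mulrSr addrK.
  rewrite mul0r mulr0 add0r andbT; case: ltP => h; first by rewrite mg mulr0 addr0.
  by rewrite mulr0 add0r mg.
have L1 : Ld (j%:Z + 1) f1.
  move=> v; rewrite /f1; case: ifP => h; last exact: dvg0.
  rewrite dvg_divgz; apply: dvg_le (fp v); rewrite /hd max_r ?subr_ge0 ?lezD1 //.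
  by rewrite -addrA -mulrDr subrK -(hdE (weight_ge0 v)) /hd subr0 (max_r (weight_ge0 v)).
have L2 : Ld 0 f2.
  move=> v; rewrite /f2; case: ifP => [/andP[h1 h2]|_]; last exact: dvg0.
  rewrite (hdE (weight_ge0 v)) dvg_divgz; apply: dvg_le (corner_cofacial h1 h2) _.
  by rewrite /f frob_corner_monom; apply: dvgM; [apply: tau_dvg; exact: Bd_Fs|exact: (dvg_gammaz j)].
have [c1 [h1 [/(_ _ L1) b1 d1] e1]] := red_main (Ld_Cz L1).
have [c2 [h2 [/(_ _ L2) b2 d2] e2]] := red_main (Ld_Cz L2).
have kp : dvg 1 (ka / p%:R ^+ j - 1).
  by have := tau_dvg (Fs_corner j); rewrite rmorphB rmorph1 fmorph_div rmorphXn rmorph_nat.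
pose c i := ka * (i == j)%:R + (gamma ^ N * c1 i + gamma ^ 1 * c2 i).
have t1 (i : 'I_n.+1) : dvg (p.-1%:Z * Num.max i%:Z (j%:Z + 1)) (gamma ^ N * c1 i).
  apply: dvg_le (dvgM (dvg_gammaz N) (b1 i)); rewrite /N -mulrDr; apply: ler_wpM2l => //.
  by clear; lia.
have t2 (i : 'I_n.+1) : dvg (p.-1%:Z * i%:Z + 1) (gamma ^ 1 * c2 i).
  apply: dvg_le (dvgM (dvg_gammaz 1) (b2 i)); rewrite addrC lerD2l subr0; apply: ler_wpM2l => //.
  by clear; lia.
have t3 (i : 'I_n.+1) : (i <= j)%N -> dvg 1 ((gamma ^ N * c1 i + gamma ^ 1 * c2 i) / p%:R ^+ i).
  move=> ij; rewrite dvg_divp; apply: dvgD; last by rewrite addrC.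
  apply: dvg_le (t1 i); have -> : Num.max i%:Z (j%:Z + 1) = j%:Z + 1 by move: ij; clear; lia.
  rewrite addrC; apply: (@le_trans _ _ (p.-1%:Z * (i%:Z + 1))); last first.
    by apply: ler_wpM2l => //; rewrite lerD2r lez_nat.
  by rewrite mulrDr mulr1 lerD2l.
exists c; split.
- move=> i; rewrite /c dvg_divp add0r; apply: dvgD.
    case: eqP => [->|_]; last by rewrite mulr0 dvg0.
    rewrite mulr1 -[X in dvg X _]add0r -dvg_divp -(subrK 1 (_ / _)).
    by apply: dvgD; [exact: dvg_le kp|exact: dvg1].
  apply: dvgD; last by apply: dvg_le (t2 i); rewrite lerDl.
  by apply: dvg_le (t1 i); apply: ler_wpM2l => //; rewrite le_max lexx.
- move=> i ij; rewrite /c; have -> : (i == j) = false by apply/eqP => h; rewrite h ltnn in ij.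
  by rewrite mulr0 add0r; apply: t3; exact: ltnW.
- by rewrite /c eqxx mulr1 mulrDl addrAC; apply: dvgD => //; exact: t3.
have g0 : dvg 0 (gamma ^ N) by apply: dvg_le (dvg_gammaz N); rewrite mulr_ge0 // addr_ge0.
have g1 : dvg 0 (gamma ^ 1) by apply: dvg_le (dvg_gammaz 1).
apply: DC_ext (DCD (DCZ g0 d1) (DCZ g1 d2)) => u.
rewrite fE; have -> : \sum_i c i * corner_monom i u = ka * corner_monom j u + (gamma ^ N * \sum_i c1 i * corner_monom i u + gamma ^ 1 * \sum_i c2 i * corner_monom i u).
  rewrite !mulr_sumr -big_split /=.
  have -> : ka * corner_monom j u = \sum_i ka * (i == j)%:R * corner_monom i u.
    rewrite (bigD1 j) //= eqxx mulr1 big1 ?addr0 // => i /negbTE ->; by rewrite mulr0 mul0r.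
  rewrite -big_split /=; apply: eq_bigr => i _; rewrite /c !mulrDl !mulrA; done.
rewrite e1 e2.
have alg (k a b x y s t : K) : a * s + b * t = k + (a * (x + s) + b * (y + t)) - (k + (a * x + b * y)) by ring.
exact: alg.
Qed.

Lemma frob_matrix : exists A : 'M[K]_n.+1,
  [/\ forall i j, dvg 0 (A i j / p%:R ^+ i), forall i j : 'I_n.+1, (i < j)%N -> dvg 1 (A i j / p%:R ^+ i),
      forall j, dvg 1 (A j j / p%:R ^+ j - 1) & forall j, DC (fun u => frob (corner_monom j) u - \sum_i A i j * corner_monom i u)].
Proof.
have [c hc] := ex_choice frob_corner_monom_column.
exists (\matrix_(i, j) c j i); split.
- by move=> i j; rewrite mxE; case: (hc j) => h _ _ _; exact: h.
- by move=> i j ij; rewrite mxE; case: (hc j) => _ h _ _; exact: h.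
- by move=> j; rewrite mxE; case: (hc j).
- by move=> j; case: (hc j) => _ _ _; apply: DC_ext => u; congr (_ - _); apply: eq_bigr => i _; rewrite mxE.
Qed.

(** * Triangularisation of Frobenius *)

Lemma dvg_unit x : dvg 1 (x - 1) -> x != 0 /\ vl x = 0.
Proof.
move=> h; have := @vl_lt_addl _ _ ord_val 1 (x - 1) (oner_neq0 _).
rewrite (addrC 1) subrK (vl1 ord_val); apply; case: eqP => //= /eqP xn.
by move: h; rewrite /dvg (vgeE ord_val) (negbTE xn) /=; apply: lt_le_trans; rewrite mul1r.
Qed.

Lemma dvg_unitV x : dvg 1 (x - 1) -> dvg 0 x^-1.
Proof.
by move=> /dvg_unit[x0 vx]; rewrite dvg_vge0 (vgeE ord_val) invr_eq0 (negbTE x0) /= (vlV ord_val) vx oppr0.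
Qed.

Lemma dvg_limit (s : nat -> K) : (forall k : nat, dvg k (s k.+1 - s k)) ->
  exists l, forall k : nat, dvg k (s k - l).
Proof.
move=> hs.
have hd' (k m : nat) : (k <= m)%N -> dvg k (s m - s k).
  move=> /subnK <-; elim: (m - k)%N => [|i IH]; first by rewrite subrr dvg0.
  rewrite -(subrK (s (i + k)%N) (s _)) -addrA; apply: dvgD => //; apply: dvg_le (hs _).
  by rewrite lez_nat leq_addl.
have cau (N : nat) : exists m0, forall m1 m2, (m0 <= m1)%N -> (m0 <= m2)%N -> (N%:R%:E <= ord (s m1 - s m2)%R)%E.
  exists (p.-1 * N)%N => m1 m2 h1 h2.
  have : dvg (p.-1 * N)%N (s m1 - s m2).
    by rewrite -(subrK (s (p.-1 * N)%N) (s m1)) -addrA; apply: dvgD; [exact: hd'|rewrite -opprB dvgN; exact: hd'].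
  by rewrite /dvg -pmulrn natrM mulrAC p1e mul1r.
have [l hl] := K_complete cau; exists l => k.
have [m0 hm] := hl k; rewrite -(subrK (s (maxn m0 k)) (s k)) -addrA; apply: dvgD.
  by rewrite -opprB dvgN; apply: hd'; exact: leq_maxr.
have hk : vge k%:R (s (maxn m0 k) - l) by exact: hm (leq_maxl _ _).
apply: (vge_le ord_val _ hk).
by rewrite -pmulrn ler_piMr // /e invf_le1 ?ler1n ?ltr0n //; have := prime_gt1 p_prime; case: (p) => [|[]].
Qed.

(* The shape of the transposed matrix of Frobenius in the basis of corner monomials. *)
Definition slope_mx m (B : 'M[K]_m) : Prop :=
  [/\ forall i j : 'I_m, dvg (p.-1 * j)%N (B i j), forall i j : 'I_m, (j < i)%N -> dvg ((p.-1 * j)%N%:Z + 1) (B i j)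
    & forall i, dvg 1 (B i i / p%:R ^+ i - 1)].

Section FixedRow.
Variables (m : nat) (b00 : K) (b01 b10 : 'I_m -> K) (b11 : 'I_m -> 'I_m -> K).
Hypotheses (h00 : dvg 1 (b00 - 1)) (h10 : forall i, dvg 1 (b10 i)).
Hypotheses (h01 : forall i : 'I_m, dvg (p.-1 * i.+1)%N (b01 i)).
Hypotheses (h11 : forall i j : 'I_m, dvg (p.-1 * j.+1)%N (b11 i j)).

(** In block form, the row (1, tau x) times the matrix is [d x] times (1, Phi x), so a fixed point
    of [Phi] spans an invariant line of the semilinear map. *)
Let d (x : 'I_m -> K) := b00 + \sum_j tau (x j) * b10 j.
Let num (x : 'I_m -> K) i := b01 i + \sum_j tau (x j) * b11 j i.
Let Phi x i := num x i / d x.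

Let d1 x : (forall i, dvg 0 (x i)) -> dvg 1 (d x - 1).
Proof.
move=> hx; rewrite /d addrAC; apply: dvgD => //; apply: dvg_sum => j _.
by apply: dvgM0 => //; exact: tau_dvg.
Qed.

Let num_dvg x (i : 'I_m) : (forall i, dvg 0 (x i)) -> dvg (p.-1 * i.+1)%N (num x i).
Proof.
move=> hx; apply: dvgD => //; apply: dvg_sum => j _; apply: dvgM0 => //; exact: tau_dvg.
Qed.

Let Phi_dvg x (i : 'I_m) : (forall i, dvg 0 (x i)) -> dvg (p.-1 * i.+1)%N (Phi x i).
Proof. by move=> hx; apply: dvgM0r; [exact: num_dvg|apply: dvg_unitV; exact: d1]. Qed.

Let p1_ge i : 1 <= (p.-1 * i.+1)%N%:Z.
Proof. by have := prime_gt1 p_prime; case: (p) => [|[]]. Qed.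

Let Phi0 x : (forall i, dvg 0 (x i)) -> forall i, dvg 0 (Phi x i).
Proof. by move=> hx i; apply: dvg_le (Phi_dvg i hx). Qed.

(** The denominators are units, and x enters only through entries b10 and b11, all divisible by
    gamma. *)
Let Phi_contract (k : nat) x y : (forall i, dvg 0 (x i)) -> (forall i, dvg 0 (y i)) ->
  (forall i, dvg k (x i - y i)) -> forall i, dvg (k%:Z + 1) (Phi x i - Phi y i).
Proof.
move=> hx hy hxy i.
have [dx0 _] := dvg_unit (d1 hx); have [dy0 _] := dvg_unit (d1 hy).
have alg (s t u v : K) : u != 0 -> v != 0 -> s / u - t / v = (s - t) * u^-1 + (t * u^-1 * v^-1) * (v - u).
  by move=> u0 v0; field; rewrite u0 v0.
rewrite /Phi alg //; apply: dvgD.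
  apply: dvgM0r; last by apply: dvg_unitV; exact: d1.
  rewrite /num opprD addrACA subrr add0r -sumrB; apply: dvg_sum => j _.
  rewrite -mulrBl -rmorphB; apply: dvgM; first exact: tau_dvg.
  exact: dvg_le (h11 _ _).
apply: dvgM0.
  apply: dvgM0; last by apply: dvg_unitV; exact: d1.
  apply: dvgM0; last by apply: dvg_unitV; exact: d1.
  by apply: dvg_le (num_dvg i hy).
rewrite -opprB dvgN /d opprD addrACA subrr add0r -sumrB; apply: dvg_sum => j _.
by rewrite -mulrBl -rmorphB; apply: dvgM => //; exact: tau_dvg.
Qed.

(* The slope-zero line, normalised as (1, x), is the fixed point of a map that contracts by gamma. *)
Lemma fixed_row : exists x : 'I_m -> K, exists c : K,
  [/\ forall i : 'I_m, dvg (p.-1 * i.+1)%N (x i), dvg 1 (c - 1),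
      b00 + \sum_j tau (x j) * b10 j = c
    & forall i, b01 i + \sum_j tau (x j) * b11 j i = c * x i].
Proof.
pose s k := iter k Phi (fun=> 0).
have s0 k : forall i, dvg 0 (s k i) by elim: k => [|k IH] i; [exact: dvg0|exact: Phi0].
have sk (k : nat) : forall i, dvg k (s k.+1 i - s k i).
  elim: k => [|k IH] i; first by apply: dvgB; exact: s0.
  by rewrite intS [1 + _]addrC; exact: (Phi_contract (s0 k.+1) (s0 k) IH).
have [x hx] := ex_choice (fun i => @dvg_limit (fun k => s k i) (fun k => sk k i)).
have x0 i : dvg 0 (x i) by rewrite -dvgN -[- _]add0r; exact: (hx i 0%N).
have fx i : Phi x i = x i.
  apply/eqP; rewrite -subr_eq0; apply/eqP; apply: dvg_eq0 => k.
  rewrite -(subrK (s k.+1 i) (Phi x i)) -addrA; apply: dvgD; last first.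
    by apply: dvg_le (hx i k.+1); rewrite lez_nat.
  apply: dvg_le (_ : dvg (k%:Z + 1) _); first by rewrite lerDl.
  apply: (Phi_contract x0 (s0 k)) => j; rewrite -opprB dvgN; exact: hx.
have [c0 _] := dvg_unit (d1 x0).
exists x, (d x); split=> // [i||i].
- by rewrite -fx; exact: Phi_dvg.
- exact: d1.
- by rewrite -[in RHS]fx /Phi mulrC divfK.
Qed.

End FixedRow.

(** Induction on the size: [fixed_row] splits off the line of slope 0, and on the quotient the
    slopes are shifted by 1, so that division by p restores the shape [slope_mx]. *)
Lemma frobenius_triangular m (B : 'M[K]_m) : slope_mx B -> exists G T : 'M[K]_m,
  [/\ G \in unitmx, is_trig_mx T, map_mx tau G *m B = T *m G
    & forall i, dvg 1 (T i i / p%:R ^+ i - 1)].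
Proof.
have pn := pnat_neq0 ord_val ord_p.
elim: m B => [|m IH] B [B1 B2 B3].
  exists 1%:M, 0; split; rewrite ?unitmx1 //; try by case.
  - by apply/is_trig_mxP; case.
  - by apply/matrixP; case.
rewrite -[m.+1]/(1 + m)%N in B B1 B2 B3 *.
pose l0 : 'I_(1 + m) := lshift m ord0; pose r (i : 'I_m) : 'I_(1 + m) := rshift 1 i.
have [x [c [x1 c1 x2 x3]]] : exists x : 'I_m -> K, exists c : K,
  [/\ forall i : 'I_m, dvg (p.-1 * i.+1)%N (x i), dvg 1 (c - 1),
      B l0 l0 + \sum_j tau (x j) * B (r j) l0 = c
    & forall i, B l0 (r i) + \sum_j tau (x j) * B (r j) (r i) = c * x i].
  apply: fixed_row.
  - by have := B3 l0; rewrite expr0 divr1.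
  - by move=> i; have := B2 (r i) l0 isT; rewrite muln0.
  - by move=> i; exact: (B1 l0 (r i)).
  - by move=> i j; exact: (B1 (r i) (r j)).
(* The map induced on the quotient by the row (1, x), divided by p. *)
pose B' : 'M[K]_m := \matrix_(i, j) ((B (r i) (r j) - B (r i) l0 * x j) / p%:R).
have e1 (j : 'I_m) : (p.-1 * (r j))%N = (p.-1 * j + p.-1)%N by rewrite /= add1n mulnS addnC.
have b0 i : dvg 1 (B (r i) l0) by have := B2 (r i) l0 isT; rewrite muln0.
have b2 i j : dvg ((p.-1 * (r j))%N%:Z + 1) (B (r i) l0 * x j) by rewrite addrC; exact: dvgM (x1 j).
have dp (N : int) y : dvg N (y / p%:R) = dvg (N + p.-1%:Z) y.
  by have := dvg_divp N 1 y; rewrite mulr1 expr1.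
have [|G [T [G1 T1 GT T2]]] := IH B'.
  split=> [i j|i j ji|i]; rewrite mxE.
  - rewrite dp -PoszD -e1; apply: dvgB; first exact: B1.
    by apply: dvg_le (b2 i j); rewrite lerDl.
  - rewrite dp addrAC -PoszD -e1; apply: dvgB; [exact: (B2 (r i) (r j))|exact: b2].
  - have -> : (B (r i) (r i) - B (r i) l0 * x i) / p%:R / p%:R ^+ i - 1 =
      B (r i) (r i) / p%:R ^+ (r i) - 1 - B (r i) l0 * x i / p%:R ^+ (r i).
      have -> : p%:R ^+ (r i) = p%:R * p%:R ^+ i :> K by rewrite -exprS.
      have alg (b y q s : K) : q != 0 -> s != 0 -> (b - y) / q / s - 1 = b / (q * s) - 1 - y / (q * s).
        by move=> q0 s0; field; rewrite q0 s0.
      by apply: alg; rewrite ?expf_neq0.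
    apply: dvgB; first exact: B3.
    by rewrite dvg_divp -PoszM addrC.
pose xr : 'rV[K]_m := \row_j x j.
have BE : B = block_mx (B l0 l0)%:M (\row_j B l0 (r j)) (\col_i B (r i) l0)
                       (\matrix_(i, j) B (r i) (r j)).
  rewrite -[LHS]submxK; congr block_mx; apply/matrixP => i j; rewrite !mxE ?ord1 //.
exists (block_mx 1%:M xr 0 G), (block_mx c%:M 0 (map_mx tau G *m \col_i B (r i) l0) (p%:R *: T)); split.
- by rewrite unitmxE det_ublock det1 mul1r -unitmxE.
- rewrite is_trig_block_mx // eqxx /=; apply/andP; split.
    by apply/is_trig_mxP => i j; rewrite !ord1.
  by apply/is_trig_mxP => i j ij; rewrite mxE (is_trig_mxP T1) ?mulr0.
- rewrite [in LHS]BE map_block_mx map_mx1 map_mx0 !mulmx_block !mul1mx !mul0mx !mulmx1 !mulmx0 !mul_scalar_mx !add0r !addr0.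
  congr block_mx.
  + apply/matrixP => i j; rewrite !ord1 !mxE eqxx mulr1n -x2; congr (_ + _).
    by apply: eq_bigr => k _; rewrite !mxE.
  + apply/matrixP => i j; rewrite !mxE -x3; congr (_ + _).
    by apply: eq_bigr => k _; rewrite !mxE.
  + have -> : (\matrix_(i, j) B (r i) (r j)) = p%:R *: B' + (\col_i B (r i) l0) *m xr.
      by apply/matrixP => i j; rewrite !mxE big_ord1 !mxE; field.
    by rewrite mulmxDr -scalemxAr GT -scalemxAl mulmxA addrC.
- move=> i; case: (split_ordP i) => k ->.
    by rewrite block_mxEul !ord1 !mxE eqxx mulr1n expr0 divr1.
  rewrite block_mxEdr mxE /= add1n exprS.
  have -> : p%:R * T k k / (p%:R * p%:R ^+ k) - 1 = T k k / p%:R ^+ k - 1.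
    by field; rewrite pn expf_neq0.
  exact: T2.
Qed.

Lemma char_poly_conj m (G N T : 'M[K]_m) : G \in unitmx -> G *m N = T *m G -> char_poly N = char_poly T.
Proof.
move=> Gu GN; have G0 : \det (map_mx polyC G) != 0.
  by rewrite det_map_mx polyC_eq0 -unitfE -unitmxE.
apply: (mulfI G0); rewrite /char_poly [RHS]mulrC -!det_mulmx; congr (\det _).
rewrite /char_poly_mx mulmxBr mulmxBl -!map_mxM GN; congr (_ - _).
by rewrite mul_mx_scalar mul_scalar_mx.
Qed.

Lemma frob_sum (I : Type) (s : seq I) (c : I -> K) (F : I -> laurent) :
  (forall i, dvg 0 (c i)) -> (forall i, Bd (F i)) ->
  frob (fun u => \sum_(i <- s) c i * F i u) =1 (fun u => \sum_(i <- s) tau (c i) * frob (F i) u).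
Proof.
move=> hc hF; elim: s => [|i s IH] u.
  have -> : (fun u => \sum_(i <- [::]) c i * F i u) = (fun=> 0) by apply: funext => v; rewrite big_nil.
  by rewrite frob_0 big_nil.
have -> : (fun u => \sum_(i <- i :: s) c i * F i u) =
   (fun u => c i * F i u + \sum_(i <- s) c i * F i u) by apply: funext => v; rewrite big_cons.
have hi : Bd (fun u => c i * F i u) by exact: BdZ.
have hs : Bd (fun u => \sum_(i <- s) c i * F i u) by apply: Bd_sum => t; exact: BdZ.
by rewrite (frobD hi hs u) big_cons; congr (_ + _); [exact: frobZ|exact: IH].
Qed.

Lemma Cz_frob f : Bd f -> Cz (frob f).
Proof. by move=> hf; apply: Ld_Cz; exact: Ld_frob. Qed.

Lemma DC_frob f : DC f -> DC (frob f).
Proof.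
move=> [g hg gE]; have -> : f = (fun u => \sum_l 1 * Dl l (g l) u).
  by apply: funext => u; rewrite gE; apply: eq_bigr => l _; rewrite mul1r.
have hB l : Bd (g l) by case: (hg l).
exists (fun l u => p%:R * frob (g l) u) => [l|u].
  by apply: CzZ; [exact: dvg_nat|exact: Cz_frob].
rewrite frob_sum => [|l|l]; [|exact: dvg1|by apply: Bd_Dg].
apply: eq_bigr => l _; rewrite rmorph1 mul1r frob_Dg // [RHS]DgZ //; exact: Bd_frob.
Qed.

(** Semilinearity makes the matrix N of the k-th iterate a twisted product of conjugates of B. A
    twisted conjugation of B to T carries over to N and the twisted product of T, with the k-th
    conjugate of G on the left. *)
Lemma iter_frob (k : nat) (B : 'M[K]_n.+1) : (forall i j, dvg 0 (B i j)) ->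
  (forall j, DC (fun u => frob (corner_monom j) u - \sum_i B j i * corner_monom i u)) ->
  exists2 N : 'M[K]_n.+1, (forall i j, dvg 0 (N i j)) /\
   (forall G T : 'M[K]_n.+1, map_mx tau G *m B = T *m G ->
      iter k (map_mx tau) G *m N = iter k (fun S : 'M[K]_n.+1 => map_mx tau S *m T) 1%:M *m G) &
   forall j, DC (fun u => iter k frob (corner_monom j) u - \sum_i N j i * corner_monom i u).
Proof.
move=> hB hD; elim: k => [|k [N [N0 NG] ND]].
  exists 1%:M; first split=> [i j|G T _].
  - by rewrite mxE; exact: dvg_nat.
  - by rewrite mulmx1 mul1mx.
  - move=> j; apply: DC_ext DC0' => u /=; rewrite (bigD1 j) //= mxE eqxx mul1r big1 ?addr0 ?subrr // => i.
    by rewrite mxE eq_sym => /negbTE ->; rewrite mul0r.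
exists (map_mx tau N *m B); first split=> [i j|G T GT].
- rewrite mxE; apply: dvg_sum => l _; rewrite mxE; apply: dvgM0 => //; exact: tau_dvg.
- by rewrite !iterS mulmxA -map_mxM (NG G T GT) map_mxM -!mulmxA GT.
move=> j; pose S u := \sum_i N j i * corner_monom i u; pose f u := iter k frob (corner_monom j) u - S u.
have Beb i : Bd (corner_monom i) by exact: Bd_monom.
have fD : DC f := ND j.
have [fB _] := DC_Cz fD.
have SB : Bd S by apply: Bd_sum => i; exact: BdZ.
have fS : iter k frob (corner_monom j) = (fun u => f u + S u) by apply: funext => u; rewrite /f subrK.
have h2 : DC (fun u => \sum_i tau (N j i) * (frob (corner_monom i) u - \sum_l B i l * corner_monom l u)).
  suff H (I : seq 'I_n.+1) : DC (fun u => \sum_(i <- I) tau (N j i) * (frob (corner_monom i) u - \sum_l B i l * corner_monom l u)) by exact: H.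
  elim: I => [|i I IH]; first by apply: DC_ext DC0' => u; rewrite big_nil.
  apply: DC_ext (DCD (DCZ (tau_dvg (N0 j i)) (hD i)) IH) => u; by rewrite big_cons.
apply: DC_ext (DCD (DC_frob fD) h2) => u.
rewrite iterS fS (frobD fB SB u) (frob_sum _ (N0 j) Beb u) -addrA; congr (_ + _).
rewrite -sumrB (eq_bigr (fun i => tau (N j i) * frob (corner_monom i) u - tau (N j i) * \sum_l B i l * corner_monom l u)); last first.
  by move=> i _; rewrite mulrBr.
rewrite !sumrB; congr (_ - _).
rewrite (eq_bigr (fun i => \sum_l tau (N j i) * (B i l * corner_monom l u))); last by move=> i _; rewrite mulr_sumr.
rewrite exchange_big; apply: eq_bigr => l _; rewrite mxE mulr_suml; apply: eq_bigr => i _.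
by rewrite mxE mulrA.
Qed.

(** The diagonal entries of the twisted product are norms of the T i i over the group generated by
    tau. Since tau^a = 1 they are tau-invariant, and dividing each conjugate by p^i leaves a factor
    congruent to 1. *)
Lemma frob_eigenvalues (a : nat) : (forall x, iter a tau x = x) ->
  exists M : 'M[K]_n.+1, exists omega : 'I_n.+1 -> K,
  [/\ forall j, DC (fun u => iter a frob (corner_monom j) u - \sum_i M j i * corner_monom i u),
      char_poly M = \prod_i ('X - (omega i)%:P), forall i, tau (omega i) = omega i
    & forall i, dvg 1 (omega i / (p ^ a)%N%:R ^+ i - 1)].
Proof.
move=> tau_a; have pn := pnat_neq0 ord_val ord_p.
have [A [A1 A2 A3 A4]] := frob_matrix.
have okA : slope_mx A^T.
  split=> [i j|i j ji|i]; rewrite mxE.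
  - by have := A1 j i; rewrite dvg_divp add0r PoszM.
  - by have := A2 j i ji; rewrite dvg_divp addrC PoszM.
  - exact: A3.
have [G [T [Gu Tt GT T1]]] := frobenius_triangular okA.
have [|j|N [_ NG] ND] := @iter_frob a A^T.
- by case: okA => h _ _ i j; apply: dvg_le (h i j).
- by apply: DC_ext (A4 j) => u; congr (_ - _); apply: eq_bigr => i _; rewrite mxE.
pose Tk k := iter k (fun S : 'M[K]_n.+1 => map_mx tau S *m T) 1%:M.
have Tk_trig k : is_trig_mx (Tk k) /\ forall i, Tk k i i = \prod_(s < k) iter s tau (T i i).
  elim: k => [|k [h1 h2]].
    split; first by apply/is_trig_mxP => i j; rewrite mxE; case: eqP => [->|]; rewrite ?ltnn.
    by move=> i; rewrite big_ord0 mxE eqxx.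
  have e1 i j : Tk k.+1 i j = \sum_l tau (Tk k i l) * T l j.
    by rewrite [Tk _]iterS mxE; apply: eq_bigr => l _; rewrite mxE.
  split.
    apply/is_trig_mxP => i j ij; rewrite e1 big1 // => l _.
    have [il|li] := ltnP i l; first by rewrite (is_trig_mxP h1 _ _ il) rmorph0 mul0r.
    by rewrite (is_trig_mxP Tt _ _ (leq_ltn_trans li ij)) mulr0.
  move=> i; rewrite e1 (bigD1 i) //= big1 ?addr0 => [|l li]; last first.
    have [il|] := ltnP i l; first by rewrite (is_trig_mxP h1 _ _ il) rmorph0 mul0r.
    rewrite leq_eqVlt => /orP[/eqP /val_inj e2|li']; first by rewrite e2 eqxx in li.
    by rewrite (is_trig_mxP Tt _ _ li') mulr0.
  by rewrite h2 rmorph_prod big_ord_recl /= mulrC.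
(* For k = a the twisted conjugation becomes a genuine one, so characteristic polynomials agree. *)
have Ga : iter a (map_mx tau) G = G.
  apply/matrixP => i j; rewrite -[RHS](tau_a (G i j)); elim: a {tau_a N NG ND} => // k IH.
  by rewrite !iterS mxE IH.
have [Ta Td] := Tk_trig a.
exists N, (fun i => Tk a i i); split=> // [|i|i].
- by rewrite (char_poly_conj Gu (T := Tk a)) ?char_poly_trig // -[in LHS]Ga (NG G T GT).
- have [t0 _] := dvg_unit (T1 i); have t0' : T i i != 0 by apply: contraNneq t0 => ->; rewrite mul0r.
  apply: (mulIf t0'); rewrite Td rmorph_prod.
  have h : \prod_(s < a.+1) iter s tau (T i i) = T i i * \prod_(s < a) tau (iter s tau (T i i)).
    by rewrite big_ord_recl.
  have h' : \prod_(s < a.+1) iter s tau (T i i) = \prod_(s < a) iter s tau (T i i) * T i i.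
    by rewrite big_ord_recr /= tau_a.
  by rewrite -h' h mulrC.
- rewrite Td natrX -exprM mulnC exprM.
  have -> : (p%:R ^+ i) ^+ a = \prod_(s < a) (p%:R ^+ i) :> K by rewrite prodr_const card_ord.
  rewrite -prodf_div; elim/big_ind: _ => [|x y|s _]; [by rewrite subrr dvg0|exact: dvg1_mul|].
  elim: (s : nat) => [|k IH]; first exact: T1.
  by have := tau_dvg IH; rewrite rmorphB rmorph1 fmorph_div rmorphXn rmorph_nat.
Qed.

(** * Return to C_0, its quotient and alpha_0 *)

Variables (O0 : K -> Prop) (sigma : 'AEnd(K)).
Hypotheses (O0E : forall x, O0 x <-> vge 0 x) (tauE : forall x, tau x = (sigma^-1)%VF x).

Lemma C0_Cz f : C0 ord gamma O0 f <-> Cz f.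
Proof.
have xiE (xi : laurent) : (forall u, f u = xi u * gamma ^ weight u) -> forall u, xi u = f u / gamma ^ weight u.
  by move=> h u; rewrite h mulfK // gammaz_neq0.
split=> [[xi [h1 h2 h3]]|[fB fT]].
  split=> [u|m].
    by rewrite h3 dvg_mulgz subrr dvg_vge0; apply/O0E.
  have [S hS] := h2 m; exists S => u /hS hu; rewrite h3 addrC dvg_mulgz addrK.
  have hu' : vge m%:R (xi u) by exact: hu.
  apply: (vge_le ord_val _ hu'); rewrite -pmulrn ler_piMr // /e invf_le1 ?ler1n ?ltr0n //.
    by have := prime_gt1 p_prime; case: (p) => [|[]].
  by have := prime_gt1 p_prime; case: (p) => [|[]].
exists (fun u => f u / gamma ^ weight u); split=> [u||u].
- by apply/O0E; rewrite -dvg_vge0 dvg_divgz add0r; exact: fB.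
- by apply: tends_dvg => m; have [S hS] := fT m; exists S => u /hS; rewrite dvg_divgz addrC.
- by rewrite divfK // gammaz_neq0.
Qed.

Lemma DC0_DC f : DC0 p ord gamma lambda O0 f <-> DC f.
Proof.
have E (g : 'I_n -> laurent) : (forall l, Cz (g l)) -> forall u,
    \sum_l Dop p ord gamma lambda l (g l) u = \sum_l Dl l (g l) u.
  by move=> hg u; apply: eq_bigr => l _; apply: Dop_Dg; case: (hg l).
split=> -[g hg gE]; exists g.
- by move=> l; apply/C0_Cz.
- by move=> u; rewrite gE E // => l; apply/C0_Cz.
- by move=> l; apply/C0_Cz; exact: hg.
- by move=> u; rewrite gE E.
Qed.

Lemma alpha0_frob a f : alpha0 p ord gamma lambda sigma a f = iter a frob f.
Proof.
by apply: eq_iter => g; apply: funext => u; rewrite /alpha1 /frob tauE.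
Qed.

(** Only c f is known to satisfy [Bd], so semilinearity is applied to c f with the scalar c^-1. *)
Lemma frob_scaled c f : c != 0 -> Bd (fun u => c * f u) ->
  (fun u => tau c * frob f u) = frob (fun u => c * f u).
Proof.
move=> c0 h; apply: funext => u.
have -> : frob f u = tau c^-1 * frob (fun u => c * f u) u.
  rewrite -(frobZ c^-1 h u); congr (frob _ u).
  by apply: funext => v; rewrite mulKf.
by rewrite mulrA -rmorphM divff // rmorph1 mul1r.
Qed.

Lemma extend_scalars_stable (P : laurent -> Prop) f : (forall g, P g -> Bd g) ->
  (forall g, P g -> P (frob g)) -> forall a, extend_scalars P f -> extend_scalars P (iter a frob f).
Proof.
move=> PB Pal; elim=> // a IH /IH[c c0 hc]; exists (tau c); first by rewrite fmorph_eq0.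
by rewrite iterS (frob_scaled c0 (PB _ hc)); exact: Pal.
Qed.

Lemma alpha0_eigenvalues (a : nat) : (forall x, iter a tau x = x) ->
  exists omega : 'I_n.+1 -> K,
  [/\ quotient_eigenvalues (extend_scalars (C0 (n := n) ord gamma O0))
        (extend_scalars (DC0 (n := n) p ord gamma lambda O0)) (alpha0 p ord gamma lambda sigma a) omega,
      forall i, tau (omega i) = omega i
    & forall i, dvg 1 (omega i / (p ^ a)%N%:R ^+ i - 1)].
Proof.
move=> tau_a; have [M [om [M1 M2 M3 M4]]] := frob_eigenvalues tau_a.
have Ceq : C0 ord gamma O0 = Cz :> (laurent -> Prop) by apply: funext => f; apply: propext; exact: C0_Cz.
have Deq : DC0 p ord gamma lambda O0 = DC :> (laurent -> Prop).
  by apply: funext => f; apply: propext; exact: DC0_DC.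
have aeq : alpha0 p ord gamma lambda sigma a = iter a frob :> (laurent -> laurent).
  by apply: funext => f; exact: alpha0_frob.
exists om; split=> //; rewrite Ceq Deq aeq.
split=> [f [c c0 /DC_Cz hc]|f hf|f hf|]; first by exists c.
- by apply: extend_scalars_stable hf => g [gB _] //; exact: Cz_frob.
- apply: extend_scalars_stable hf => g; last exact: DC_frob.
  by move=> /DC_Cz[].
exists corner_monom, M; split=> //.
- move=> i; exists 1; first exact: oner_neq0.
  by apply: Cz_ext (Cz_monom (corner i)) => u; rewrite mul1r.
- move=> c [d d0 hd'] i; have h : DC (fun u => \sum_i (d * c i) * corner_monom i u).
    by apply: DC_ext hd' => u; rewrite mulr_sumr; apply: eq_bigr => j _; rewrite mulrA.
  have /eqP := corner_monom_indep h i; rewrite mulf_eq0 (negbTE d0) /= => /eqP; exact.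
- move=> f [d d0 hf]; have [c [h [_ hD] hE]] := red_main hf.
  exists (fun i => d^-1 * c i), d => //; apply: DC_ext hD => u.
  rewrite mulrBr hE mulr_sumr; have -> : \sum_i d * (d^-1 * c i * corner_monom i u) = \sum_i c i * corner_monom i u.
    by apply: eq_bigr => i _; rewrite !mulrA divff // mul1r.
  by rewrite addrC addrA addNr add0r.
- move=> i; exists 1; first exact: oner_neq0.
  by apply: DC_ext (M1 i) => u; rewrite mul1r.
Qed.

End Laurent.

(** Used to present sigma^(a-1), the inverse of sigma, as a ring morphism. *)
Lemma iter_rmorphism (R : pzRingType) (s : {rmorphism R -> R}) k :
  exists t : {rmorphism R -> R}, forall x, t x = iter k s x.
Proof.
elim: k => [|k [t ht]]; first by exists idfun.
by exists (s \o t) => x; rewrite /= ht.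
Qed.

Theorem theorem1p7
  (p a n : nat) (p_prime : prime p) (a_gt0 : (0 < a)%N) (n_gt0 : (0 < n)%N)
  (* Q_p, with its valuation ord_p *)
  (Qp : fieldType) (ordp : Qp -> \bar rat) (Qp_padic : padic_numbers p ordp)
  (* Omega_0 = Q_q(zeta_p), with Q_q unramified of degree a over Q_p *)
  (K : fieldExtType Qp) (ord : K -> \bar rat) (ord_val : valuation ord)
  (ord_ext : forall x : Qp, ord (x%:A) = ordp x)
  (Qq : {subfield K}) (Qq_deg : \dim Qq = a) (Qq_unram : unramified ord Qq)
  (zeta : K) (zeta_prim : p.-primitive_root zeta)
  (K_gen : <<Qq; zeta>>%VS = fullv)
  (* the residue field F_q of Z_q *)
  (Fq : finFieldType) (Fq_card : #|Fq| = (p ^ a)%N)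
  (red : K -> Fq) (red_res : residue_map ord (integers_of ord Qq) red)
  (* the Frobenius automorphism *)
  (sigma : 'AEnd(K)) (sigma_zeta : sigma zeta = zeta)
  (sigma_frob : {in integers_of ord Qq, forall x,
      sigma x \in integers_of ord Qq /\ red (sigma x) = red x ^+ p})
  (gamma : K) (gammaP : is_gamma p ord gamma)
  (* lambda is the Teichmueller lift of lambdabar *)
  (lambdabar : Fq) (lambdabar_neq0 : lambdabar != 0)
  (lambda : K) (lambda_Zq : lambda \in integers_of ord Qq)
  (lambda_teich : lambda ^+ (p ^ a) = lambda) (lambda_red : red lambda = lambdabar) :
  let Zp := integers_of ord 1%AS in
  let O0 := adjoin (integers_of ord Qq) zeta in
  exists omega : 'I_n.+1 -> K,
    [/\ quotient_eigenvalues
          (extend_scalars (C0 (n := n) ord gamma O0))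
          (extend_scalars (DC0 (n := n) p ord gamma lambda O0))
          (alpha0 p ord gamma lambda sigma a) omega,
        forall i, adjoin Zp zeta (omega i)
      & forall i, congr_mod O0 gamma (omega i / ((p ^ a)%N%:R ^+ i)) 1].
Proof.
move=> Zp O0.
have ordP := ord_p Qp_padic ord_ext.
have p_gt1 := prime_gt1 p_prime.
have a_gt0' := a_gt0.
have O0E x : O0 x <-> vge ord 0 x by eapply adjoin_Zq; eassumption.
have cpl : complete_valuation ord by eapply K_complete; eassumption.
have sK x : sig sigma a x = x by eapply sigma_order; eassumption.
have sV x : (sigma^-1)%VF x = sig sigma a.-1 x by eapply sigma_unitV; eassumption.
have g0 : gamma != 0 by eapply gamma_neq0; eassumption.
have vg : vl ord gamma = p.-1%:R^-1 by eapply vl_gamma; eassumption.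
have gp : exists2 x, dvg p ord 1 x & gamma ^+ p.-1 = - p%:R * (1 + x).
  rewrite /dvg mul1r; eapply gammaX_p; eassumption.
have gc m : vge ord ((p ^ m)%:R * p.-1%:R^-1 + ((p ^ m)%:R - 1)) (p%:R ^+ m * gamma_ p gamma m).
  by eapply gamma__coef; eassumption.
have sg k : sig sigma k gamma = gamma by eapply sig_gamma; eassumption.
have s0 k x : vge ord 0 x -> vge ord 0 (sig sigma k x) by eapply sig_vge0; eassumption.
have sl : sigma lambda = lambda ^+ p by eapply sigma_lambda; eassumption.
have [l0 vl0] : lambda != 0 /\ vl ord lambda = 0 by eapply lambda_unit; eassumption.
have fix_adj x : vge ord 0 x -> sigma x = x -> adjoin Zp zeta x by eapply fixed_adjoin; eassumption.
have res1 x : x \in (1%AS : {subfield K}) -> vge ord 0 x -> vge ord 1 (x ^+ p - x) by eapply Qp_frobenius; eassumption.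
have AHi m : vge ord 0 (AH p K m) by eapply AH_integral; eassumption.
have [tau tauE] := iter_rmorphism (sigma : {rmorphism K -> K}) a.-1.
have sa x : sig sigma a.-1 (sigma x) = x by rewrite -[RHS]sK -[in RHS](prednK a_gt0) /sig iterSr.
have sa' x : sigma (sig sigma a.-1 x) = x by rewrite -[RHS]sK -[in RHS](prednK a_gt0).
have tau_sig x : tau (sigma x) = x by rewrite tauE; exact: sa.
have tau_a x : iter a tau x = x.
  have h k : iter k sigma (iter k tau x) = x.
    elim: k => // k IH; rewrite [iter k.+1 tau x]iterS iterSr.
    have -> : sigma (tau (iter k tau x)) = iter k tau x by rewrite tauE; exact: sa'.
    exact: IH.
  by rewrite -[LHS]sK; exact: h.
have tg : tau gamma = gamma by rewrite tauE; exact: sg.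
have tl : tau (lambda ^+ p) = lambda by rewrite -sl.
have t0 x : vge ord 0 x -> vge ord 0 (tau x) by rewrite tauE; exact: s0.
have tV x : tau x = (sigma^-1)%VF x by rewrite tauE sV.
have [om [h1 h2 h3]] : exists omega : 'I_n.+1 -> K,
  [/\ quotient_eigenvalues (extend_scalars (C0 (n := n) ord gamma O0))
        (extend_scalars (DC0 (n := n) p ord gamma lambda O0)) (alpha0 p ord gamma lambda sigma a) omega,
      forall i, tau (omega i) = omega i
    & forall i, dvg p ord 1 (omega i / (p ^ a)%N%:R ^+ i - 1)].
  by eapply alpha0_eigenvalues; eassumption.
exists om; split=> // i.
(* Each eigenvalue is integral, being q^i times an element congruent to 1, and sigma fixes it
   because its inverse tau does. *)
- apply: fix_adj; last by rewrite -{1}(h2 i) tauE; exact: sa'.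
  have q0 : (p ^ a)%N%:R ^+ i != 0 :> K by rewrite natrX !expf_neq0 // (pnat_neq0 ord_val ordP).
  rewrite -[om i](divfK q0) -(dvg_vge0 p) -[_ / _](subrK 1); apply: dvgM0 => //.
    apply: (dvgD ord_val); last exact: dvg1.
    by apply: (dvg_le p_prime ord_val _ (h3 i)).
  by rewrite -natrX; exact: dvg_nat.
exists ((om i / (p ^ a)%N%:R ^+ i - 1) / gamma); last by rewrite [RHS]mulrC divfK.
by apply/O0E; rewrite -(dvg_vge0 p) -[gamma]expr1z dvg_divgz.
Qed.
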